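(* Let $d\geq 2$ and let $0\leq \gamma \leq 1\leq \beta <d$ be fixed. Then for all $\tilde \gamma, \alpha, \tilde \beta$ satisfying $$0\leq\tilde \gamma \leq\gamma,\quad \tilde \beta \geq 0,\quad \beta -2 < \tilde \beta \leq \beta,\quad 0 < \alpha <1,\quad \beta -\tilde \beta -1< \alpha < d-\tilde\beta,$$ there exists a positive constant $\delta=\delta_{\gamma,\tilde \gamma,\alpha,\beta,\tilde \beta,d}$, depending only on the indicated parameters, such that for all $u_0 \in L^\infty(|x|^\gamma\mathrm{d}x) \cap L^\infty(|x|^\beta\mathrm{d}x)$ (with values in $\mathbb{R}^d$) with $\operatorname{div}(u_0) = 0$ satisfying $$\sup_{x \in \mathbb{R}^d,\, t>0}\Big(|x|^{\tilde \gamma}t^{\frac{1}{2}(\gamma-\tilde \gamma)} + |x|^\alpha t^{\frac{1}{2}(1-\alpha)}+|x|^{\tilde\beta} t^{\frac{1}{2}(\beta-\tilde \beta)}\Big)|(e^{t\Delta}u_0)(x)|\leq \delta,$$ the Navier-Stokes equations with initial datum $u_0$ have a global mild solution $u$ on $(0,\infty) \times \mathbb{R}^d$ such that $$\sup_{x \in \mathbb{R}^d,\, t>0}\Big(|x|^{\gamma}+t^{\frac{\gamma}{2}} +|x|^\beta +t^{\frac{\beta}{2}}\Big)|u(x,t)| <+\infty.$$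
   Context: For $\beta\geq 0$, $L^\infty(|x|^\beta\mathrm{d}x)$ denotes the space of measurable (scalar- or vector-valued) functions $u$ on $\mathbb{R}^d$ with $\|u\|_{L^\infty(|x|^\beta\mathrm{d}x)}:=\operatorname{ess\,sup}_{x\in\mathbb{R}^d}|x|^\beta|u(x)|<+\infty$. The heat semigroup is $e^{t\Delta}u=(4\pi t)^{-d/2}e^{-|\cdot|^2/(4t)}*u$. The Navier-Stokes equations are $\partial_t u=\Delta u-\nabla\cdot(u\otimes u)-\nabla p$, $\nabla\cdot u=0$, $u(0,x)=u_0$ on $\mathbb{R}^d$. A mild solution on the time interval from $0$ to $T$ ($T=\infty$ for a global one) with divergence-free initial datum $u_0$ is a function $u$ solving the integral equation $$u(t) = e^{t\Delta}u_0 - \int_{0}^{t} e^{(t-\tau) \Delta} \mathbb{P}\nabla\cdot\big(u(\tau)\otimes u(\tau)\big)\,\mathrm{d}\tau .$$ Here $(u\otimes v)_{ij}=u_iv_j$, $(\nabla\cdot F)_i=\sum_{j=1}^d\partial_jF_{ij}$ for a tensor $F=(F_{ij})$, and $\mathbb{P}$ is the Helmholtz-Leray projection $(\mathbb{P}f)_j=f_j+\sum_{k=1}^dR_jR_kf_k$ with $\widehat{R_jg}(\xi)=\frac{i\xi_j}{|\xi|}\hat g(\xi)$. The operator $e^{t\Delta}\mathbb{P}\nabla\cdot$ acts by convolution with its (integrable) kernel: its $j$-th component on $F$ is $\sum_{k,l}K^t_{jkl}*F_{kl}$ with $\widehat{K^t_{jkl}}(\xi)=(\delta_{jk}-\xi_j\xi_k/|\xi|^2)\,i\xi_l\,e^{-t|\xi|^2}$.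 *)

(* Defs.v *)
From HB Require Import structures.
From mathcomp Require Import all_boot all_order all_algebra.
From mathcomp Require Import all_classical all_reals all_analysis.
From mathcomp Require Import ess_sup_inf.
From mathcomp Require Import complex.

Set Implicit Arguments.
Unset Strict Implicit.
Unset Printing Implicit Defensive.

Import Order.TTheory GRing.Theory Num.Theory.
Import numFieldNormedType.Exports.

Local Open Scope classical_set_scope.
Local Open Scope ring_scope.

(* R^d is 'rV[R]_d, with the sigma-algebra generated by the coordinates (the
   same construction as the one of the library on d.-tuple R). *)
Section measurable_rV.
Context {R : realType} (n : nat).

Let coord : 'I_n -> 'rV[R]_n -> R := fun i x => x ord0 i.

Let rV_set0 : g_sigma_preimage coord set0.
Proof. exact: sigma_algebra0. Qed.

Let rV_setC A : g_sigma_preimage coord A -> g_sigma_preimage coord (~` A).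
Proof. exact: sigma_algebraC. Qed.

Let rV_bigcup (F : _^nat) : (forall i, g_sigma_preimage coord (F i)) ->
  g_sigma_preimage coord (\bigcup_i (F i)).
Proof. exact: sigma_algebra_bigcup. Qed.

Definition rV_display : measure_display.
Proof. exact. Qed.

HB.instance Definition _ := @isMeasurable.Build rV_display
  'rV[R]_n (g_sigma_preimage coord) rV_set0 rV_setC rV_bigcup.

Lemma measurable_coord (i : 'I_n) :
  measurable_fun [set: 'rV[R]_n] (fun x => x ord0 i).
Proof.
move=> _ Y mY; rewrite setTI; apply: sub_sigma_algebra => /=.
rewrite -bigcup_seq/=; exists i => /=; first by rewrite mem_index_enum.
by exists Y => //; rewrite setTI.
Qed.

Lemma measurable_fun_rV d (T : measurableType d) (f : T -> 'rV[R]_n) :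
  (forall i, measurable_fun [set: T] (fun x => f x ord0 i)) ->
  measurable_fun [set: T] f.
Proof.
move=> mf _ A mA; rewrite setTI.
have : preimage_set_system [set: T] f (g_sigma_preimage coord) (f @^-1` A).
  by exists A => //; rewrite setTI.
rewrite -g_sigma_preimage_comp; apply: smallest_sub.
  exact: sigma_algebra_measurable.
rewrite -bigcup_seq; apply: bigcup_sub => i _ B [C mC <-].
exact: mf.
Qed.

End measurable_rV.

Section lebesgue_rV.
Context {R : realType}.

Definition cons_rV n (p : measurableTypeR R * 'rV[R]_n) : 'rV[R]_n.+1 :=
  row_mx (p.1)%:M p.2.

Definition uncons_rV n (x : 'rV[R]_n.+1) : measurableTypeR R * 'rV[R]_n :=
  (x ord0 ord0, \row_i x ord0 (lift ord0 i)).

Lemma cons_rV0 n p : @cons_rV n p ord0 ord0 = p.1.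
Proof.
have -> : ord0 = @lshift 1 n ord0 :> 'I_n.+1 by exact/val_inj.
by rewrite /cons_rV (@row_mxEl _ 1 1 n) mxE eqxx.
Qed.

Lemma cons_rVS n p (j : 'I_n) : @cons_rV n p ord0 (lift ord0 j) = p.2 ord0 j.
Proof.
have -> : lift ord0 j = @rshift 1 n j :> 'I_n.+1 by exact/val_inj.
exact: (@row_mxEr _ 1 1 n).
Qed.

Lemma measurable_cons_rV n : measurable_fun setT (@cons_rV n).
Proof.
apply: measurable_fun_rV => i.
case: (unliftP ord0 i) => [j ->|->].
  apply: (eq_measurable_fun ((fun x : 'rV[R]_n => x ord0 j) \o snd)).
    by move=> p _; rewrite /= cons_rVS.
  exact: measurableT_comp (measurable_coord j) measurable_snd.
apply: (eq_measurable_fun fst); last exact: measurable_fst.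
by move=> p _; rewrite cons_rV0.
Qed.

Lemma measurable_uncons_rV n : measurable_fun setT (@uncons_rV n).
Proof.
apply/measurable_fun_pairP; split; first exact: measurable_coord.
apply: measurable_fun_rV => i /=.
apply: (eq_measurable_fun (fun x : 'rV[R]_n.+1 => x ord0 (lift ord0 i))).
  by move=> x _; rewrite /= mxE.
exact: measurable_coord.
Qed.

Lemma cons_rVK n : cancel (@cons_rV n) (@uncons_rV n).
Proof.
move=> [a v]; rewrite /uncons_rV cons_rV0; congr pair.
by apply/rowP => i; rewrite mxE cons_rVS.
Qed.

Section pushforward_cons.
Context n (mu : {sigma_finite_measure set 'rV[R]_n -> \bar R}).

Definition lebesgue_cons : set 'rV[R]_n.+1 -> \bar R :=
  pushforward (lebesgue_measure \x mu)%E (@cons_rV n).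

Let mcons A : measurable A -> measurable (@cons_rV n @^-1` A).
Proof.
by move=> mA; rewrite -[X in measurable X]setTI; exact: measurable_cons_rV.
Qed.

Let lebesgue_cons0 : lebesgue_cons set0 = 0%E.
Proof. by rewrite /lebesgue_cons /pushforward preimage_set0 measure0. Qed.

Let lebesgue_cons_ge0 A : (0 <= lebesgue_cons A)%E.
Proof. by rewrite /lebesgue_cons /pushforward measure_ge0. Qed.

Let lebesgue_cons_sigma_additive : semi_sigma_additive lebesgue_cons.
Proof.
move=> F mF tF mUF; rewrite /lebesgue_cons /pushforward preimage_bigcup.
apply: measure_semi_sigma_additive; first by move=> i; exact: mcons.
- apply/trivIsetP => i j _ _ ij; rewrite -preimage_setI.
  by move/trivIsetP : tF => /(_ _ _ I I ij) ->; rewrite preimage_set0.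
- by rewrite -preimage_bigcup; exact: mcons.
Qed.

HB.instance Definition _ := isMeasure.Build _ _ _ lebesgue_cons
  lebesgue_cons0 lebesgue_cons_ge0 lebesgue_cons_sigma_additive.

Let lebesgue_cons_sigma_finite : sigma_finite setT lebesgue_cons.
Proof.
have /sigma_finiteP[F [FT ndF Foo]] := sigma_finiteT (@lebesgue_measure R).
have /sigma_finiteP[G [GT ndG Goo]] := sigma_finiteT mu.
exists (fun i => @uncons_rV n @^-1` (F i `*` G i)).
  apply/esym; rewrite -subTset => x _.
  have [i _ Fi] : (\bigcup_i F i) (uncons_rV x).1 by rewrite -FT.
  have [j _ Gj] : (\bigcup_i G i) (uncons_rV x).2 by rewrite -GT.
  exists (maxn i j) => //; split => /=.
    by move: Fi; exact/subsetPset/ndF/leq_maxl.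
  by move: Gj; exact/subsetPset/ndG/leq_maxr.
move=> i; have [mF Fi] := Foo i; have [mG Gi] := Goo i; split.
  rewrite -[X in measurable X]setTI; apply: measurable_uncons_rV => //.
  exact: measurableX.
rewrite /lebesgue_cons /pushforward -comp_preimage.
rewrite (_ : _ \o _ = id) ?preimage_id; last first.
  by apply/funext => p; exact: cons_rVK.
by rewrite product_measure1E// lte_mul_pinfty// ge0_fin_numE.
Qed.

HB.instance Definition _ :=
  Measure_isSigmaFinite.Build _ _ _ lebesgue_cons lebesgue_cons_sigma_finite.

End pushforward_cons.

Fixpoint lebesgue_rV n : {sigma_finite_measure set 'rV[R]_n -> \bar R} :=
  if n is n'.+1 then lebesgue_cons (lebesgue_rV n') else \d_ (0 : 'rV[R]_0).

End lebesgue_rV.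

Section navier_stokes.
Context {R : realType} {d : nat}.
Local Notation E := 'rV[R]_d.
Local Notation leb := (@lebesgue_rV R d).
Implicit Types (x y xi : E) (t : R).

(* The library norm of 'rV[R]_d is the max norm. *)
Definition dotp x y : R := \sum_i x ord0 i * y ord0 i.
Definition enorm x : R := Num.sqrt (dotp x x).

Definition weighted_Linfty (beta : R) (u : E -> E) : Prop :=
  measurable_fun setT u /\
  (ess_sup leb (fun x => (enorm x `^ beta * enorm (u x))%:E) < +oo)%E.

Definition e_ (i : 'I_d) : E := delta_mx ord0 i.

Definition iter_partial (s : seq 'I_d) (phi : E -> R) : E -> R :=
  foldr (fun i f => 'D_(e_ i) f) phi s.

Definition test_function (phi : E -> R) : Prop :=
  [/\ forall s, continuous (iter_partial s phi),
      forall s i x, derivable (iter_partial s phi) x (e_ i) &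
      compact (closure [set x | phi x != 0])].

(* div u = 0 in the sense of distributions *)
Definition divergence_free (u : E -> E) : Prop :=
  forall phi, test_function phi ->
    \int[leb]_x (\sum_i u x ord0 i * 'D_(e_ i) phi x) = 0.

Definition convol (f g : E -> R) x : R := \int[leb]_y (f (x - y) * g y).

Definition heat_kernel t x : R :=
  (4 * pi * t) `^ (- (d%:R / 2)) * expR (- (enorm x ^+ 2 / (4 * t))).

Definition heat t (u : E -> E) x : E :=
  \row_j convol (heat_kernel t) (fun y => u y ord0 j) x.

(* normalized so that the transform of 'D_(e_ l) f is i xi_l times that of f *)
Definition fourier (f : E -> R) xi : R[i] :=
  Complex (\int[leb]_x (f x * cos (dotp x xi)))
          (- \int[leb]_x (f x * sin (dotp x xi))).

Definition oseen_symbol t (j k l : 'I_d) xi : R[i] :=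
  Complex 0 (((j == k)%:R - xi ord0 j * xi ord0 k / enorm xi ^+ 2)
             * xi ord0 l * expR (- (t * enorm xi ^+ 2))).

(* The kernel of e^{t Delta} P div is prescribed by its Fourier transform, which
   determines it up to a null set, and hence determines all convolutions. *)
Definition is_oseen_kernel (K : R -> 'I_d -> 'I_d -> 'I_d -> E -> R) : Prop :=
  forall t, 0 < t -> forall j k l,
    leb.-integrable setT (EFin \o K t j k l) /\
    forall xi, fourier (K t j k l) xi = oseen_symbol t j k l xi.

Definition tensor (u v : E -> E) x : 'M[R]_d := (u x)^T *m v x.

Definition oseen (K : R -> 'I_d -> 'I_d -> 'I_d -> E -> R) t
    (F : E -> 'M[R]_d) x : E :=
  \row_j \sum_k \sum_l convol (K t j k l) (fun y => F y k l) x.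

(* Integrals are total in the library: the two integrability clauses say that
   those of the Duhamel term are genuine. *)
Definition mild_solution (T : \bar R) (u0 : E -> E) (u : R -> E -> E) : Prop :=
  measurable_fun ([set t | 0 < t /\ (t%:E < T)%E] `*` setT)
    (fun p : R * E => u p.1 p.2) /\
  exists2 K, is_oseen_kernel K &
    forall t, 0 < t -> (t%:E < T)%E -> forall x,
    [/\ forall tau, 0 < tau < t -> forall j k l,
          leb.-integrable setT (fun y =>
            (K (t - tau) j k l (x - y)
             * tensor (u tau) (u tau) y k l)%:E),
        forall j, lebesgue_measure.-integrable `]0, t[
          (fun tau => (oseen K (t - tau) (tensor (u tau) (u tau)) x ord0 j)%:E) &
        u t x = heat t u0 x - \row_j \int[lebesgue_measure]_(tau in `]0, t[)
          oseen K (t - tau) (tensor (u tau) (u tau)) x ord0 j].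

Definition sup_spacetime (f : R -> E -> R) : \bar R :=
  ereal_sup [set (f t x)%:E | t in [set t | 0 < t] & x in [set: E]].

End navier_stokes.

(* Main.v *)
(* Picard iteration on the Duhamel formula.  Put K = oseen_kernel.  Writing
   |xi|^-2 e^(- t |xi|^2) as the integral of e^(- s |xi|^2) over s >= t gives
     K^t_jkl = delta_jk d_l G_t + \int_t^oo d_j d_k d_l G_s ds,
   G the heat kernel, so that |K^t(x)| <= C (sqrt t + |x|)^(- d - 1).  Since
   |y|^-b <= \prod_i |y_i|^(- b / d), convolving this bound with |y|^-b,
   b < d, reduces to one-dimensional integrals, and splitting the time integral
   at t / 2 shows that, for 0 <= sigma < d, the bilinear Duhamel term maps
   X x W_sigma to W_sigma, where the norms of X and W_sigma are the suprema of
   |x|^alpha t^((1 - alpha) / 2) |u| and (|x|^sigma + t^(sigma / 2)) |u|.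
   If the heat flow is small in X, the iterates stay small in X and bounded in
   W_gamma and W_beta, and their differences decrease geometrically in W_beta. *)
From HB Require Import structures.
Require Import Defs.
From mathcomp Require Import all_boot all_order all_algebra.
From mathcomp Require Import all_classical all_reals all_analysis.
From mathcomp Require Import ess_sup_inf.
From mathcomp Require Import complex.
From mathcomp Require Import ring lra measurable_realfun.
Set Implicit Arguments.
Unset Strict Implicit.
Unset Printing Implicit Defensive.
Import Order.TTheory GRing.Theory Num.Theory.
Import numFieldNormedType.Exports.
Local Open Scope classical_set_scope.
Local Open Scope ring_scope.

(** * Integrals on the line *)

(** Only the norm of [X] is small; the norms in [W_gamma] and [W_beta] may be large. This suffices
    because the bilinear bound is linear in the [W] norm with the [X] norm as coefficient, so
    [delta] depends only on the constants of the Duhamel estimates. The product of a factor in [X]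
    and a factor in [W_sigma] decays like a spatial weight of order [alpha + sigma], which may
    exceed [d]. The surplus is traded for powers of time: the weight kept has order
    [max(alpha, sigma)], still below [d] and less than 1 above [sigma], which is what both the space
    and the time integrals require. From [X x X] to [X] the order is [2 alpha < d]. Two features of
    the setting shape the rest. The kernel is prescribed by its Fourier transform and integrals are
    total, so the kernel needs an explicit, jointly measurable formula and estimates must come with
    integrability. Lebesgue measure on R^d is built one coordinate at a time, so integrals over R^d
    are reached through products of functions of one variable. *)

Section lebesgue_affine.
Context {R : realType}.
Local Notation mu := (@lebesgue_measure R).

Definition pushforward_measure d1 d2 (T1 : measurableType d1)
    (T2 : measurableType d2) (m : {measure set T1 -> \bar R}) (f : T1 -> T2)
    (mf : measurable_fun setT f) : {measure set T2 -> \bar R} :=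
  measure_function_pushforward__canonical__measure_function_Measure m mf.

(** Lebesgue measure is determined by its values on the intervals []a, b]]; their preimages are
    half-open on the other side and have the same length. *)
Lemma lebesgue_measure_reflect (c : R) (A : set R) : measurable A ->
  mu ((fun y => c - y) @^-1` A) = mu A.
Proof.
move=> mA.
have mf : measurable_fun setT (fun y : measurableTypeR R => (c - y : measurableTypeR R)).
  exact: measurable_funB.
apply/esym.
apply: (@lebesgue_measure_unique R (pushforward_measure mu mf)) => //.
move=> _ [[a b] /= _ <-]; rewrite /pushforward.
rewrite (_ : _ @^-1` _ = `[c - b, c - a[%classic); last first.
  apply/seteqP; split => y /=; rewrite !in_itv /= => /andP[? ?]; apply/andP; split; lra.
rewrite !lebesgue_measure_itv/= !lte_fin.
by rewrite ltrD2l ltrN2; case: ifP => // _; rewrite -!EFinB; congr EFin; ring.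
Qed.

Lemma lebesgue_measure_dilate (a : R) (A : set R) : 0 < a -> measurable A ->
  mu ((fun y => y / a) @^-1` A) = (a%:E * mu A)%E.
Proof.
move=> a0 mA.
have mf : measurable_fun setT (fun y : measurableTypeR R => (y / a : measurableTypeR R)).
  exact: measurable_funM.
have a0' : 0 <= a^-1 by rewrite invr_ge0 ltW.
(* The uniqueness theorem characterizes [mu] itself, so the pushforward is first rescaled by
   [a^-1]. *)
have -> : mu A = mscale (NngNum a0') (pushforward_measure mu mf) A.
  apply: (@lebesgue_measure_unique R (mscale (NngNum a0') (pushforward_measure mu mf))) => //.
  move=> _ [[b c] /= _ <-]; rewrite /mscale/= /pushforward.
  rewrite (_ : _ @^-1` _ = `]a * b, a * c]%classic); last first.
    apply/seteqP; split => y /=; rewrite !in_itv /=.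
      by rewrite ltr_pdivlMr// ler_pdivrMr// ![_ * a]mulrC.
    by rewrite ltr_pdivlMr// ler_pdivrMr// ![_ * a]mulrC.
  rewrite !lebesgue_measure_itv/= !lte_fin ltr_pM2l//; case: ifP => bc; last by rewrite mule0.
  by rewrite -!EFinB -EFinM; congr EFin; field; rewrite gt_eqF.
by rewrite /mscale/= muleA -EFinM divff ?gt_eqF// mul1e.
Qed.

Lemma ge0_integral_reflect (c : R) (f : R -> \bar R) :
  measurable_fun setT f -> (forall x, 0 <= f x)%E ->
  (\int[mu]_y f (c - y)%R = \int[mu]_y f y)%E.
Proof.
move=> mf f0.
have mg : measurable_fun setT (fun y : measurableTypeR R => (c - y : measurableTypeR R)).
  exact: measurable_funB.
transitivity (\int[pushforward mu (fun y : measurableTypeR R => (c - y : measurableTypeR R)%R)]_y f y)%E.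
  by rewrite ge0_integral_pushforward.
apply: (eq_measure_integral mu) => A mA _; exact: lebesgue_measure_reflect.
Qed.

Lemma ge0_integral_dilate (a : R) (f : R -> \bar R) : 0 < a ->
  measurable_fun setT f -> (forall x, 0 <= f x)%E ->
  (\int[mu]_y f (y / a)%R = a%:E * \int[mu]_y f y)%E.
Proof.
move=> a0 mf f0.
have mg : measurable_fun setT (fun y : measurableTypeR R => (y / a : measurableTypeR R)).
  exact: measurable_funM.
transitivity (\int[pushforward mu (fun y : measurableTypeR R => (y / a : measurableTypeR R)%R)]_y f y)%E.
  by rewrite ge0_integral_pushforward.
rewrite -(@ge0_integral_mscale _ _ _ mu setT measurableT (NngNum (ltW a0)))//.
apply: eq_measure_integral => A mA _; exact: lebesgue_measure_dilate.
Qed.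

Lemma integral_dilate (a : R) (f : R -> R) : 0 < a ->
  mu.-integrable setT (EFin \o f) ->
  \int[mu]_y f (y / a) = a * \int[mu]_y f y.
Proof.
move=> a0 intf; have mf := measurable_int _ intf.
have ff := integrable_fin_num measurableT intf.
rewrite /Rintegral -[a in RHS]/(fine a%:E) -fineM//.
rewrite [in LHS]integralE [in RHS]integralE.
have pE (g : R -> R) : ((fun y => (g (y / a))%:E)^\+ = (fun y => ((EFin \o g)^\+ (y / a)%R)))%E.
  by apply/funext => y; rewrite !funeposE.
have nE (g : R -> R) : ((fun y => (g (y / a))%:E)^\- = (fun y => ((EFin \o g)^\- (y / a)%R)))%E.
  by apply/funext => y; rewrite !funenegE.
rewrite pE nE !ge0_integral_dilate//; last 2 first.
  exact: measurable_funeneg.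
  exact: measurable_funepos.
have pf := integrable_pos_fin_num measurableT intf.
have nf := integrable_neg_fin_num measurableT intf.
by rewrite [in RHS]muleBr ?fin_num_adde_defl ?fin_numN.
Qed.

End lebesgue_affine.

(** * Integrals of power functions *)

Section power_integrals.
Context {R : realType}.
Local Notation mu := (@lebesgue_measure R).

(** Away from 0 the fundamental theorem of calculus applies; the bound does not depend on [a], so it
    survives the monotone limit [a -> 0] in [integral_powR_near0]. *)
Lemma integral_powR_le (q a r : R) : q < 1 -> 0 < a ->
  (\int[mu]_(y in `]a, r[) (y `^ (- q))%:E <= (r `^ (1 - q) / (1 - q))%:E)%E.
Proof.
move=> q1 a0; have q1' : 0 < 1 - q by lra.
have [ra|ar] := leP r a.
  by rewrite set_itv_ge ?bnd_simp -?leNgt// integral_set0 lee_fin divr_ge0// ?powR_ge0// ltW.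
have cont : {within `[a, r], continuous (fun y : R => y `^ (- q))}.
  apply: derivable_within_continuous => y; rewrite in_itv/= => /andP[ay _].
  by apply: derivable_powR; rewrite in_itv/= andbT (lt_le_trans a0).
have dF (x : R) : 0 < x ->
    is_derive x 1 (fun y => (1 - q)^-1 * y `^ (1 - q)) (x `^ (- q)).
  move=> x0; have := is_derive1_powR (1 - q) x0 => H.
  apply: is_derive_eq; rewrite /GRing.scale/= mulrA mulVf ?gt_eqF// mul1r.
  by congr powR; lra.
pose F (y : R) := (1 - q)^-1 * y `^ (1 - q).
have cF (x : R) : 0 < x -> F y @[y --> x] --> F x.
  move=> x0; apply/differentiable_continuous/derivable1_diffP.
  by have [] := dF x x0.
rewrite integral_itv_obnd_cbnd; last first.
  by apply: measurableT_comp => //; apply/measurable_funTS; exact: measurable_powR.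
rewrite integral_itv_bndo_bndc; last first.
  by apply: measurableT_comp => //; apply/measurable_funTS; exact: measurable_powR.
rewrite (@continuous_FTC2 _ _ F)//.
- rewrite -EFinB lee_fin mulrC gerBl mulr_ge0 ?powR_ge0// invr_ge0 ltW//.
- split.
  + move=> x; rewrite in_itv/= => /andP[ax _].
    by have [] := dF x (lt_trans a0 ax).
  + apply: cvg_at_right_filter; exact: cF.
  + apply: cvg_at_left_filter; exact: cF (lt_trans a0 ar).
- move=> x; rewrite in_itv/= => /andP[ax _].
  by rewrite derive1E; have [_ ->] := dF x (lt_trans a0 ax).
Qed.

Lemma integral_powR_near0 (q r : R) : q < 1 -> 0 < r ->
  (\int[mu]_(y in `]0%R, r[) (y `^ (- q))%:E <= (r `^ (1 - q) / (1 - q))%:E)%E.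
Proof.
move=> q1 r0.
have -> : `]0, r[%classic = \bigcup_n `](n.+1%:R^-1 : R), r[%classic.
  apply/seteqP; split => y /=; rewrite in_itv/=.
    move=> /andP[y0 yr].
    have [n _ /(_ n (leqnn n)) /= yn] := near_infty_natSinv_lt (PosNum y0).
    by exists n => //=; rewrite in_itv/= yr andbT.
  by move=> [n _ /=]; rewrite in_itv/= => /andP[ny ->]; rewrite (lt_trans _ ny).
have mf D : measurable_fun D (fun y : R => (y `^ (- q))%:E).
  by apply: measurableT_comp => //; apply/measurable_funTS; exact: measurable_powR.
have cv : (\int[mu]_(y in `](n.+1%:R^-1)%R, r[) (y `^ (- q))%:E @[n --> \oo] -->
    \int[mu]_(y in \bigcup_n `](n.+1%:R^-1)%R, r[%classic) (y `^ (- q))%:E)%E.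
  apply: ge0_nondecreasing_set_cvg_integral => //.
  - move=> n m nm; apply/subsetPset => y /=; rewrite !in_itv/= => /andP[ny ->].
    by rewrite andbT (le_lt_trans _ ny)// lef_pV2 ?posrE ?ler_nat.
  - by move=> n; exact: mf.
  - by move=> *; rewrite lee_fin powR_ge0.
rewrite -(cvg_lim _ cv)//; apply: lime_le; first by apply/cvg_ex; eexists; exact: cv.
by apply: nearW => n; exact: integral_powR_le.
Qed.

Lemma integral_powR_reflect (p t : R) : p < 1 -> 0 < t ->
  (\int[mu]_(s in `]0%R, t[) ((t - s)%R `^ (- p))%:E
   <= (t `^ (1 - p) / (1 - p))%:E)%E.
Proof.
move=> p1 t0; apply: le_trans (integral_powR_near0 p1 t0).
rewrite [in leLHS]integral_mkcond [in leRHS]integral_mkcond.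
set f := (X in (_ <= integral _ _ X)%E).
rewrite -(@ge0_integral_reflect _ t f)//.
- rewrite le_eqVlt; apply/orP; left; apply/eqP; apply: eq_integral => s _; rewrite /f !patchE.
  by congr (if _ then _ else _); rewrite !mem_setE /= !in_itv/=; lra.
- apply/(measurable_restrictT _ _).1 => //.
  by apply: measurableT_comp => //; apply/measurable_funTS; exact: measurable_powR.
- by move=> x; rewrite /f patchE; case: ifP => // _; rewrite lee_fin powR_ge0.
Qed.

Lemma measurable_norm_fun d (T : measurableType d) (f : T -> R) :
  measurable_fun setT f -> measurable_fun setT (fun x => `|f x|).
Proof. by move=> mf; apply: measurableT_comp => //; exact: normr_measurable. Qed.

Lemma measurable_powR_fun d (T : measurableType d) (f : T -> R) p :
  measurable_fun setT f -> measurable_fun setT (fun x => f x `^ p).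
Proof. by move=> mf; exact: (measurableT_comp (measurable_powR p)). Qed.

(** One-variable factors of the product bounds on R^d: this one bounds the singular weight inside a
    cube, [tail_powR] bounds the kernel on the whole line. *)
Definition cut_powR (q r y : R) : R := (`|y| < r)%R%:R * `|y| `^ (- q).

Lemma cut_powR_ge0 q r y : 0 <= cut_powR q r y.
Proof. by rewrite mulr_ge0// ?ler0n// powR_ge0. Qed.

Lemma measurable_cut_powR q r : measurable_fun setT (cut_powR q r).
Proof.
apply: measurable_funM.
  apply: (measurableT_comp (f := (fun b : bool => b%:R : R))) => //.
  by apply: measurable_fun_ltr => //; exact: measurable_norm_fun.
exact/measurable_powR_fun/measurable_norm_fun.
Qed.

Lemma integral_ball_powR (q r : R) : q < 1 -> 0 < r ->
  (\int[mu]_y (cut_powR q r y)%:E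
   <= (2 * (r `^ (1 - q) / (1 - q)))%:E)%E.
Proof.
move=> q1 r0.
have mf : measurable_fun setT (fun y : R => (cut_powR q r y)%:E).
  by apply: measurableT_comp => //; exact: measurable_cut_powR.
have f0 (y : R) : (0 <= (cut_powR q r y)%:E)%E by rewrite lee_fin cut_powR_ge0.
have pos : (\int[mu]_(y in `]0%R, +oo[) (cut_powR q r y)%:E
    <= (r `^ (1 - q) / (1 - q))%:E)%E.
  apply: le_trans (integral_powR_near0 q1 r0).
  rewrite [in leLHS]integral_mkcond [in leRHS]integral_mkcond.
  rewrite le_eqVlt; apply/orP; left; apply/eqP; apply: eq_integral => y _; rewrite !patchE !mem_setE/= !in_itv/=.
  rewrite andbT; have [y0|//] := ltP 0 y; rewrite /cut_powR gtr0_norm//=.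
  by case: ifP => _; rewrite ?mul1r ?mul0r.
have neg : (\int[mu]_(y in `]-oo, 0%R[) (cut_powR q r y)%:E
    <= (r `^ (1 - q) / (1 - q))%:E)%E.
  apply: le_trans pos.
  rewrite [in leLHS]integral_mkcond [in leRHS]integral_mkcond.
  rewrite -[in leLHS](@ge0_integral_reflect _ 0)//.
  - rewrite le_eqVlt; apply/orP; left; apply/eqP; apply: eq_integral => y _; rewrite !patchE !mem_setE/= !in_itv/=.
    by rewrite andbT sub0r oppr_lt0 /cut_powR normrN.
  - by apply/(measurable_restrictT _ _).1 => //; exact: measurable_funTS.
  - by move=> x; rewrite patchE; case: ifP.
rewrite -(setUv `]-oo, 0[%classic) ge0_integral_setU//=; first last.
- by apply/disj_setPCl.
- by rewrite setUv.
- exact: measurableC.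
rewrite setCitvl -integral_itv_obnd_cbnd; last exact: measurable_funTS.
by rewrite mulrDl mul1r EFinD leeD.
Qed.

Definition tail_powR (p rho y : R) : R := (rho + `|y|) `^ (- p).

Lemma tail_powR_ge0 p rho y : 0 <= tail_powR p rho y.
Proof. exact: powR_ge0. Qed.

Lemma measurable_tail_powR p rho : measurable_fun setT (tail_powR p rho).
Proof.
by apply: measurable_powR_fun; apply: measurable_funD => //; exact: measurable_norm_fun.
Qed.

Lemma shift_powR_cvg0 (p rho : R) : 1 < p -> 0 < rho ->
  (rho + y) `^ (1 - p) @[y --> +oo%R] --> 0.
Proof.
move=> p1 rho0; apply/cvgrPdist_lt => e e0.
(* [M] solves [M ^ (1 - p) = e], so it is enough that [rho + y] exceeds [M]. *)
pose M := e `^ (1 - p)^-1.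
near=> y; have My : M < rho + y.
  apply: (@lt_le_trans _ _ y); last by rewrite lerDr ltW.
  by near: y; apply: nbhs_pinfty_gt; exact: num_real.
have M0 : 0 < M by exact: powR_gt0.
rewrite sub0r normrN ger0_norm ?powR_ge0//.
have p1' : p - 1 != 0 by rewrite subr_eq0 gt_eqF.
have -> : e = (M `^ (p - 1))^-1.
  rewrite -powRN -powRrM -[LHS](powRr1 (ltW e0)); congr powR.
  by field; rewrite subr_eq0 lt_eqF.
rewrite (_ : 1 - p = - (p - 1)); last by lra.
rewrite powRN ltf_pV2 ?posrE ?powR_gt0//; last exact: lt_trans My.
by apply: gt0_ltr_powR; rewrite ?nnegrE ?subr_gt0// ltW// (lt_trans M0).
Unshelve. all: end_near. Qed.

(** Serves both the tails of the spatial kernel bound and the integral over [rho] in the Oseen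
    kernel. *)
Lemma integral_shift_powR (p rho : R) : 1 < p -> 0 < rho ->
  (\int[mu]_(y in `[0%R, +oo[) ((rho + y)%R `^ (- p))%:E
   = (rho `^ (1 - p) / (p - 1))%:E)%E.
Proof.
move=> p1 rho0; have p1' : 0 < p - 1 by lra.
pose F (y : R) := - ((p - 1)^-1 * (rho + y) `^ (1 - p)).
have dF (x : R) : 0 <= x -> is_derive x 1 F ((rho + x) `^ (- p)).
  move=> x0; have := @is_derive1_powR R (1 - p) (rho + x) (ltr_wpDr x0 rho0) => H.
  have H2 : is_derive x (1 : R) (fun y : R => rho + y) 1.
    by have := is_deriveD (is_derive_cst rho x (1 : R)) (is_derive_id x (1 : R)); rewrite add0r.
  have := @is_derive1_comp _ (fun z : R => z `^ (1 - p)) (fun y => rho + y) x _ _ H H2.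
  move=> H3; rewrite /F; apply: is_derive_eq.
  rewrite /GRing.scale/= mulr1 (_ : 1 - p - 1 = - p); last by lra.
  rewrite mulrA -mulNr -mulrN (_ : - (1 - p) = p - 1); last by lra.
  by rewrite mulVf ?gt_eqF// mul1r.
have cF (x : R) : 0 <= x -> F y @[y --> x] --> F x.
  move=> x0; apply/differentiable_continuous/derivable1_diffP.
  by have [] := dF x x0.
rewrite (@ge0_continuous_FTC2y _ _ F _ 0).
- by rewrite /F addr0 sub0e -EFinN opprK mulrC.
- by move=> x x0; exact: powR_ge0.
- apply/continuous_within_itvcyP; split.
    move=> x; rewrite in_itv/= andbT => x0.
    apply: (@continuous_comp _ _ _ (fun y : R => rho + y) (fun z : R => z `^ (- p))).
      by apply: cvgD; [exact: cvg_cst|exact: cvg_id].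
    apply/differentiable_continuous/derivable1_diffP/derivable_powR.
    by rewrite in_itv/= andbT addr_gt0.
  apply: cvg_at_right_filter.
  apply: (@continuous_comp _ _ _ (fun y : R => rho + y) (fun z : R => z `^ (- p))).
    by apply: cvgD; [exact: cvg_cst|exact: cvg_id].
  apply/differentiable_continuous/derivable1_diffP/derivable_powR.
  by rewrite in_itv/= andbT addr0.
- rewrite -oppr0 -(mulr0 (p - 1)^-1); apply: cvgN; apply: cvgM; first exact: cvg_cst.
  exact: shift_powR_cvg0.
- by move=> x x0; have [] := dF x (ltW x0).
- by apply: cvg_at_right_filter; exact: cF.
- move=> x; rewrite in_itv/= andbT => x0.
  by rewrite derive1E; have [_ ->] := dF x (ltW x0).
Qed.

Lemma integral_tail_powR (p rho x : R) : 1 < p -> 0 < rho ->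
  (\int[mu]_y (tail_powR p rho (x - y)%R)%:E
   = (2 * (rho `^ (1 - p) / (p - 1)))%:E)%E.
Proof.
move=> p1 rho0.
rewrite (@ge0_integral_reflect R x (fun y => (tail_powR p rho y)%:E))//.
rewrite ge0_symfun_integralT.
- rewrite EFinM -(integral_shift_powR p1 rho0); congr (_ * _)%E.
  rewrite (_ : [set x | _] = `[0, +oo[%classic); last first.
    by apply/seteqP; split => y/=; rewrite in_itv/= andbT.
  apply: eq_integral => y; rewrite inE/= in_itv/= andbT => y0.
  by rewrite /tail_powR ger0_norm.
- by move=> y; exact: tail_powR_ge0.
- move=> y; apply: (@continuous_comp _ _ _ (fun y : R => rho + `|y|) (fun z : R => z `^ (- p))).
    by apply: cvgD; [exact: cvg_cst|exact: norm_continuous].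
  apply/differentiable_continuous/derivable1_diffP/derivable_powR.
  by rewrite in_itv/= andbT ltr_wpDr.
- by move=> y; rewrite /tail_powR/= normrN.
- by apply: measurableT_comp => //; exact: measurable_tail_powR.
- by move=> y; rewrite lee_fin tail_powR_ge0.
Qed.
End power_integrals.

(** * Domination and the time integral *)

Section time_integral.
Context {R : realType}.
Local Notation mu := (@lebesgue_measure R).

(** [Rintegral] is total, so a bound on it is meaningful only next to integrability; domination by
    [g] yields both. *)
Lemma Rintegral_dominated d (T : measurableType d) (m : {measure set T -> \bar R})
    (D : set T) (h g : T -> R) (B : R) : measurable D ->
  measurable_fun D h -> measurable_fun D g ->
  (forall x, D x -> `|h x| <= g x) ->
  (\int[m]_(x in D) (g x)%:E <= B%:E)%E ->
  m.-integrable D (EFin \o h) /\ `|\int[m]_(x in D) h x| <= B.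
Proof.
move=> mD mh mg hg gB.
have hB : (\int[m]_(x in D) `|(h x)%:E| <= B%:E)%E.
  apply: le_trans gB; apply: ge0_le_integral => //.
  - by apply: measurableT_comp => //; exact/measurable_EFinP.
  - exact/measurable_EFinP.
have inth : m.-integrable D (EFin \o h).
  apply/integrableP; split; first exact/measurable_EFinP.
  by apply: le_lt_trans hB _; exact: ltry.
split=> //; apply: le_trans (le_normr_Rintegral _ inth) _ => //.
rewrite -lee_fin; apply: le_trans hB.
rewrite /Rintegral fineK//.
by have := integrable_fin_num mD (integrable_norm inth).
Qed.

(** Each bound is used on the half interval that avoids one of its singularities. For [s < t / 2]
    the factor [(t - s)^-p1] is at most [2^p1 t^-p1], and only [q1 < 1] matters; for [s >= t / 2]
    the roles are exchanged. Hence [p1] and [q2] are not bounded above. *)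
Lemma integral_time_split (h : R -> R) (t A1 A2 p1 q1 p2 q2 : R) :
  0 < t -> 0 <= A1 -> 0 <= A2 -> 0 <= p1 -> q1 < 1 -> p2 < 1 -> 0 <= q2 ->
  measurable_fun `]0, t[ h ->
  (forall s, 0 < s < t -> `|h s| <= A1 * ((t - s) `^ (- p1) * s `^ (- q1))) ->
  (forall s, 0 < s < t -> `|h s| <= A2 * ((t - s) `^ (- p2) * s `^ (- q2))) ->
  mu.-integrable `]0, t[ (EFin \o h) /\
  `|\int[mu]_(s in `]0, t[) h s| <=
    A1 * (2 `^ p1 / (1 - q1)) * t `^ (1 - p1 - q1) +
    A2 * (2 `^ q2 / (1 - p2)) * t `^ (1 - p2 - q2).
Proof.
move=> t0 A10 A20 p10 q11 p21 q20 mh H1 H2.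
pose k1 := A1 * 2 `^ p1 * t `^ (- p1); pose k2 := A2 * 2 `^ q2 * t `^ (- q2).
have k10 : 0 <= k1 by rewrite !mulr_ge0// powR_ge0.
have k20 : 0 <= k2 by rewrite !mulr_ge0// powR_ge0.
have half (p s : R) : 0 <= p -> t / 2 <= s -> s `^ (- p) <= 2 `^ p * t `^ (- p).
  move=> p0 ts; have s0 : 0 < s by lra.
  rewrite !powRN ler_pdivlMr ?powR_gt0// mulrC ler_pdivrMr ?powR_gt0//.
  rewrite -powRM//; last exact: ltW.
  by apply: ge0_ler_powR => //; rewrite ?nnegrE; lra.
have mf q : measurable_fun `]0%R, t[ (fun s : R => s `^ (- q)).
  by apply/measurable_funTS; exact: measurable_powR.
have mg q : measurable_fun `]0%R, t[ (fun s : R => (t - s) `^ (- q)).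
  by apply/measurable_funTS; apply: measurable_powR_fun; exact: measurable_funB.
(* The sum of the two majorants dominates [h] on all of []0, t[], so the integral need not be
   cut. *)
pose g s := k1 * s `^ (- q1) + k2 * (t - s) `^ (- p2).
apply: (@Rintegral_dominated _ (measurableTypeR R) lebesgue_measure _ h g) => //; rewrite /g.
- by apply: measurable_funD; apply: measurable_funM => //; [exact: mf|exact: mg].
- move=> s; rewrite /= in_itv/= => /andP[s0 st]; have [ts|ts] := leP (t / 2) s.
    apply: le_trans (H2 s _) _; first by rewrite s0.
    rewrite ler_wpDl// ?mulr_ge0 ?powR_ge0//.
    rewrite /k2 -!mulrA ler_wpM2l// mulrC mulrA ler_wpM2r ?powR_ge0//.
    exact: half.
  apply: le_trans (H1 s _) _; first by rewrite s0.
  rewrite ler_wpDr// ?mulr_ge0 ?powR_ge0//.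
  rewrite /k1 -!mulrA ler_wpM2l// mulrA ler_wpM2r ?powR_ge0//.
  by apply: half => //; lra.
have ge0M (k : R) (f : R -> R) : 0 <= k -> (forall s : R, 0 <= f s) -> measurable_fun `]0%R, t[ f ->
    (\int[mu]_(s in `]0%R, t[) (k * f s)%:E =
     k%:E * \int[mu]_(s in `]0%R, t[) (f s)%:E)%E.
  move=> k0 f0 mf'; under eq_integral do rewrite EFinM.
  by rewrite ge0_integralZl//; [exact/measurable_EFinP|move=> s _; rewrite lee_fin].
under eq_integral do rewrite EFinD.
rewrite ge0_integralD//; last first.
- by apply/measurable_EFinP; apply: measurable_funM => //; exact: mg.
- by move=> s _; rewrite lee_fin mulr_ge0// powR_ge0.
- by apply/measurable_EFinP; apply: measurable_funM => //; exact: mf.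
- by move=> s _; rewrite lee_fin mulr_ge0// powR_ge0.
rewrite !ge0M//; try (by move=> s; exact: powR_ge0).
rewrite EFinD leeD//.
  apply: le_trans (lee_wpmul2l _ (integral_powR_near0 q11 t0)) _; rewrite ?lee_fin//.
  rewrite (_ : 1 - p1 - q1 = - p1 + (1 - q1)); last by ring.
  rewrite (@powRD _ t (- p1)); last by apply/implyP => _; rewrite gt_eqF.
  rewrite /k1 le_eqVlt; apply/orP; left; apply/eqP; field; lra.
apply: le_trans (lee_wpmul2l _ (integral_powR_reflect p21 t0)) _; rewrite ?lee_fin//.
rewrite (_ : 1 - p2 - q2 = - q2 + (1 - p2)); last by ring.
rewrite (@powRD _ t (- q2)); last by apply/implyP => _; rewrite gt_eqF.
rewrite /k2 le_eqVlt; apply/orP; left; apply/eqP; field; lra.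
Qed.
End time_integral.

(** * Weighted integrals on R^d *)

Section lebesgue_rV_integral.
Context {R : realType}.
Local Notation mu := (@lebesgue_measure R).

Lemma ge0_integral_rV_cons n (f : 'rV[R]_n.+1 -> \bar R) :
  measurable_fun setT f -> (forall x, 0 <= f x)%E ->
  (\int[@lebesgue_rV R n.+1]_x f x =
   \int[mu]_a \int[@lebesgue_rV R n]_v f (cons_rV (a, v)))%E.
Proof.
move=> mf f0.
transitivity (\int[pushforward (mu \x (@lebesgue_rV R n))%E (@cons_rV R n)]_x f x)%E => //.
rewrite ge0_integral_pushforward//; last exact: measurable_cons_rV.
rewrite preimage_setT fubini_tonelli1//.
  by apply: measurableT_comp => //; exact: measurable_cons_rV.
by move=> x; exact: f0.
Qed.

Lemma measurable_prod_rV n (f : 'I_n -> R -> R) :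
  (forall i, measurable_fun setT (f i)) ->
  measurable_fun setT (fun x : 'rV[R]_n => \prod_i f i (x ord0 i)).
Proof.
move=> mf; apply: measurable_prod => i _.
exact: (measurableT_comp (mf i) (measurable_coord i)).
Qed.

Lemma prod_cons_rV n (f : 'I_n.+1 -> R -> R) a (v : 'rV[R]_n) :
  \prod_i f i (cons_rV (a, v) ord0 i) =
  f ord0 a * \prod_i f (lift ord0 i) (v ord0 i).
Proof.
rewrite big_ord_recl cons_rV0/=; congr (_ * _).
by apply: eq_bigr => i _; rewrite cons_rVS.
Qed.

(** Tonelli, one coordinate at a time; the measure on R^0 is a Dirac mass, which matches the empty
    product. *)
Lemma integral_prod_rV_le n (f : 'I_n -> R -> R) (B : 'I_n -> R) :
  (forall i, measurable_fun setT (f i)) -> (forall i x, 0 <= f i x) ->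
  (forall i, \int[mu]_x (f i x)%:E <= (B i)%:E)%E ->
  (\int[@lebesgue_rV R n]_x (\prod_i f i (x ord0 i))%:E <= (\prod_i B i)%:E)%E.
Proof.
elim: n f B => [|n IH] f B mf f0 fB.
  under eq_integral do rewrite big_ord0.
  by rewrite /= integral_dirac// diracT mul1e big_ord0.
rewrite ge0_integral_rV_cons//; last 2 first.
  by apply/measurable_EFinP; exact: measurable_prod_rV.
  by move=> x; rewrite lee_fin prodr_ge0.
set P := (\int[@lebesgue_rV R n]_v (\prod_i f (lift ord0 i) (v ord0 i))%:E)%E.
have PB : (P <= (\prod_i B (lift ord0 i))%:E)%E.
  by apply: (IH (fun i => f (lift ord0 i)) (fun i => B (lift ord0 i))) => i;
    [exact: mf|exact: f0|exact: fB].
have P0 : (0 <= P)%E by apply: integral_ge0 => v _; rewrite lee_fin prodr_ge0.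
have E a : (\int[@lebesgue_rV R n]_v (\prod_i f i (cons_rV (a, v) ord0 i))%:E =
    (f ord0 a)%:E * P)%E.
  under eq_integral do rewrite prod_cons_rV EFinM.
  rewrite ge0_integralZl//.
  - by apply/measurable_EFinP; apply: (measurable_prod_rV (f := fun i => f (lift ord0 i))).
  - by move=> v _; rewrite lee_fin prodr_ge0.
  - by rewrite lee_fin.
under eq_integral do rewrite E.
rewrite ge0_integralZr//; last first.
- by move=> a _; rewrite lee_fin.
- by apply/measurable_EFinP; exact: mf.
rewrite big_ord_recl EFinM lee_pmul// ?fB//.
by apply: integral_ge0 => a _; rewrite lee_fin.
Qed.
End lebesgue_rV_integral.

(** * Norms on R^d *)

Section norms.
Context {R : realType} {d : nat}.
Implicit Types x y : 'rV[R]_d.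

(** The l1 norm compares with functions of one variable without constants: it dominates each
    [|x_i|], and [1 + norm1 x] is at most the product of the [1 + |x_i|]. *)
Definition norm1 x : R := \sum_i `|x ord0 i|.

Lemma norm1_ge0 x : 0 <= norm1 x.
Proof. by apply: sumr_ge0. Qed.

Lemma norm1D x y : norm1 (x + y) <= norm1 x + norm1 y.
Proof.
by rewrite /norm1 -big_split ler_sum// => i _; rewrite mxE ler_normD.
Qed.

Lemma coord_le_norm1 x i : `|x ord0 i| <= norm1 x.
Proof. by rewrite /norm1 (bigD1 i)//= lerDl sumr_ge0. Qed.

Lemma dotp_ge0 x : 0 <= dotp x x.
Proof. by apply: sumr_ge0 => i _; rewrite -expr2 sqr_ge0. Qed.

Lemma sqr_enorm x : enorm x ^+ 2 = dotp x x.
Proof. by rewrite sqr_sqrtr// dotp_ge0. Qed.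

Lemma enorm_ge0 x : 0 <= enorm x.
Proof. exact: sqrtr_ge0. Qed.

Lemma coord_le_enorm x i : `|x ord0 i| <= enorm x.
Proof.
rewrite -sqrtr_sqr ler_sqrt ?dotp_ge0// /dotp (bigD1 i)//= expr2 lerDl.
by apply: sumr_ge0 => j _; rewrite -expr2 sqr_ge0.
Qed.

Lemma enorm_le_norm1 x : enorm x <= norm1 x.
Proof.
rewrite -(@ler_pXn2r _ 2)// ?nnegrE ?enorm_ge0 ?norm1_ge0// sqr_enorm.
rewrite expr2 {1}/norm1 mulr_suml; apply: ler_sum => i _.
rewrite -expr2 -real_normK ?num_real// expr2.
by rewrite ler_wpM2l// coord_le_norm1.
Qed.

Lemma norm1_le_enorm x : norm1 x <= d%:R * enorm x.
Proof.
rewrite /norm1 (_ : _ * _ = \sum_(i < d) enorm x); last first.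
  by rewrite sumr_const card_ord mulr_natl.
by apply: ler_sum => i _; exact: coord_le_enorm.
Qed.

Lemma measurable_norm1 : measurable_fun setT norm1.
Proof.
apply: measurable_sum => i; apply: measurable_norm_fun.
exact: measurable_coord.
Qed.

Lemma measurable_enorm : measurable_fun setT (@enorm R d).
Proof.
apply: (measurableT_comp (f := @Num.sqrt R)).
  by apply: continuous_measurable_fun; exact: sqrt_continuous.
by apply: measurable_sum => i; apply: measurable_funM; exact: measurable_coord.
Qed.

Lemma measurable_subrV : measurable_fun setT (fun p : 'rV[R]_d * 'rV[R]_d => p.1 - p.2).
Proof.
apply: measurable_fun_rV => i.
apply: (eq_measurable_fun (fun p : 'rV[R]_d * 'rV[R]_d => p.1 ord0 i - p.2 ord0 i)).
  by move=> p _; rewrite !mxE.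
by apply: measurable_funB;
  [exact: measurableT_comp (measurable_coord i) measurable_fst|
   exact: measurableT_comp (measurable_coord i) measurable_snd].
Qed.

End norms.

(** * Coordinate hyperplanes are null *)

Section null_hyperplanes.
Context {R : realType}.

(** The hyperplane is exhausted by bounded pieces [A n], whose indicators are products of
    one-variable functions with finite integrals; the factor of index [i] is the indicator of a
    point and has integral 0. *)
Lemma negligible_hyperplane d (i : 'I_d) :
  (@lebesgue_rV R d).-negligible [set y : 'rV[R]_d | y ord0 i = 0].
Proof.
pose A n := [set y : 'rV[R]_d | y ord0 i = 0 /\ forall j, `|y ord0 j| < n.+1%:R].
have AE : [set y : 'rV[R]_d | y ord0 i = 0] `<=` \bigcup_n A n.
  move=> y /= yi; have [n _ /(_ n (leqnn n)) /= ny] := nbhs_infty_gtr (norm1 y).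
  exists n => //; split=> // j; apply: le_lt_trans (coord_le_norm1 y j) _.
  by rewrite (lt_le_trans ny)// ler_nat.
apply: negligibleS AE _; apply: negligible_bigcup => n.
(* [cut_powR 0] is the indicator of an interval, origin included, since [0 ^ 0 = 1] for [powR]. *)
pose f (j : 'I_d) : R -> R := if j == i then \1_[set 0] else cut_powR 0 n.+1%:R.
pose B (j : 'I_d) : R := if j == i then 0 else
  2 * (n.+1%:R `^ (1 - 0) / (1 - 0)).
have mf j : measurable_fun setT (f j).
  by rewrite /f; case: ifP => _; [exact: measurable_indic|exact: measurable_cut_powR].
have f0 j z : 0 <= f j z.
  by rewrite /f; case: ifP => _; [rewrite indicE|exact: cut_powR_ge0].
have AfE y : (\1_(A n) y)%:E = (\prod_j f j (y ord0 j))%:E.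
  congr EFin; rewrite indicE; case: (boolP (y \in A n)) => [|/negP] yA.
    move: yA; rewrite inE => -[yi yn]; rewrite big1// => j _; rewrite /f.
    case: (j =P i) => [->|_]; first by rewrite yi indicE mem_set.
    by rewrite /cut_powR yn oppr0 powRr0 mulr1.
  apply/esym/eqP/prodf_eq0.
  have [yi|yi] := eqVneq (y ord0 i) 0; last first.
    by exists i => //; rewrite /f eqxx indicE memNset//; exact/eqP.
  have [j /negP jn] : exists j, ~ (`|y ord0 j| < n.+1%:R).
    by apply/existsNP => H; apply: yA; rewrite inE.
  exists j => //; rewrite /f; case: (j =P i) => [ji|_].
    by move: jn; rewrite ji yi normr0 ltr0n.
  by rewrite /cut_powR (negbTE jn) mul0r.
have mA : measurable (A n).
  apply/measurable_indicP.
  apply: (eq_measurable_fun (fun y : 'rV[R]_d => \prod_j f j (y ord0 j))).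
    by move=> y _; have [] := AfE y.
  exact: measurable_prod_rV.
exists (A n); split => //.
apply/eqP; rewrite eq_le measure_ge0 andbT -[A n]setIT -integral_indic//.
under eq_integral do rewrite AfE.
apply: le_trans (integral_prod_rV_le (B := B) mf f0 _) _.
  move=> j; rewrite /f /B; case: ifP => _; last exact: integral_ball_powR.
  rewrite integral_indic// setIT [X in (X <= _)%E](_ : _ = 0%E)//.
  exact: lebesgue_measure_set1.
by rewrite (bigD1 i)//= /B eqxx mul0r.
Qed.

(** The product bound on the weight breaks down on these hyperplanes, because [powR] sends 0 to 0
    when the exponent is nonzero. *)
Lemma ae_coord_neq0 d :
  {ae @lebesgue_rV R d, forall y : 'rV[R]_d, forall i, y ord0 i != 0}.
Proof.
apply: (@negligibleS _ _ _ _ (\big[setU/set0]_(i <- enum 'I_d) [set y : 'rV[R]_d | y ord0 i = 0])).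
  move=> y /= /existsNP [i /negP]; rewrite negbK => /eqP yi.
  by rewrite -bigcup_seq; exists i => //=; rewrite mem_enum.
apply: big_ind => [|B C|i _]; first exact: negligible_set0.
- exact: negligibleU.
- exact: negligible_hyperplane.
Qed.
End null_hyperplanes.

Lemma ge0_integral_lincomb d (T : measurableType d) (R : realType)
    (m : {measure set T -> \bar R}) (c1 c2 : R) (g1 g2 : T -> R) :
  0 <= c1 -> 0 <= c2 -> measurable_fun setT g1 -> measurable_fun setT g2 ->
  (forall x, 0 <= g1 x) -> (forall x, 0 <= g2 x) ->
  (\int[m]_x (c1 * g1 x + c2 * g2 x)%:E =
   c1%:E * \int[m]_x (g1 x)%:E + c2%:E * \int[m]_x (g2 x)%:E)%E.
Proof.
move=> c10 c20 mg1 mg2 g10 g20.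
have ge0M (k : R) (g : T -> R) : 0 <= k -> (forall y, 0 <= g y) ->
    measurable_fun setT g ->
    (\int[m]_y (k * g y)%:E = k%:E * \int[m]_y (g y)%:E)%E.
  move=> k0 h0 mh; under eq_integral do rewrite EFinM.
  by rewrite ge0_integralZl//; [exact/measurable_EFinP|move=> y _; rewrite lee_fin].
under eq_integral do rewrite EFinD.
rewrite ge0_integralD ?ge0M//.
- by move=> y _; rewrite lee_fin mulr_ge0.
- by apply/measurable_EFinP; exact: measurable_funM.
- by move=> y _; rewrite lee_fin mulr_ge0.
- by apply/measurable_EFinP; exact: measurable_funM.
Qed.

(** * Convolution of the kernel bound with a singular weight *)

Section decay_kernel.
Context {R : realType} {d : nat}.
Hypothesis d_gt0 : (0 < d)%N.
Local Notation leb := (@lebesgue_rV R d).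
Implicit Types x y : 'rV[R]_d.

Let dR_gt0 : 0 < d%:R :> R. Proof. by rewrite ltr0n. Qed.

Definition decay_kernel (rho : R) x : R := ((rho + norm1 x) ^+ d.+1)^-1.

Lemma decay_kernel_ge0 rho x : 0 < rho -> 0 <= decay_kernel rho x.
Proof. by move=> r0; rewrite invr_ge0 exprn_ge0// addr_ge0 ?norm1_ge0 1?ltW. Qed.

(** The first term is the mass of the product weight with exponent [b / d] in each variable, the
    second that of the product kernel; [d ^ b] is the price of passing from [norm1] to [enorm] in
    the weight. *)
Definition ball_const (b : R) : R :=
  (2 / (1 - b / d%:R)) ^+ d + d%:R `^ b * (2 * d%:R) ^+ d.

Lemma prod_powR_const (c p : R) : \prod_(i < d) (c `^ p) = c `^ (p * d%:R).
Proof.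
by rewrite prodr_const card_ord -powR_mulrn ?powR_ge0// powRrM.
Qed.

(** The exponent [d + 1] is shared equally by the coordinates: each receives [(d + 1) / d > 1], just
    enough for integrability on the line. *)
Lemma decay_kernel_le_prod rho x : 0 < rho ->
  decay_kernel rho x <= \prod_i tail_powR (d.+1%:R / d%:R) rho (x ord0 i).
Proof.
move=> r0; have rN : 0 < rho + norm1 x by rewrite ltr_wpDr ?norm1_ge0.
have -> : decay_kernel rho x = \prod_(i < d) (rho + norm1 x) `^ (- (d.+1%:R / d%:R)).
  rewrite prod_powR_const mulNr mulfVK ?gt_eqF// powR_invn//; exact: ltW.
apply: ler_prod => i _; rewrite powR_ge0/= /tail_powR !powRN lef_pV2 ?posrE ?powR_gt0//.
  apply: ge0_ler_powR; rewrite ?nnegrE ?lerD2l ?coord_le_norm1//.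
  - by rewrite addr_ge0// ltW.
  - exact: ltW.
by rewrite ltr_wpDr.
Qed.

(* Each |y_i| is at most |y|: this makes the weight a product of functions of one
   variable. *)
Lemma enorm_powR_le_prod (b r : R) y : 0 <= b -> (forall i, y ord0 i != 0) ->
  norm1 y < r -> enorm y `^ (- b) <= \prod_i cut_powR (b / d%:R) r (y ord0 i).
Proof.
move=> b0 y0 yr.
have -> : enorm y `^ (- b) = \prod_(i < d) enorm y `^ (- (b / d%:R)).
  by rewrite prod_powR_const mulNr mulfVK// gt_eqF.
apply: ler_prod => i _; rewrite powR_ge0/= /cut_powR.
have yi0 : 0 < `|y ord0 i| by rewrite normr_gt0.
have yir : `|y ord0 i| < r by exact: le_lt_trans (coord_le_norm1 y i) yr.
have ye := coord_le_enorm y i.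
rewrite yir mul1r !powRN lef_pV2 ?posrE ?powR_gt0//; last exact: lt_le_trans ye.
by apply: ge0_ler_powR; rewrite ?nnegrE ?divr_ge0 ?enorm_ge0 ?ler0n// ltW.
Qed.

(** Where [norm1 y < r] the kernel is replaced by its bound and the weight is integrated; elsewhere
    [enorm y >= r / d] bounds the weight and the kernel is integrated. Both contributions scale like
    [rho^-1 r^-b], for any admissible [r]. *)
Lemma decay_kernel_integral_le x (rho r b M : R) (f : 'rV[R]_d -> R) :
  0 < rho -> 0 < r -> 0 <= b -> b < d%:R -> 0 <= M -> measurable_fun setT f ->
  {ae leb, forall y, enorm y `^ b * `|f y| <= M} ->
  (forall y, norm1 y < r -> decay_kernel rho (x - y) <= (rho * r ^+ d)^-1) ->
  (\int[leb]_y (decay_kernel rho (x - y) * `|f y|)%:E <=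
   (ball_const b * M * (rho^-1 * r `^ (- b)))%:E)%E.
Proof.
move=> rho0 r0 b0 bd M0 mf fM Hr.
pose q := b / d%:R; pose p : R := d.+1%:R / d%:R.
have q1 : q < 1 by rewrite ltr_pdivrMr// mul1r.
have p1 : 1 < p by rewrite ltr_pdivlMr// mul1r ltr_nat.
have pE : p - 1 = d%:R^-1.
  by rewrite /p -natr1 mulrDl divff ?gt_eqF// mul1r addrAC subrr add0r.
have qd : q * d%:R = b by rewrite mulfVK// gt_eqF.
pose c1 := M * (rho * r ^+ d)^-1; pose c2 := M * (r `^ (- b) * d%:R `^ b).
have c10 : 0 <= c1 by rewrite mulr_ge0// invr_ge0 mulr_ge0 ?exprn_ge0// ltW.
have c20 : 0 <= c2 by rewrite !mulr_ge0// powR_ge0.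
pose g1 y := \prod_i cut_powR q r (y ord0 i).
pose g2 y := \prod_i tail_powR p rho (x ord0 i - y ord0 i).
have mg1 : measurable_fun setT g1.
  by apply: (measurable_prod_rV (f := fun=> cut_powR q r)) => i; exact: measurable_cut_powR.
have mg2 : measurable_fun setT g2.
  apply: (measurable_prod_rV (f := fun i z => tail_powR p rho (x ord0 i - z))) => i.
  apply: (measurableT_comp (f := tail_powR p rho)); first exact: measurable_tail_powR.
  exact: measurable_funB.
have g10 y : 0 <= g1 y by apply: prodr_ge0 => i _; exact: cut_powR_ge0.
have g20 y : 0 <= g2 y by apply: prodr_ge0 => i _; exact: tail_powR_ge0.
have c1g y : 0 <= c1 * g1 y by exact: mulr_ge0.
have c2g y : 0 <= c2 * g2 y by exact: mulr_ge0.
have mk : measurable_fun setT (fun y => decay_kernel rho (x - y)).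
  have mN : measurable_fun setT (fun y => rho + norm1 (x - y)).
    apply: measurable_funD => //; apply: (measurableT_comp (measurable_norm1)).
    apply: measurable_fun_rV => i.
    apply: (eq_measurable_fun (fun y => x ord0 i - y ord0 i)).
      by move=> y _; rewrite !mxE.
    by apply: measurable_funB => //; exact: measurable_coord.
  apply: (eq_measurable_fun (fun y => (rho + norm1 (x - y)) `^ (- d.+1%:R))).
    move=> y _; rewrite /decay_kernel powR_invn//.
    by rewrite addr_ge0 ?norm1_ge0// ltW.
  exact: measurable_powR_fun.
apply: (@le_trans _ _ (\int[leb]_y (c1 * g1 y + c2 * g2 y)%:E)%E).
  apply: ae_ge0_le_integral => //.
  - by move=> y _; rewrite lee_fin mulr_ge0// decay_kernel_ge0.
  - by apply/measurable_EFinP; apply: measurable_funM => //; exact: measurable_norm_fun.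
  - by move=> y _; rewrite lee_fin addr_ge0.
  - by apply/measurable_EFinP; apply: measurable_funD; apply: measurable_funM.
  apply: filterS2 fM (@ae_coord_neq0 R d) => y fy y0 _.
  rewrite lee_fin.
  have ye : 0 < enorm y.
    apply: lt_le_trans (coord_le_enorm y (Ordinal d_gt0)).
    by rewrite normr_gt0.
  have {}fy : `|f y| <= M * enorm y `^ (- b).
    by rewrite powRN ler_pdivlMr ?powR_gt0// mulrC.
  have [yr|ry] := ltP (norm1 y) r.
    rewrite ler_wpDr//.
    apply: (@le_trans _ _ ((rho * r ^+ d)^-1 * (M * enorm y `^ (- b)))).
      by apply: ler_pM => //; [exact: decay_kernel_ge0|exact: Hr].
    rewrite mulrCA mulrA ler_wpM2l//; exact: enorm_powR_le_prod.
  rewrite ler_wpDl//.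
  apply: (@le_trans _ _ (g2 y * (M * enorm y `^ (- b)))).
    apply: ler_pM => //; first exact: decay_kernel_ge0.
    apply: le_trans (decay_kernel_le_prod _ rho0) _.
    by under eq_bigr do rewrite !mxE.
  rewrite mulrC ler_wpM2r// ler_wpM2l//.
  rewrite !powRN mulrC ler_pdivlMr ?powR_gt0// mulrC.
  rewrite ler_pdivrMr ?powR_gt0// -powRM ?ler0n//; last exact: enorm_ge0.
  apply: ge0_ler_powR; rewrite ?nnegrE ?mulr_ge0 ?enorm_ge0 ?ler0n ?(ltW r0)//.
  exact: le_trans ry (norm1_le_enorm y).
rewrite ge0_integral_lincomb//.
have I1 := @integral_prod_rV_le R d (fun=> cut_powR q r)
  (fun=> 2 * (r `^ (1 - q) / (1 - q))) (fun=> measurable_cut_powR q r)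
  (fun=> cut_powR_ge0 q r) (fun=> integral_ball_powR q1 r0).
have I2 := @integral_prod_rV_le R d (fun i z => tail_powR p rho (x ord0 i - z))
  (fun=> 2 * (rho `^ (1 - p) / (p - 1))).
apply: (@le_trans _ _ (c1%:E * (\prod_(i < d) (2 * (r `^ (1 - q) / (1 - q))))%:E +
    c2%:E * (\prod_(i < d) (2 * (rho `^ (1 - p) / (p - 1))))%:E)%E).
  rewrite leeD// lee_wpmul2l ?lee_fin//; apply: I2.
  - move=> i; apply: (measurableT_comp (f := tail_powR p rho)).
      exact: measurable_tail_powR.
    exact: measurable_funB.
  - by move=> i z; exact: tail_powR_ge0.
  - by move=> i; rewrite integral_tail_powR.
rewrite !prodr_const !card_ord pE -EFinM -EFinM -EFinD lee_fin.
have rd : (r `^ (1 - q)) ^+ d = r ^+ d * r `^ (- b).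
  rewrite -powR_mulrn ?powR_ge0// -powRrM mulrBl mul1r qd -powR_mulrn ?(ltW r0)//.
  by rewrite -powRD//; apply/implyP => _; rewrite gt_eqF.
have rhod : (rho `^ (1 - p)) ^+ d = rho^-1.
  rewrite -powR_mulrn ?powR_ge0// -powRrM -opprB pE mulNr mulVf ?gt_eqF//.
  by rewrite powR_inv1// ltW.
rewrite !exprMn invrK rd rhod /c1 /c2 /ball_const -/q exprMn.
rewrite [(2 * d%:R) ^+ d]exprMn; set u := _^-1 ^+ d; set v := r `^ _.
have w0 : r ^+ d != 0 by rewrite expf_neq0// gt_eqF.
move: w0; set w := r ^+ d; set z := d%:R `^ b; set e := 2 ^+ d; set D := d%:R ^+ d.
move=> w0; rewrite le_eqVlt; apply/orP; left; apply/eqP; field.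
by rewrite w0 gt_eqF.
Qed.

(* The radius separating the two regions is max(rho, |x| / 2): inside it the
   kernel is bounded, outside it the weight is. *)
Definition ball_bound (rho b : R) x : R :=
  rho^-1 * (Num.max rho (norm1 x / 2)) `^ (- b).

(** What remains is the kernel bound inside the radius [r]. If [r = rho], it is immediate. Otherwise
    [norm1 y < norm1 x / 2] forces [norm1 (x - y) >= r], and one factor of the power is bounded by
    [rho], the other [d] by [r]. *)
Lemma decay_kernel_ball_bound x (rho b M : R) (f : 'rV[R]_d -> R) :
  0 < rho -> 0 <= b -> b < d%:R -> 0 <= M -> measurable_fun setT f ->
  {ae leb, forall y, enorm y `^ b * `|f y| <= M} ->
  (\int[leb]_y (decay_kernel rho (x - y) * `|f y|)%:E <=
   (ball_const b * M * ball_bound rho b x)%:E)%E.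
Proof.
move=> rho0 b0 bd M0 mf fM; apply: decay_kernel_integral_le => //.
  by rewrite lt_max rho0.
move=> y yr.
have pw (u v : R) : 0 < v -> v <= u -> (u ^+ d.+1)^-1 <= (v ^+ d.+1)^-1.
  move=> v0 vu; rewrite lef_pV2 ?posrE ?exprn_gt0//; last exact: lt_le_trans vu.
  by rewrite lerXn2r// ?nnegrE ltW// (lt_le_trans v0).
move: yr; have [h|h] := leP (norm1 x / 2) rho => yr.
  rewrite -exprS; apply: pw => //.
  by rewrite lerDl norm1_ge0.
have h0 : 0 < norm1 x / 2 by exact: lt_trans h.
have xy : norm1 x / 2 <= norm1 (x - y).
  have := norm1D (x - y) y; rewrite subrK; lra.
rewrite /decay_kernel lef_pV2 ?posrE; last 2 first.
  by rewrite exprn_gt0// ltr_wpDr// norm1_ge0.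
  by rewrite mulr_gt0// exprn_gt0.
rewrite exprS; apply: ler_pM; rewrite ?(ltW rho0) ?exprn_ge0 ?(ltW h0)//.
  by rewrite lerDl norm1_ge0.
by apply: lerXn2r; rewrite ?nnegrE ?(ltW h0)// ?addr_ge0 ?norm1_ge0 ?(ltW rho0)//; lra.
Qed.

(** Since [enorm x <= 2 r], the weight costs at most [(2 r) ^ a]; as [a <= b], the remaining
    [r ^ (a - b)] is at most [rho ^ (a - b)]. With [rho] the square root of time, spatial weight is
    converted into a power of time. *)
Lemma ball_bound_le x (rho a b : R) : 0 < rho -> 0 <= a -> a <= b ->
  enorm x `^ a * ball_bound rho b x <= 2 `^ b * rho `^ (- (1 + b - a)).
Proof.
move=> rho0 a0 ab; rewrite /ball_bound.
set r := Num.max rho _.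
have rr : rho <= r by rewrite le_max lexx.
have r0 : 0 < r by exact: lt_le_trans rr.
have xr : enorm x <= 2 * r.
  apply: le_trans (enorm_le_norm1 x) _.
  have : norm1 x / 2 <= r by rewrite le_max lexx orbT.
  lra.
apply: (@le_trans _ _ ((2 * r) `^ a * (rho^-1 * r `^ (- b)))).
  rewrite ler_wpM2r ?mulr_ge0 ?powR_ge0 ?invr_ge0 ?(ltW rho0)//.
  by apply: ge0_ler_powR; rewrite ?nnegrE ?enorm_ge0 ?mulr_ge0 ?(ltW r0).
rewrite powRM ?(ltW r0)//.
have -> : 2 `^ a * r `^ a * (rho^-1 * r `^ (- b)) =
    2 `^ a * (rho^-1 * r `^ (- (b - a))).
  rewrite (_ : - (b - a) = a + - b); last by ring.
  rewrite powRD; last by apply/implyP => _; rewrite gt_eqF.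
  ring.
have -> : rho `^ (- (1 + b - a)) = rho^-1 * rho `^ (- (b - a)).
  rewrite -powR_inv1 ?(ltW rho0)// -powRD; last by apply/implyP => _; rewrite gt_eqF.
  by congr powR; ring.
apply: ler_pM; rewrite ?powR_ge0 ?mulr_ge0 ?powR_ge0 ?invr_ge0 ?(ltW rho0)//.
  by apply: ler_powR; rewrite ?ler1n.
rewrite ler_wpM2l ?invr_ge0 ?(ltW rho0)// !powRN lef_pV2 ?posrE ?powR_gt0//.
by apply: ge0_ler_powR; rewrite ?nnegrE ?subr_ge0 ?(ltW rho0) ?(ltW r0).
Qed.

End decay_kernel.

(** * Gaussians and their Fourier transform *)

Section hermite.
Context {R : realType}.
Local Notation mu := (@lebesgue_measure R).

(* Successive derivatives of [y |-> (4 pi)^(-1/2) e^(- y^2 / 4)]. *)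
Fixpoint dgauss (m : nat) (y : R) : R :=
  match m with
  | 0%N => (Num.sqrt (4 * pi))^-1 * expR (- (y / 2) ^+ 2)
  | m1.+1 => - (y / 2) * dgauss m1 y -
      (if m1 is m2.+1 then (m1%:R / 2) * dgauss m2 y else 0)
  end.

Lemma dgauss1 y : dgauss 1 y = - (y / 2) * dgauss 0 y.
Proof. exact: subr0. Qed.

Lemma dgaussSS m y :
  dgauss m.+2 y = - (y / 2) * dgauss m.+1 y - (m.+1%:R / 2) * dgauss m y.
Proof. by []. Qed.

(** Two consecutive orders are proved together because the recursion looks two steps back.
    Differentiating the factor [- y / 2] raises the coefficient of the second term from [m.+1 / 2]
    to [m.+2 / 2]. *)
Lemma is_derive_dgauss m (y : R) : is_derive y 1 (dgauss m) (dgauss m.+1 y).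
Proof.
suff [] : is_derive y 1 (dgauss m) (dgauss m.+1 y) /\
   is_derive y 1 (dgauss m.+1) (dgauss m.+2 y) by [].
have D0 : is_derive y (1 : R) (fun z : R => - (z / 2)) (- 2^-1).
  have := is_deriveN (is_deriveM (is_derive_id y (1 : R)) (is_derive_cst (2^-1 : R) y (1 : R))).
  by rewrite /GRing.scale/= mulr0 mulr1 add0r.
have D1 : is_derive y 1 (dgauss 0) (dgauss 1 y).
  have D2 : is_derive y (1 : R) (fun z : R => - (z / 2) ^+ 2) (- (y / 2)).
    have := is_deriveM D0 (is_deriveN D0).
    rewrite (_ : _ * _ = fun z : R => - (z / 2) ^+ 2); last first.
      by apply/funext => z; rewrite !fctE/= opprK mulNr expr2.
    by move/is_derive_eq; apply; rewrite /GRing.scale/= ?fctE/=; field.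
  have H := @is_derive1_comp _ expR (fun z : R => - (z / 2) ^+ 2) y _ _ (is_derive_expR _) D2.
  rewrite dgauss1.
  have := is_deriveM (is_derive_cst ((Num.sqrt (4 * pi))^-1 : R) y (1 : R)) H.
  move/is_derive_eq; apply.
  by rewrite /GRing.scale/= mulr0 addr0; ring.
elim: m => [|m [IH1 IH2]].
  split => //.
  rewrite (_ : dgauss 1 = fun z => - (z / 2) * dgauss 0 z); last first.
    by apply/funext => z; exact: dgauss1.
  have := is_deriveM D0 D1; move/is_derive_eq; apply.
  rewrite dgaussSS; set a := dgauss 1 y; set b := dgauss 0 y.
  by rewrite /GRing.scale/=; field.
split => //.
have H1 := is_deriveM D0 IH2.
have H2 := is_deriveM (is_derive_cst (m.+1%:R / 2 : R) y (1 : R)) IH1.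
have := is_deriveB H1 H2; move/is_derive_eq; apply.
rewrite [dgauss m.+3 y]dgaussSS -[m.+2%:R]natr1.
set a := dgauss m.+2 y; set b := dgauss m.+1 y.
by rewrite /GRing.scale/= mulr0 addr0; field.
Qed.

Lemma continuous_dgauss m : continuous (dgauss m).
Proof.
move=> y; apply/differentiable_continuous/derivable1_diffP.
by have [] := is_derive_dgauss m y.
Qed.

Lemma measurable_dgauss m : measurable_fun setT (dgauss m).
Proof. by apply: continuous_measurable_fun; exact: continuous_dgauss. Qed.

(** The claim is proved for all [N] at once: in the recursion the factor [y] uses up one power of
    [1 + |y|]. *)
Lemma dgauss_decay m N :
  exists2 C, 0 <= C & forall y, `|dgauss m y| * (1 + `|y|) ^+ N <= C.
Proof.
suff [] : (forall N, exists2 C, 0 <= C & forall y, `|dgauss m y| * (1 + `|y|) ^+ N <= C) /\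
  (forall N, exists2 C, 0 <= C & forall y, `|dgauss m.+1 y| * (1 + `|y|) ^+ N <= C) by [].
have step (f g : R -> R) k :
    (forall N, exists2 C, 0 <= C & forall y, `|f y| * (1 + `|y|) ^+ N <= C) ->
    (forall N, exists2 C, 0 <= C & forall y, `|g y| * (1 + `|y|) ^+ N <= C) ->
    (forall N, exists2 C, 0 <= C &
      forall y, `|- (y / 2) * f y - k * g y| * (1 + `|y|) ^+ N <= C).
  move=> Hf Hg {}N; have [Cf Cf0 HCf] := Hf N.+1; have [Cg Cg0 HCg] := Hg N.
  exists (Cf + `|k| * Cg); first by rewrite addr_ge0// mulr_ge0.
  move=> y; have P0 : 0 <= (1 + `|y|) ^+ N by rewrite exprn_ge0// addr_ge0.
  apply: (@le_trans _ _ ((`|y| * `|f y| + `|k| * `|g y|) * (1 + `|y|) ^+ N)).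
    rewrite ler_wpM2r//; apply: le_trans (ler_normB _ _) _.
    rewrite !normrM normrN lerD2r ler_wpM2r// normrM ler_piMr//.
    by rewrite ger0_norm ?invr_ge0// invf_le1// ler1n.
  rewrite mulrDl lerD//.
    apply: le_trans (HCf y); rewrite exprS mulrC mulrCA [leRHS]mulrCA.
    rewrite mulrCA mulrC -!mulrA ler_wpM2r ?mulr_ge0//.
    by rewrite lerDr.
  by rewrite -mulrA ler_wpM2l.
have base : forall N, exists2 C, 0 <= C & forall y, `|dgauss 0 y| * (1 + `|y|) ^+ N <= C.
  move=> {}N; exists ((Num.sqrt (4 * pi))^-1 * (expR 2 * N.+1`!%:R)).
    by rewrite mulr_ge0 ?invr_ge0 ?sqrtr_ge0// mulr_ge0 ?expR_ge0.
  move=> y; rewrite /= normrM ger0_norm ?invr_ge0 ?sqrtr_ge0//.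
  rewrite -mulrA ler_wpM2l ?invr_ge0 ?sqrtr_ge0//.
  rewrite ger0_norm ?expR_ge0// expRN mulrC ler_pdivrMr ?expR_gt0//.
  have z1 : 1 <= 1 + `|y| by rewrite lerDl.
  have z0 : 0 <= 1 + `|y| by rewrite addr_ge0.
  apply: (@le_trans _ _ (N.+1`!%:R * expR (1 + `|y|))).
    (* The exponential series dominates its term of order [N.+1], whence the factorial in the
       constant. *)
    have := expR_ge1Dxn N z0 => H.
    apply: (@le_trans _ _ ((1 + `|y|) ^+ N.+1)); first by rewrite ler_weXn2l.
    rewrite mulrC -ler_pdivrMr ?ltr0n ?fact_gt0//; apply: le_trans H; lra.
  rewrite [expR 2 * _]mulrC -mulrA ler_wpM2l// -expRD ler_expR.
  (* This square being nonnegative means [1 + |y| <= 2 + (y / 2)^2]. *)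
  have : 0 <= (`|y| / 2 - 1) ^+ 2 by rewrite sqr_ge0.
  rewrite sqrrB expr1n mulr1 exprMn real_normK ?num_real// -exprMn; lra.
elim: m => [|m [IH1 IH2]]; split=> //; last exact: step.
(* [dgauss 1] has no second term, which amounts to the coefficient 0. *)
move=> {}N; have [C C0 HC] := step _ _ 0 base base N.
by exists C => // y; have := HC y; rewrite mul0r.
Qed.

Lemma dgauss_le_tail m (N : nat) : exists2 C, 0 <= C &
  forall y, `|dgauss m y| <= C * tail_powR N%:R 1 y.
Proof.
have [C C0 HC] := dgauss_decay m N; exists C => // y.
have y1 : 0 < 1 + `|y| by rewrite ltr_pwDl.
by rewrite /tail_powR powRN powR_mulrn ?(ltW y1)// ler_pdivlMr ?exprn_gt0.
Qed.

Lemma integrable_dominated d (T : measurableType d) (m : {measure set T -> \bar R})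
    (h g : T -> R) (B : R) :
  measurable_fun setT h -> measurable_fun setT g ->
  (forall x, `|h x| <= g x) ->
  (\int[m]_x (g x)%:E <= B%:E)%E ->
  m.-integrable setT (EFin \o h).
Proof.
by move=> mh mg hg gB; have [] := @Rintegral_dominated _ _ _ m setT h g B measurableT mh mg (fun x _ => hg x) gB.
Qed.

Lemma integrable_tail_bound (f : R -> R) C : 0 <= C -> measurable_fun setT f ->
  (forall y, `|f y| <= C * tail_powR 2 1 y) -> mu.-integrable setT (EFin \o f).
Proof.
move=> C0 mf fC.
apply: (@integrable_dominated _ (measurableTypeR R) lebesgue_measure f (fun y => C * tail_powR 2 1 y)
   (C * (2 * (1 `^ (1 - 2) / (2 - 1))))) => //.
  by apply: measurable_funM => //; exact: measurable_tail_powR.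
under eq_integral do rewrite EFinM.
rewrite ge0_integralZl//; last 2 first.
- by apply/measurable_EFinP; exact: measurable_tail_powR.
- by move=> y _; rewrite lee_fin tail_powR_ge0.
rewrite EFinM lee_wpmul2l//.
rewrite -(@integral_tail_powR R 2 1 0) ?ltr1n//.
rewrite le_eqVlt; apply/orP; left; apply/eqP; apply: eq_integral => y _.
by rewrite /tail_powR sub0r normrN.
Qed.

Lemma integrable_dgaussM m (k : R -> R) : measurable_fun setT k ->
  (forall y, `|k y| <= 1) -> mu.-integrable setT (EFin \o (fun y => dgauss m y * k y)).
Proof.
move=> mk k1; have [C C0 HC] := dgauss_le_tail m 2.
apply: integrable_tail_bound C0 _ _.
  by apply: measurable_funM => //; exact: measurable_dgauss.
move=> y; rewrite normrM; apply: le_trans (HC y).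
by rewrite ler_piMr.
Qed.
End hermite.

(** * Fourier transform of the Gaussian and its derivatives on the line *)

Section gauss_fourier.
Context {R : realType}.
Local Notation mu := (@lebesgue_measure R).

(** On [[- n.+1, n.+1]] the integral is a difference of boundary values, at most [2 C / n.+1] by the
    decay of [F]; dominated convergence identifies its limit. *)
Lemma Rintegral_derive_eq0 (F f : R -> R) (C : R) :
  (forall x : R, is_derive x 1 F (f x)) -> continuous f ->
  mu.-integrable setT (EFin \o f) ->
  (forall x, `|F x| * (1 + `|x|) <= C) -> \int[mu]_x f x = 0.
Proof.
move=> dF cf intf FC.
have cF : continuous F.
  by move=> x; apply/differentiable_continuous/derivable1_diffP; have [] := dF x.
have FTC n : (\int[mu]_(x in `[(- n.+1%:R)%R, n.+1%:R]) (f x)%:E =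
    (F n.+1%:R)%:E - (F (- n.+1%:R))%:E)%E.
  apply: continuous_FTC2 => //.
  - by rewrite gtrN ?ltr0n.
  - exact: continuous_subspaceT.
  - split; first by move=> x _; have [] := dF x.
    + by apply: cvg_at_right_filter; exact: cF.
    + by apply: cvg_at_left_filter; exact: cF.
  - by move=> x _; rewrite derive1E; have [_ ->] := dF x.
pose fn n := fun x : R => ((f \_ `[(- n.+1%:R)%R, n.+1%:R]) x)%:E.
have mfn n : measurable_fun setT (fn n).
  apply/measurable_EFinP; apply/(measurable_restrictT _ _).1 => //.
  by apply: measurable_funTS; exact: continuous_measurable_fun.
have cvfn x : fn n x @[n --> \oo] --> (f x)%:E.
  apply: cvg_near_cst.
  have [n _ nx] := nbhs_infty_gtr `|x|; exists n => // k /= nk.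
  rewrite /fn patchE mem_set//= in_itv/= -ler_norml ltW// (lt_le_trans (nx _ nk))//.
  by rewrite ler_nat.
have fnf x n : (`|fn n x| <= `|(f x)%:E|)%E.
  by rewrite /fn patchE; case: ifP => // _; rewrite /= normr0 lee_fin.
have [|||||_ _ cv] := @dominated_convergence _ (measurableTypeR R) R mu setT
  measurableT fn (EFin \o f) (abse \o (EFin \o f)).
- exact: mfn.
- exact: measurable_int intf.
- by apply: aeW => x _; exact: cvfn.
- exact: integrable_abse.
- by apply: aeW => x n _; exact: fnf.
have cv0 : (\int[mu]_x fn n x)%E @[n --> \oo] --> (0 : \bar R).
  have E n : (\int[mu]_x fn n x = (F n.+1%:R - F (- n.+1%:R))%:E)%E.
    rewrite EFinB -FTC [in RHS]integral_mkcond; apply: eq_integral => x _.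
    by rewrite /fn !patchE; case: ifP.
  rewrite (eq_cvg _ _ E) -[0%E]/(0%:E); apply: cvg_EFin; first by apply: nearW.
  have CH : (2 * C) * harmonic n @[n --> \oo] --> (2 * C) * (0 : R).
    by apply: cvgM; [exact: cvg_cst|exact: cvg_harmonic].
  rewrite mulr0 in CH.
  have CHN : - ((2 * C) * harmonic n) @[n --> \oo] --> (0 : R).
    by rewrite -oppr0; exact: cvgN.
  apply: (squeeze_cvgr _ CHN CH); apply: nearW => n /=.
  have b (z : R) : `|z| = n.+1%:R -> `|F z| <= C * harmonic n.
    move=> zn; rewrite /harmonic/= ler_pdivlMr ?ltr0n//.
    apply: le_trans (FC z); rewrite zn ler_wpM2l// lerDr//.
  have b1 := b n.+1%:R (ger0_norm (ler0n _ _)).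
  have b2 := b (- n.+1%:R); rewrite normrN in b2; have {}b2 := b2 (ger0_norm (ler0n _ _)).
  rewrite -ler_norml; apply: le_trans (ler_normB _ _) _.
  by apply: le_trans (lerD b1 b2) _; rewrite -mulrA mulr_natl mulr2n.
have := cvg_unique _ cv cv0 => E.
by rewrite /Rintegral E.
Qed.

Definition cosft m (xi : R) := \int[mu]_y (dgauss m y * cos (y * xi)).
Definition sinft m (xi : R) := \int[mu]_y (dgauss m y * sin (y * xi)).

Lemma continuous_scaled (f : R -> R) (xi : R) : continuous f ->
  continuous (fun y : R => f (y * xi)).
Proof.
move=> cf y; apply: (@continuous_comp _ _ _ (fun y : R => y * xi) f); last exact: cf.
by apply: cvgM; [exact: cvg_id|exact: cvg_cst].
Qed.

Lemma norm_cos_le1 (x : R) : `|cos x| <= 1.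
Proof. by rewrite ler_norml cos_geN1 cos_le1. Qed.

Lemma norm_sin_le1 (x : R) : `|sin x| <= 1.
Proof. by rewrite ler_norml sin_geN1 sin_le1. Qed.

Lemma continuous_cosM xi : continuous (fun y : R => cos (y * xi)).
Proof. by apply: continuous_scaled; exact: continuous_cos. Qed.

Lemma continuous_sinM xi : continuous (fun y : R => sin (y * xi)).
Proof. by apply: continuous_scaled; exact: continuous_sin. Qed.

Lemma integrable_dgauss_sin m xi :
  mu.-integrable setT (EFin \o (fun y : R => dgauss m y * sin (y * xi))).
Proof.
apply: integrable_dgaussM => [|y]; last exact: norm_sin_le1.
by apply: continuous_measurable_fun; exact: continuous_sinM.
Qed.

Lemma is_derive_cosM (xi y : R) :
  is_derive y (1 : R) (fun z : R => cos (z * xi)) (- sin (y * xi) * xi).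
Proof.
have D : is_derive y (1 : R) (fun z : R => z * xi) xi.
  have := is_deriveM (is_derive_id y (1 : R)) (is_derive_cst xi y (1 : R)).
  by move/is_derive_eq; apply; rewrite /GRing.scale/= mulr0 mulr1 add0r.
exact: (@is_derive1_comp _ cos _ y _ _ (is_derive_cos _) D).
Qed.

Lemma is_derive_sinM (xi y : R) :
  is_derive y (1 : R) (fun z : R => sin (z * xi)) (cos (y * xi) * xi).
Proof.
have D : is_derive y (1 : R) (fun z : R => z * xi) xi.
  have := is_deriveM (is_derive_id y (1 : R)) (is_derive_cst xi y (1 : R)).
  by move/is_derive_eq; apply; rewrite /GRing.scale/= mulr0 mulr1 add0r.
exact: (@is_derive1_comp _ sin _ y _ _ (is_derive_sin _) D).
Qed.

Lemma dgaussM_decay m (k : R -> R) : (forall y, `|k y| <= 1) ->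
  exists C, forall y, `|dgauss m y * k y| * (1 + `|y|) <= C.
Proof.
move=> k1; have [C C0 HC] := @dgauss_decay R m 1; exists C => y.
apply: le_trans (HC y); rewrite expr1 normrM ler_wpM2r ?addr_ge0//.
by rewrite ler_piMr.
Qed.

(** Stated for a pair [k], [dk] so that [cos] and [sin] are both instances; the boundary terms
    vanish by the decay of [dgauss m]. *)
Lemma dgauss_by_parts m (k dk : R -> R) (xi : R) :
  (forall y : R, is_derive y (1 : R) k (xi * dk y)) ->
  continuous k -> continuous dk ->
  (forall y, `|k y| <= 1) -> (forall y, `|dk y| <= 1) ->
  \int[mu]_y (dgauss m.+1 y * k y) = - xi * \int[mu]_y (dgauss m y * dk y).
Proof.
move=> Dk ck cdk k1 dk1.
have i1 := integrable_dgaussM m.+1 (continuous_measurable_fun ck) k1.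
have i2 := integrable_dgaussM m (continuous_measurable_fun cdk) dk1.
have [C HC] := dgaussM_decay m k1.
have E : \int[mu]_y (dgauss m.+1 y * k y + xi * (dgauss m y * dk y)) = 0.
  apply: (@Rintegral_derive_eq0 (fun y => dgauss m y * k y) _ C) => //.
  - move=> y; have := is_deriveM (is_derive_dgauss m y) (Dk y).
    by move/is_derive_eq; apply; rewrite /GRing.scale/=; ring.
  - move=> y; apply: cvgD; first by apply: cvgM; [exact: continuous_dgauss|exact: ck].
    apply: cvgM; first exact: cvg_cst.
    by apply: cvgM; [exact: continuous_dgauss|exact: cdk].
  - have := integrableD measurableT i1 (integrableZl measurableT xi i2).
    by apply: eq_integrable.
rewrite RintegralD// in E; last first.
  by have := integrableZl measurableT xi i2; apply: eq_integrable.
rewrite RintegralZl// in E.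
by apply/eqP; rewrite mulNr -addr_eq0 E.
Qed.

Lemma cosftS m xi : cosft m.+1 xi = xi * sinft m xi.
Proof.
have D (y : R) : is_derive y (1 : R) (fun y => cos (y * xi)) (- xi * sin (y * xi)).
  by have := is_derive_cosM xi y; rewrite mulNr mulrC -mulNr.
rewrite /cosft (dgauss_by_parts m D (@continuous_cosM xi) (@continuous_sinM xi)) ?opprK//.
- by move=> y; exact: norm_cos_le1.
- by move=> y; exact: norm_sin_le1.
Qed.

Lemma sinftS m xi : sinft m.+1 xi = - xi * cosft m xi.
Proof.
have D (y : R) : is_derive y (1 : R) (fun y => sin (y * xi)) (xi * cos (y * xi)).
  by have := is_derive_sinM xi y; rewrite mulrC.
rewrite /sinft (dgauss_by_parts m D (@continuous_sinM xi) (@continuous_cosM xi))//.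
- by move=> y; exact: norm_sin_le1.
- by move=> y; exact: norm_cos_le1.
Qed.

(** Differentiation in [xi] brings down a factor [y], and [y * dgauss 0 y] is [- 2 * dgauss 1 y].
    Integration by parts then returns to [dgauss 0], so the transform satisfies [h' = - 2 xi h]. *)
Lemma derive_gauss_ft (k dk : R -> R) (xi : R) :
  (forall z : R, is_derive z (1 : R) k (dk z)) ->
  continuous k -> continuous dk ->
  (forall z, `|k z| <= 1) -> (forall z, `|dk z| <= 1) ->
  is_derive xi (1 : R) (fun z => \int[mu]_y (dgauss 0 y * k (y * z)))
    (- 2 * \int[mu]_y (dgauss 1 y * dk (y * xi))).
Proof.
move=> Dk ck cdk k1 dk1.
pose f (z y : R) := dgauss 0 y * k (y * z).
have Df (z y : R) : is_derive z (1 : R) (f ^~ y) (dgauss 0 y * (y * dk (y * z))).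
  have D : is_derive z (1 : R) (fun w : R => y * w) y.
    have := is_deriveM (is_derive_cst y z (1 : R)) (is_derive_id z (1 : R)).
    by move/is_derive_eq; apply; rewrite /GRing.scale/= mulr0 mulr1 addr0.
  have H := @is_derive1_comp _ k (fun w : R => y * w) z _ _ (Dk _) D.
  have := is_deriveM (is_derive_cst (dgauss 0 y) z (1 : R)) H.
  by move/is_derive_eq; apply; rewrite /GRing.scale/= mulr0 addr0; ring.
have E y : partial1of2 f xi y = - 2 * (dgauss 1 y * dk (y * xi)).
  rewrite partial1of2E; have [_ ->] := Df xi y.
  by rewrite dgauss1; field.
have intf z : mu.-integrable setT (EFin \o f z).
  apply: integrable_dgaussM => //.
  by apply: continuous_measurable_fun; exact: continuous_scaled.
have int1 : mu.-integrable setT (EFin \o (fun y => dgauss 1 y * dk (y * xi))).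
  apply: integrable_dgaussM => //.
  by apply: continuous_measurable_fun; exact: continuous_scaled.
have intG : mu.-integrable setT (EFin \o (fun y : R => 2 * `|dgauss 1 y * 1|)).
  have one (y : R) : `|cst (1 : R) y| <= 1 by rewrite normr1.
  have := integrable_norm (integrable_dgaussM 1 (measurable_cst _) one).
  by move=> /(integrableZl measurableT 2); apply: eq_integrable.
have Gub (z y : R) : `|partial1of2 f z y| <= 2 * `|dgauss 1 y * 1|.
  rewrite partial1of2E; have [_ ->] := Df z y.
  rewrite mulr1 dgauss1; set g := dgauss 0 y.
  have h2 : `|2^-1| = 2^-1 :> R by rewrite ger0_norm.
  have -> : 2 * `|- (y / 2) * g| = `|g| * `|y|.
    by rewrite normrM normrN normrM h2; field.
  by rewrite !normrM ler_wpM2l// ler_piMr.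
have Ixi : `]xi - 1, xi + 1[%classic xi by rewrite /= in_itv/=; lra.
have derf (z y : R) : derivable (f ^~ y) z 1 by have [] := Df z y.
have G0 (y : R) : 0 <= 2 * `|dgauss 1 y * 1| by rewrite mulr_ge0.
apply: DeriveDef.
  exact: (@derivable_under_integral _ _ _ mu f setT measurableT xi (xi - 1) (xi + 1)
    Ixi (fun z _ => intf z) (fun z y _ _ => derf z y) _ G0 intG (fun z y _ _ => Gub z y)).
rewrite -derive1E (@differentiation_under_integral _ _ _ mu f setT measurableT xi
  (xi - 1) (xi + 1) Ixi (fun z _ => intf z) (fun z y _ _ => derf z y) _ G0 intG
  (fun z y _ _ => Gub z y)).
rewrite -RintegralZl//; apply: eq_Rintegral => y _; exact: E.
Qed.

(** Multiplication by [expR (x ^+ 2)] makes the solution constant. *)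
Lemma ode_gauss (h : R -> R) : (forall x : R, is_derive x (1 : R) h (- 2 * x * h x)) ->
  forall x, h x = h 0 * expR (- x ^+ 2).
Proof.
move=> Dh x.
have D (z : R) : is_derive z (1 : R) (fun y => h y * expR (y ^+ 2)) 0.
  have D2 : is_derive z (1 : R) (fun y : R => y ^+ 2) (2 * z).
    have := is_deriveM (is_derive_id z (1 : R)) (is_derive_id z (1 : R)).
    rewrite (_ : _ * _ = fun y : R => y ^+ 2); last by apply/funext => y; rewrite expr2.
    by move/is_derive_eq; apply; rewrite /GRing.scale/=; ring.
  have H := @is_derive1_comp _ expR (fun y : R => y ^+ 2) z _ _ (is_derive_expR _) D2.
  have := is_deriveM (Dh z) H.
  by move/is_derive_eq; apply; rewrite /GRing.scale/=; ring.
have := is_derive_0_is_cst x 0 D.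
rewrite expr0n/= expR0 mulr1 => <-.
by rewrite -mulrA -expRD subrr expR0 mulr1.
Qed.

Lemma Rintegral_dgauss0 : \int[mu]_y dgauss 0 y = 1.
Proof.
have H : mu.-integrable setT (EFin \o gauss_fun) := @integrableT_gauss R.
have E : \int[mu]_y gauss_fun (y / 2) = 2 * Num.sqrt pi.
  by rewrite integral_dilate// /Rintegral integralT_gauss.
have i2 : mu.-integrable setT (EFin \o (fun y : R => gauss_fun (y / 2))).
  apply/integrableP; split.
    apply/measurable_EFinP; apply: (measurableT_comp (f := gauss_fun)).
      exact: measurable_gauss_fun.
    exact: measurable_funM.
  under eq_integral do rewrite /= ger0_norm ?gauss_fun_ge0//.
  rewrite (@ge0_integral_dilate R 2 (EFin \o gauss_fun))//.
  - by rewrite /= integralT_gauss -EFinM ltry.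
  - by apply/measurable_EFinP; exact: measurable_gauss_fun.
  - by move=> y; rewrite lee_fin gauss_fun_ge0.
rewrite /dgauss -/(gauss_fun _) RintegralZl// E sqrtrM// (_ : 4 = 2 ^+ 2); last by rewrite -natrX.
rewrite sqrtr_sqr ger0_norm// mulVf// mulf_neq0//.
by rewrite gt_eqF// sqrtr_gt0 pi_gt0.
Qed.

Lemma cosft0 xi : cosft 0 xi = expR (- xi ^+ 2).
Proof.
have D (x : R) : is_derive x (1 : R) (cosft 0) (- 2 * x * cosft 0 x).
  have Dc (z : R) : is_derive z (1 : R) (@cos R) (- sin z) := is_derive_cos z.
  have cs : continuous (fun z : R => - sin z).
    by move=> z; apply: cvgN; exact: continuous_sin.
  have ns (z : R) : `|- sin z| <= 1 by rewrite normrN norm_sin_le1.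
  have := @derive_gauss_ft (@cos R) _ x Dc (@continuous_cos R) cs (@norm_cos_le1) ns.
  move/is_derive_eq; apply.
  transitivity (2 * sinft 1 x); last by rewrite sinftS; ring.
  rewrite /sinft mulNr -mulrN; congr (_ * _).
  rewrite -mulN1r -RintegralZl//; last first.
    have := integrable_dgauss_sin 1 x.
    move=> /(integrableZl measurableT (-1)); apply: eq_integrable => // y _.
    by rewrite /= -EFinM; congr EFin; ring.
  by apply: eq_Rintegral => y _; ring.
rewrite (ode_gauss D) (_ : cosft 0 0 = 1) ?mul1r// -Rintegral_dgauss0.
by apply: eq_Rintegral => y _; rewrite mulr0 cos0 mulr1.
Qed.

Lemma sinft0 xi : sinft 0 xi = 0.
Proof.
have D (x : R) : is_derive x (1 : R) (sinft 0) (- 2 * x * sinft 0 x).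
  have Ds (z : R) : is_derive z (1 : R) (@sin R) (cos z) := is_derive_sin z.
  have := @derive_gauss_ft (@sin R) _ x Ds (@continuous_sin R) (@continuous_cos R)
    (@norm_sin_le1) (@norm_cos_le1).
  move/is_derive_eq; apply.
  by rewrite -/(cosft 1 x) cosftS; ring.
rewrite (ode_gauss D) (_ : sinft 0 0 = 0) ?mul0r// /sinft.
under eq_Rintegral do rewrite mulr0 sin0 mulr0.
by rewrite Rintegral_cst// mul0r.
Qed.
End gauss_fourier.

Lemma integrableM_le1 d (T : measurableType d) (R : realType)
    (m : {measure set T -> \bar R}) (f k : T -> R) :
  m.-integrable setT (EFin \o f) -> measurable_fun setT k ->
  (forall x, `|k x| <= 1) -> m.-integrable setT (EFin \o (fun x => f x * k x)).
Proof.
move=> intf mk k1.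
have mf : measurable_fun setT f by apply/measurable_EFinP; exact: measurable_int intf.
apply: (le_integrable _ _ _ intf) => //.
  by apply/measurable_EFinP; exact: measurable_funM.
by move=> x _; rewrite /= lee_fin normrM ler_piMr.
Qed.

(** * Fourier transform of products of one-variable functions *)

Section fourier_product.
Context {R : realType}.
Local Notation mu := (@lebesgue_measure R).

(** Integrability is delivered with the value because [fourier_prod] adds and subtracts such
    integrals. *)
Lemma integral_rV_cons_prod n (g : R -> R) (h : 'rV[R]_n -> R) :
  mu.-integrable setT (EFin \o g) ->
  (@lebesgue_rV R n).-integrable setT (EFin \o h) ->
  let f := fun x : 'rV[R]_n.+1 => g (uncons_rV x).1 * h (uncons_rV x).2 in
  (@lebesgue_rV R n.+1).-integrable setT (EFin \o f) /\
  \int[@lebesgue_rV R n.+1]_x f x = \int[mu]_a g a * \int[@lebesgue_rV R n]_v h v.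
Proof.
move=> intg inth f.
have mg : measurable_fun setT g by apply/measurable_EFinP; exact: measurable_int intg.
have mh : measurable_fun setT h by apply/measurable_EFinP; exact: measurable_int inth.
have mf : measurable_fun setT f.
  apply: measurable_funM.
    by apply: (measurableT_comp mg); apply: measurableT_comp => //; exact: measurable_uncons_rV.
  by apply: (measurableT_comp mh); apply: measurableT_comp => //; exact: measurable_uncons_rV.
have fE a v : f (cons_rV (a, v)) = g a * h v by rewrite /f cons_rVK.
have /integrableP[_ ig] := intg; have /integrableP[_ ih] := inth.
have Ioo : (\int[mu]_a \int[@lebesgue_rV R n]_v `|(EFin \o f) (cons_rV (a, v))| < +oo)%E.
  under eq_integral => a _.
    under eq_integral do rewrite /comp fE /= normrM EFinM.
    rewrite ge0_integralZl//; last first.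
      by apply/measurable_EFinP; exact: measurable_norm_fun.
    over.
  rewrite /= ge0_integralZr//; last 2 first.
  - by apply/measurable_EFinP; exact: measurable_norm_fun.
  - exact: integral_ge0.
  rewrite -ge0_fin_numE; last first.
    by rewrite mule_ge0//; exact: integral_ge0.
  by rewrite fin_numM// ge0_fin_numE//; exact: integral_ge0.
have mEf : measurable_fun setT (EFin \o f) by exact/measurable_EFinP.
have intf : (@lebesgue_rV R n.+1).-integrable setT (EFin \o f).
  apply/integrableP; split=> //.
  by rewrite ge0_integral_rV_cons//; exact: measurableT_comp.
split=> //.
have intfc : (mu \x @lebesgue_rV R n)%E.-integrable setT ((EFin \o f) \o @cons_rV R n).
  apply/integrable12ltyP => //.
  by apply: measurableT_comp => //; exact: measurable_cons_rV.
rewrite /Rintegral.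
transitivity (fine (\int[pushforward (mu \x (@lebesgue_rV R n))%E (@cons_rV R n)]_x (EFin \o f) x)%E) => //.
rewrite integral_pushforward//; last exact: measurable_cons_rV.
rewrite preimage_setT -integral12_prod_meas1//.
have inth_fin := integrable_fin_num measurableT inth.
have intg_fin := integrable_fin_num measurableT intg.
have FE a : fubini_F (@lebesgue_rV R n) ((EFin \o f) \o @cons_rV R n) a =
    ((fine (\int[@lebesgue_rV R n]_v (h v)%:E))%:E * (g a)%:E)%E.
  rewrite fineK// /fubini_F; under eq_integral do rewrite /comp fE EFinM.
  by rewrite integralZl// muleC.
transitivity (fine (\int[mu]_a ((fine (\int[@lebesgue_rV R n]_v (h v)%:E))%:E * (g a)%:E)))%E.
  by congr fine; apply: eq_integral => a _; exact: FE.
by rewrite integralZl// fineM// mulrC.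
Qed.

Lemma uncons_dotp n (x xi : 'rV[R]_n.+1) :
  dotp x xi = (uncons_rV x).1 * (uncons_rV xi).1 +
              dotp (uncons_rV x).2 (uncons_rV xi).2.
Proof.
rewrite /dotp big_ord_recl/=; congr (_ + _).
by apply: eq_bigr => i _; rewrite !mxE.
Qed.

Lemma uncons_prod n (f : 'I_n.+1 -> R -> R) (x : 'rV[R]_n.+1) :
  \prod_i f i (x ord0 i) = f ord0 (uncons_rV x).1 *
    \prod_i f (lift ord0 i) ((uncons_rV x).2 ord0 i).
Proof.
rewrite big_ord_recl/=; congr (_ * _).
by apply: eq_bigr => i _; rewrite !mxE.
Qed.

Lemma measurable_dotp n (xi : 'rV[R]_n) : measurable_fun setT (fun x => dotp x xi).
Proof.
apply: measurable_sum => i; apply: measurable_funM => //.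
exact: measurable_coord.
Qed.

Lemma measurable_cos_dotp n (xi : 'rV[R]_n) :
  measurable_fun setT (fun x => cos (dotp x xi)).
Proof.
apply: (measurableT_comp (f := @cos R)); last exact: measurable_dotp.
by apply: continuous_measurable_fun; exact: continuous_cos.
Qed.

Lemma measurable_sin_dotp n (xi : 'rV[R]_n) :
  measurable_fun setT (fun x => sin (dotp x xi)).
Proof.
apply: (measurableT_comp (f := @sin R)); last exact: measurable_dotp.
by apply: continuous_measurable_fun; exact: continuous_sin.
Qed.

Lemma integrable_cosM (f : R -> R) (xi : R) : mu.-integrable setT (EFin \o f) ->
  mu.-integrable setT (EFin \o (fun x : R => f x * cos (x * xi))).
Proof.
move=> intf; apply: (@integrableM_le1 _ (measurableTypeR R) R mu f) => //.
  by apply: continuous_measurable_fun; exact: continuous_cosM.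
by move=> x; exact: norm_cos_le1.
Qed.

Lemma integrable_sinM (f : R -> R) (xi : R) : mu.-integrable setT (EFin \o f) ->
  mu.-integrable setT (EFin \o (fun x : R => f x * sin (x * xi))).
Proof.
move=> intf; apply: (@integrableM_le1 _ (measurableTypeR R) R mu f) => //.
  by apply: continuous_measurable_fun; exact: continuous_sinM.
by move=> x; exact: norm_sin_le1.
Qed.

Definition fourier1 (f : R -> R) (xi : R) : R[i] :=
  Complex (\int[mu]_y (f y * cos (y * xi))) (- \int[mu]_y (f y * sin (y * xi))).

(** Induction on the dimension: once a coordinate is split off, the addition formulas for [cos] and
    [sin] are the real and imaginary parts of a complex product. *)
Lemma fourier_prod n (f : 'I_n -> R -> R) :
  (forall i, mu.-integrable setT (EFin \o f i)) ->
  (@lebesgue_rV R n).-integrable setT (EFin \o (fun x => \prod_i f i (x ord0 i))) /\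
  forall xi, fourier (fun x : 'rV[R]_n => \prod_i f i (x ord0 i)) xi =
    \prod_i fourier1 (f i) (xi ord0 i).
Proof.
elim: n f => [|n IH] f intf.
  split.
    apply/integrableP; split.
      by apply/measurable_EFinP; apply: measurable_prod_rV => -[].
    under eq_integral do rewrite /= big_ord0 normr1.
    by rewrite /= integral_dirac// diracT mul1e ltry.
  move=> xi; rewrite big_ord0 /fourier.
  have -> : xi = 0 by apply/rowP => -[].
  have d0 (x : 'rV[R]_0) : dotp x 0 = 0 by rewrite /dotp big_ord0.
  under eq_Rintegral do rewrite big_ord0 mul1r d0 cos0.
  under [X in - X]eq_Rintegral do rewrite big_ord0 mul1r d0 sin0.
  by rewrite /Rintegral /= !integral_dirac// diracT !mul1e oppr0.
have [intP FP] := IH (fun i => f (lift ord0 i)) (fun i => intf (lift ord0 i)).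
set P := (fun x : 'rV[R]_n => \prod_i f (lift ord0 i) (x ord0 i)) in intP FP.
have PE : (fun x : 'rV[R]_n.+1 => \prod_i f i (x ord0 i)) =
    (fun x => f ord0 (uncons_rV x).1 * P (uncons_rV x).2).
  by apply/funext => x; exact: uncons_prod.
split.
  have [H1 _] := integral_rV_cons_prod (intf ord0) intP.
  by apply: eq_integrable H1 => // x _; rewrite /= uncons_prod.
rewrite PE.
move=> xi; rewrite big_ord_recl.
pose xi0 := (uncons_rV xi).1; pose xi' := (uncons_rV xi).2.
have -> : \prod_(i < n) fourier1 (f (lift ord0 i)) (xi ord0 (lift ord0 i)) = fourier P xi'.
  by rewrite FP; apply: eq_bigr => i _; rewrite /xi' /= mxE.
have c1 := integrable_cosM xi0 (intf ord0); have s1 := integrable_sinM xi0 (intf ord0).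
have cP : (@lebesgue_rV R n).-integrable setT (EFin \o (fun x => P x * cos (dotp x xi'))).
  apply: integrableM_le1 intP (measurable_cos_dotp xi') _ => x; exact: norm_cos_le1.
have sP : (@lebesgue_rV R n).-integrable setT (EFin \o (fun x => P x * sin (dotp x xi'))).
  apply: integrableM_le1 intP (measurable_sin_dotp xi') _ => x; exact: norm_sin_le1.
have [Icc Ecc] := integral_rV_cons_prod c1 cP.
have [Iss Ess] := integral_rV_cons_prod s1 sP.
have [Isc Esc] := integral_rV_cons_prod s1 cP.
have [Ics Ecs] := integral_rV_cons_prod c1 sP.
rewrite /fourier /fourier1 -/xi0.
have -> : \int[@lebesgue_rV R n.+1]_x (f ord0 (uncons_rV x).1 * P (uncons_rV x).2 *
    cos (dotp x xi)) =
  (\int[mu]_y (f ord0 y * cos (y * xi0))) * (\int[@lebesgue_rV R n]_x (P x * cos (dotp x xi')))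
  - (\int[mu]_y (f ord0 y * sin (y * xi0))) * (\int[@lebesgue_rV R n]_x (P x * sin (dotp x xi'))).
  rewrite -Ecc -Ess -RintegralB//; apply: eq_Rintegral => x _.
  by rewrite uncons_dotp cosD; ring.
have -> : \int[@lebesgue_rV R n.+1]_x (f ord0 (uncons_rV x).1 * P (uncons_rV x).2 *
    sin (dotp x xi)) =
  (\int[mu]_y (f ord0 y * sin (y * xi0))) * (\int[@lebesgue_rV R n]_x (P x * cos (dotp x xi')))
  + (\int[mu]_y (f ord0 y * cos (y * xi0))) * (\int[@lebesgue_rV R n]_x (P x * sin (dotp x xi'))).
  rewrite -Esc -Ecs -RintegralD//; apply: eq_Rintegral => x _.
  by rewrite uncons_dotp sinD; ring.
rewrite [RHS]/GRing.mul /=; congr Complex; ring.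
Qed.
End fourier_product.

(** On nonnegative numbers the inverse is [powR] with exponent [-1], also at 0 where both are 0; the
    sign is handled by the positive and negative parts. *)
Lemma measurable_inv_fun d (T : measurableType d) (R : realType) (f : T -> R) :
  measurable_fun setT f -> measurable_fun setT (fun x => (f x)^-1).
Proof.
move=> mf.
apply: (eq_measurable_fun (fun x => Num.max (f x) 0 `^ (-1) - Num.max (- f x) 0 `^ (-1))).
  move=> x _; rewrite !powR_inv1 ?le_max ?lexx ?orbT//.
  have [fx|fx] := leP 0 (f x).
    by rewrite max_r ?oppr_le0// invr0 subr0.
  by rewrite max_l ?oppr_ge0 ?(ltW fx)// invr0 sub0r invrN opprK.
by apply: measurable_funB; apply: measurable_powR_fun; apply: measurable_maxr => //;
  exact: measurable_funN.
Qed.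

(** * Derivatives of the heat kernel *)

Section scaled_gauss.
Context {R : realType}.
Local Notation mu := (@lebesgue_measure R).

(* The [m]-th derivative of the heat kernel of [R] at time [rho ^+ 2]. *)
Definition sgauss (m : nat) (rho x : R) : R :=
  (rho^-1) ^+ m.+1 * dgauss m (x / rho).

Lemma sgauss_decay m n : exists2 C, 0 <= C & forall rho x, 0 < rho ->
  `|sgauss m rho x| <= C * ((rho^-1) ^+ m.+1 * ((1 + `|x| / rho) ^+ n)^-1).
Proof.
have [C C0 HC] := @dgauss_decay R m n; exists C => // rho x rho0.
rewrite /sgauss normrM ger0_norm ?exprn_ge0 ?invr_ge0 ?(ltW rho0)//.
rewrite mulrCA ler_wpM2l ?exprn_ge0 ?invr_ge0 ?(ltW rho0)//.
have z0 : 0 < 1 + `|x| / rho by rewrite ltr_pwDl// divr_ge0// ltW.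
rewrite ler_pdivlMr ?exprn_gt0//; have := HC (x / rho).
by rewrite normrM normfV (gtr0_norm rho0).
Qed.

Lemma integrable_sgauss m rho : 0 < rho ->
  mu.-integrable setT (EFin \o sgauss m rho).
Proof.
move=> rho0; have m0 := @measurable_dgauss R m.
have one (y : R) : `|cst (1 : R) y| <= 1 by rewrite normr1.
have H := integrable_dgaussM m (measurable_cst _) one.
have /integrableP[_] := H => Hoo.
have mE : measurable_fun setT (fun y : R => `|dgauss m y|%:E).
  by apply/measurable_EFinP; exact: measurable_norm_fun.
have I1 : mu.-integrable setT (EFin \o (fun x : R => dgauss m (x / rho))).
  apply/integrableP; split.
    apply/measurable_EFinP; apply: (measurableT_comp m0); exact: measurable_funM.
  rewrite [X in (X < _)%E](_ : _ = (rho%:E * \int[mu]_y `|dgauss m y|%:E)%E); last first.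
    by rewrite -(@ge0_integral_dilate R rho (fun y => `|dgauss m y|%:E)).
  rewrite lte_mul_pinfty ?lee_fin ?(ltW rho0)//.
  apply: le_lt_trans Hoo; rewrite le_eqVlt; apply/orP; left; apply/eqP.
  by apply: eq_integral => y _; rewrite /= mulr1.
have := integrableZl measurableT ((rho^-1) ^+ m.+1) I1.
by apply: eq_integrable.
Qed.

Lemma Rintegral_sgaussM m rho (k : R -> R) xi : 0 < rho -> continuous k ->
  (forall y, `|k y| <= 1) ->
  \int[mu]_x (sgauss m rho x * k (x * xi)) =
  (rho^-1) ^+ m * \int[mu]_y (dgauss m y * k (y * (rho * xi))).
Proof.
move=> rho0 ck k1.
have I2 : mu.-integrable setT (EFin \o (fun y : R => dgauss m y * k (y * (rho * xi)))).
  apply: integrable_dgaussM => //.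
  by apply: continuous_measurable_fun; exact: continuous_scaled.
have I1 : mu.-integrable setT (EFin \o (fun x : R => sgauss m rho x * k (x * xi))).
  apply: (@integrableM_le1 _ (measurableTypeR R) R mu (sgauss m rho)) => //.
    exact: integrable_sgauss.
  by apply: continuous_measurable_fun; exact: continuous_scaled.
have E (x : R) : dgauss m (x / rho) * k (x / rho * (rho * xi)) =
    rho ^+ m.+1 * (sgauss m rho x * k (x * xi)).
  have r1 : rho ^+ m.+1 * rho^-1 ^+ m.+1 = 1.
    by rewrite -exprMn divff ?gt_eqF// expr1n.
  by rewrite /sgauss !mulrA r1 mul1r divfK ?gt_eqF.
have := integral_dilate rho0 I2.
under eq_Rintegral do rewrite E.
rewrite RintegralZl// => H.
apply: (@mulfI _ (rho ^+ m.+1)); first by rewrite expf_neq0// gt_eqF.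
have r1 : rho ^+ m * rho^-1 ^+ m = 1 by rewrite -exprMn divff ?gt_eqF// expr1n.
by rewrite H exprS -mulrA; congr (_ * _); rewrite mulrA r1 mul1r.
Qed.

(** Each derivative contributes [rho xi] from the dilated frequency and [rho^-1] from the
    normalization, hence [i xi] independently of [rho]. *)
Lemma fourier1_sgauss m rho xi : 0 < rho ->
  fourier1 (sgauss m rho) xi =
  (Complex 0 xi) ^+ m * Complex (expR (- (rho * xi) ^+ 2)) 0.
Proof.
move=> rho0.
have E k : fourier1 (sgauss k rho) xi =
    Complex ((rho^-1) ^+ k * cosft k (rho * xi)) (- ((rho^-1) ^+ k * sinft k (rho * xi))).
  rewrite /fourier1 (Rintegral_sgaussM k xi rho0 (@continuous_cos R))//; last first.
    by move=> y; exact: norm_cos_le1.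
  rewrite (Rintegral_sgaussM k xi rho0 (@continuous_sin R))//.
  by move=> y; exact: norm_sin_le1.
elim: m => [|m IH].
  by rewrite E !expr0 !mul1r cosft0 sinft0 oppr0.
rewrite exprS -mulrA -IH !E cosftS sinftS.
rewrite [RHS]/GRing.mul /= exprS; congr Complex; field; exact: lt0r_neq0.
Qed.

(** The derivative of multi-index [ms] of the heat kernel of R^d at time [rho ^+ 2]. *)
Definition pgauss d (ms : 'I_d -> nat) (rho : R) (x : 'rV[R]_d) : R :=
  \prod_i sgauss (ms i) rho (x ord0 i).

Lemma fourier_pgauss d (ms : 'I_d -> nat) rho : 0 < rho ->
  (@lebesgue_rV R d).-integrable setT (EFin \o pgauss ms rho) /\
  forall xi, fourier (pgauss ms rho) xi =
    (\prod_i (Complex 0 (xi ord0 i)) ^+ ms i) *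
    Complex (expR (- (rho ^+ 2 * enorm xi ^+ 2))) 0.
Proof.
move=> rho0.
have [I F] := @fourier_prod R d (fun i => sgauss (ms i) rho)
  (fun i => integrable_sgauss (ms i) rho0).
split => // xi; rewrite F.
under eq_bigr do rewrite fourier1_sgauss//.
rewrite big_split/=; congr (_ * _).
rewrite sqr_enorm /dotp mulr_sumr -sumrN expR_sum.
rewrite (big_morph (fun x : R => Complex x 0) (id1 := 1) (op1 := *%R))//.
  by apply: eq_bigr => i _; rewrite exprMn expr2.
by move=> a b; rewrite [RHS]/GRing.mul/=; congr Complex; ring.
Qed.

Lemma ler_1sum_prod (I : Type) (s : seq I) (a : I -> R) : (forall i, 0 <= a i) ->
  1 + \sum_(i <- s) a i <= \prod_(i <- s) (1 + a i).
Proof.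
move=> a0; elim: s => [|i s IH]; first by rewrite !big_nil addr0.
rewrite !big_cons; set S := \sum_(j <- s) a j in IH *.
have S0 : 0 <= S by exact: sumr_ge0.
apply: (@le_trans _ _ ((1 + a i) * (1 + S))).
  rewrite (_ : (1 + a i) * (1 + S) = 1 + (a i + S) + a i * S); last by ring.
  by rewrite lerDl mulr_ge0.
by rewrite ler_wpM2l// addr_ge0.
Qed.

(** Powers of [rho^-1] add up over the coordinates, and the product of the [1 + |x_i| / rho] is at
    least [1 + norm1 x / rho]. *)
Lemma pgauss_decay d (ms : 'I_d -> nat) n : exists2 C, 0 <= C &
  forall rho x, 0 < rho ->
  `|pgauss ms rho x| <=
    C * ((rho^-1) ^+ (d + \sum_i ms i) * ((1 + norm1 x / rho) ^+ n)^-1).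
Proof.
pose C i := s2val (cid2 (sgauss_decay (ms i) n)).
have C0 i : 0 <= C i by rewrite /C; case: cid2.
have HC i rho x : 0 < rho ->
   `|sgauss (ms i) rho x| <= C i * ((rho^-1) ^+ (ms i).+1 * ((1 + `|x| / rho) ^+ n)^-1).
  by rewrite /C; case: cid2 => c c0 H; exact: H.
exists (\prod_i C i); first exact: prodr_ge0.
move=> rho x rho0; rewrite /pgauss normr_prod.
apply: (@le_trans _ _ (\prod_i (C i * ((rho^-1) ^+ (ms i).+1 *
    ((1 + `|x ord0 i| / rho) ^+ n)^-1)))).
  by apply: ler_prod => i _; rewrite normr_ge0/= HC.
rewrite big_split/= ler_wpM2l ?prodr_ge0//.
rewrite big_split/= prodrXr.
rewrite (_ : (\sum_(i < d) (ms i).+1 = d + \sum_i ms i)%N); last first.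
  rewrite (eq_bigr (fun i => 1 + ms i)%N)//.
  by rewrite big_split/= sum1_card card_ord.
rewrite ler_wpM2l ?exprn_ge0 ?invr_ge0 ?(ltW rho0)//.
rewrite prodfV lef_pV2 ?posrE; last 2 first.
- apply: prodr_gt0 => i _; rewrite exprn_gt0// ltr_pwDl// divr_ge0// ltW//.
- by rewrite exprn_gt0// ltr_pwDl// divr_ge0 ?norm1_ge0// ltW.
rewrite prodrXl lerXn2r// ?nnegrE.
- by rewrite addr_ge0// divr_ge0 ?norm1_ge0// ltW.
- by apply: prodr_ge0 => i _; rewrite addr_ge0// divr_ge0// ltW.
rewrite /norm1 mulr_suml; apply: ler_1sum_prod => i.
by rewrite divr_ge0// ltW.
Qed.
End scaled_gauss.

(** * The Oseen kernel *)

Section parametric_integrals.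
Context d1 d2 (T1 : measurableType d1) (T2 : measurableType d2) (R : realType).
Context (m1 : {sigma_finite_measure set T1 -> \bar R})
  (m2 : {sigma_finite_measure set T2 -> \bar R}).

(** The integrals of the positive and negative parts are measurable by Tonelli. As [fine] is
    measurable too, the total integral is measurable in its parameter, default values included. *)
Lemma measurable_Rintegral_param (f : T1 * T2 -> R) : measurable_fun setT f ->
  measurable_fun setT (fun x => \int[m2]_y f (x, y)).
Proof.
move=> mf; rewrite /Rintegral.
have mEf : measurable_fun setT (EFin \o f) by exact/measurable_EFinP.
apply: (measurableT_comp (f := fine)) => //.
have mp := @measurable_fun_fubini_tonelli_F _ _ _ _ R m2 (EFin \o f)^\+%E
  (measurable_funepos mEf) (funepos_ge0 (EFin \o f)).
have mn := @measurable_fun_fubini_tonelli_F _ _ _ _ R m2 (EFin \o f)^\-%E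
  (measurable_funeneg mEf) (funeneg_ge0 (EFin \o f)).
apply: (eq_measurable_fun (fun x => fubini_F m2 (EFin \o f)^\+%E x
    - fubini_F m2 (EFin \o f)^\-%E x)%E); last exact: emeasurable_funB.
move=> x _; rewrite [RHS]integralE; congr (_ - _)%E; apply: eq_integral => y _.
  by rewrite !funeposE.
by rewrite !funenegE.
Qed.

(** Integrability of every section, not merely of almost every one, lets [fine] be undone under the
    outer integrals. *)
Lemma Rintegral_Fubini (f : T1 * T2 -> R) :
  (m1 \x m2)%E.-integrable setT (EFin \o f) ->
  (forall x, m2.-integrable setT (EFin \o (fun y => f (x, y)))) ->
  (forall y, m1.-integrable setT (EFin \o (fun x => f (x, y)))) ->
  \int[m1]_x \int[m2]_y f (x, y) = \int[m2]_y \int[m1]_x f (x, y).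
Proof.
move=> intf int1 int2; rewrite /Rintegral; congr fine.
under eq_integral => x _ do rewrite fineK ?(integrable_fin_num measurableT (int1 x))//.
under [RHS]eq_integral => y _ do rewrite fineK ?(integrable_fin_num measurableT (int2 y))//.
exact: (Fubini (f := EFin \o f)) intf.
Qed.
End parametric_integrals.

Lemma measurable_bool_fun d1 (T : measurableType d1) (R : realType) (b : T -> bool) :
  measurable_fun setT b -> measurable_fun setT (fun x => (b x)%:R : R).
Proof. by move=> mb; apply: (measurableT_comp (f := (fun b : bool => b%:R : R))). Qed.

Section oseen_kernel.
Context {R : realType} {d : nat}.
Hypothesis d_gt0 : (0 < d)%N.
Local Notation E := 'rV[R]_d.
Local Notation mu := (@lebesgue_measure R).
Local Notation leb := (@lebesgue_rV R d).
Implicit Types (j k l : 'I_d) (x xi : E).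

(** Multi-indices of the derivative [d_l] and, for [ix3], of [d_j d_k d_l]. *)
Definition ix1 l : 'I_d -> nat := fun i => (i == l).
Definition ix3 j k l : 'I_d -> nat := fun i => ((i == j) + (i == k) + (i == l))%N.

Lemma sum_ix1 l : (\sum_i ix1 l i)%N = 1%N.
Proof. by rewrite (bigD1 l)//= /ix1 eqxx big1 ?addn0// => i /negbTE ->. Qed.

Lemma sum_ix3 j k l : (\sum_i ix3 j k l i)%N = 3%N.
Proof. by rewrite /ix3 !big_split/= !sum_ix1. Qed.

Lemma prod_ix1 (z : 'I_d -> R[i]) l : \prod_i z i ^+ ix1 l i = z l.
Proof.
by rewrite (bigD1 l)//= /ix1 eqxx big1 ?mulr1// => i /negbTE ->.
Qed.

Lemma prod_ix3 (z : 'I_d -> R[i]) j k l : \prod_i z i ^+ ix3 j k l i = z j * z k * z l.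
Proof.
rewrite /ix3; under eq_bigr do rewrite !exprD.
by rewrite !big_split/= !prod_ix1.
Qed.

Lemma measurable_pgauss (ms : 'I_d -> nat) d1 (T : measurableType d1)
    (f : T -> R) (g : T -> E) : measurable_fun setT f -> measurable_fun setT g ->
  measurable_fun setT (fun p => pgauss ms (f p) (g p)).
Proof.
move=> mf mg; apply: measurable_prod => i _; apply: measurable_funM.
  by apply: measurable_funX; exact: measurable_inv_fun.
apply: (measurableT_comp (@measurable_dgauss R (ms i))).
apply: measurable_funM; last exact: measurable_inv_fun.
exact: (measurableT_comp (measurable_coord i) mg).
Qed.

(** The factor [2 * (r + y)] is the Jacobian of [s = (r + y) ^+ 2]; the indicator extends the
    integrand to the whole line, as [measurable_Rintegral_param] expects. *)
Definition oseen_tail (r : R) j k l x (y : R) : R :=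
  (0 <= y)%R%:R * (2 * (r + y) * pgauss (ix3 j k l) (r + y) x).

(* With [rho = sqrt t + y], the integral is that of
   [d_j d_k d_l G_s x], [G] the heat kernel, over [s = rho ^+ 2 >= t]: the
   Leray projection comes from [|xi|^-2 e^(- t |xi|^2)], the integral of
   [e^(- s |xi|^2)] over [s >= t]. *)
Definition oseen_kernel (t : R) j k l x : R :=
  (0 < t)%R%:R * ((j == k)%:R * pgauss (ix1 l) (Num.sqrt t) x +
    \int[mu]_y oseen_tail (Num.sqrt t) j k l x y).

Lemma measurable_oseen_tail j k l d1 (T : measurableType d1)
    (rf : T -> R) (xf : T -> E) (yf : T -> R) :
  measurable_fun setT rf -> measurable_fun setT xf -> measurable_fun setT yf ->
  measurable_fun setT (fun p => oseen_tail (rf p) j k l (xf p) (yf p)).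
Proof.
move=> mr mx my; apply: measurable_funM.
  by apply: measurable_bool_fun; apply: measurable_fun_ler.
have mry : measurable_fun setT (fun p => rf p + yf p) by exact: measurable_funD.
by apply: measurable_funM; [exact: measurable_funM|exact: measurable_pgauss].
Qed.

Lemma measurable_oseen_kernel j k l :
  measurable_fun setT (fun p : R * E => oseen_kernel p.1 j k l p.2).
Proof.
have ms : measurable_fun setT (fun p : R * E => Num.sqrt p.1).
  apply: (measurableT_comp (f := @Num.sqrt R)) => //.
  by apply: continuous_measurable_fun; exact: sqrt_continuous.
apply: measurable_funM.
  by apply: measurable_bool_fun; apply: measurable_fun_ltr.
apply: measurable_funD.
  by apply: measurable_funM => //; exact: measurable_pgauss.
apply: (@measurable_Rintegral_param _ _ _ _ R mu
  (fun q : (R * E) * measurableTypeR R => oseen_tail (Num.sqrt q.1.1) j k l q.1.2 q.2)).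
apply: measurable_oseen_tail => //.
  exact: (measurableT_comp ms measurable_fst).
exact: (measurableT_comp measurable_snd measurable_fst).
Qed.

Lemma decayE (n : nat) (r N : R) : 0 < r ->
  (r^-1) ^+ n * ((1 + N / r) ^+ n)^-1 = ((r + N) ^+ n)^-1.
Proof.
move=> r0; rewrite -!exprVn -exprMn -invfM; congr (_^-1 ^+ _).
by rewrite mulrDr mulr1 mulrC divfK// gt_eqF.
Qed.

(** The third derivative carries [rho^-1] to the power [d + 3], and the Jacobian takes one of these
    away; the rest merges with the spatial decay into a power of [rho + norm1 x]. *)
Lemma oseen_tail_le j k l : exists2 C, 0 <= C & forall r x y, 0 < r -> 0 <= y ->
  `|oseen_tail r j k l x y| <= C * ((r + norm1 x) + y) `^ (- d.+2%:R).
Proof.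
have [C C0 HC] := @pgauss_decay R d (ix3 j k l) d.+2; exists (2 * C) => [|r x y r0 y0].
  exact: mulr_ge0.
have rho0 : 0 < r + y by rewrite ltr_pwDl.
rewrite /oseen_tail y0 mul1r normrM ger0_norm ?mulr_ge0 ?(ltW rho0)//.
rewrite powR_invn; last by rewrite addr_ge0// addr_ge0 ?norm1_ge0// ltW.
have := HC (r + y) x rho0; rewrite sum_ix3 addnC addSn addSn addSn add0n exprS -mulrA decayE// => H.
rewrite -!mulrA ler_wpM2l//.
apply: le_trans (ler_wpM2l (ltW rho0) H) _.
rewrite mulrCA (mulrA (r + y)) divff ?gt_eqF// mul1r.
by rewrite addrAC.
Qed.

(** Integration over [rho] gains one power: [d + 2] becomes [d + 1]. *)
Lemma integral_oseen_tail_le j k l : exists2 C, 0 <= C & forall r x, 0 < r ->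
  (\int[mu]_y `|oseen_tail r j k l x y|%:E <= (C * decay_kernel r x)%:E)%E.
Proof.
have [C C0 HC] := oseen_tail_le j k l; exists (C / d.+1%:R) => [|r x r0].
  exact: divr_ge0.
have rN : 0 < r + norm1 x by rewrite ltr_wpDr ?norm1_ge0.
have mt : measurable_fun setT (oseen_tail r j k l x) by exact: measurable_oseen_tail.
apply: (@le_trans _ _ (\int[mu]_(y in `[0%R, +oo[)
    (C * ((r + norm1 x) + y) `^ (- d.+2%:R))%:E)%E).
  rewrite [leRHS]integral_mkcond; apply: ge0_le_integral => //.
  - by apply/measurable_EFinP; exact: measurable_norm_fun.
  - apply/(measurable_restrictT _ _).1 => //; apply/measurable_EFinP/measurable_funTS.
    by apply: measurable_funM => //; apply: measurable_powR_fun; exact: measurable_funD.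
  - move=> y _; rewrite patchE; case: ifPn => [|].
      by rewrite inE/= in_itv/= andbT => y0; rewrite lee_fin; exact: HC.
    rewrite notin_setE/= in_itv/= andbT => /negP y0.
    by rewrite /oseen_tail (negbTE y0) mul0r normr0.
under eq_integral do rewrite EFinM.
rewrite ge0_integralZl//; last 2 first.
- apply/measurable_EFinP/measurable_funTS.
  by apply: measurable_powR_fun; exact: measurable_funD.
- by move=> y _; rewrite lee_fin powR_ge0.
rewrite integral_shift_powR ?ltr1n// -EFinM lee_fin -mulrA ler_wpM2l//.
rewrite (_ : d.+2%:R - 1 = d.+1%:R); last by rewrite -natr1 addrK.
rewrite (_ : 1 - d.+2%:R = - d.+1%:R); last by rewrite -natr1; ring.
by rewrite powR_invn ?(ltW rN)// mulrC.
Qed.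

Lemma oseen_kernel_le : exists2 C, 0 <= C & forall t j k l x, 0 < t ->
  `|oseen_kernel t j k l x| <= C * decay_kernel (Num.sqrt t) x.
Proof.
have H (p : 'I_d * 'I_d * 'I_d) : exists2 C, 0 <= C & forall t x, 0 < t ->
    `|oseen_kernel t p.1.1 p.1.2 p.2 x| <= C * decay_kernel (Num.sqrt t) x.
  move: p => [[j k] l] /=.
  have [C1 C10 H1] := @pgauss_decay R d (ix1 l) d.+1.
  have [C2 C20 H2] := integral_oseen_tail_le j k l.
  exists (C1 + C2) => [|t x t0]; first exact: addr_ge0.
  have r0 : 0 < Num.sqrt t by rewrite sqrtr_gt0.
  rewrite /oseen_kernel t0 mul1r mulrDl.
  apply: le_trans (ler_normD _ _) _; apply: lerD.
    rewrite normrM; apply: (@le_trans _ _ `|pgauss (ix1 l) (Num.sqrt t) x|).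
      by rewrite ler_piMl//; case: (j == k); rewrite ?normr1 ?normr0.
    apply: le_trans (H1 _ x r0) _.
    by rewrite sum_ix1 addn1 decayE.
  have [] := @Rintegral_dominated R _ (measurableTypeR R) mu setT
    (oseen_tail (Num.sqrt t) j k l x) (fun y => `|oseen_tail (Num.sqrt t) j k l x y|)
    (C2 * decay_kernel (Num.sqrt t) x) measurableT => //.
  - exact: measurable_oseen_tail.
  - by apply: measurable_norm_fun; exact: measurable_oseen_tail.
  - exact: H2.
(* There are finitely many index triples, so the sum of their constants serves for all. *)
pose C p := s2val (cid2 (H p)).
have C0 p : 0 <= C p by rewrite /C; case: cid2.
exists (\sum_p C p) => [|t j k l x t0]; first exact: sumr_ge0.
apply: (@le_trans _ _ (C (j, k, l) * decay_kernel (Num.sqrt t) x)).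
  by rewrite /C; case: cid2 => c c0 /= Hc; exact: Hc.
rewrite ler_wpM2r ?decay_kernel_ge0 ?sqrtr_gt0//.
by rewrite (bigD1 (j, k, l))//= lerDl sumr_ge0.
Qed.

Lemma measurable_decay_kernel (r : R) : measurable_fun setT (@decay_kernel R d r).
Proof.
apply: measurable_inv_fun; apply: measurable_funX; apply: measurable_funD => //.
exact: measurable_norm1.
Qed.

(** The weighted bound with exponent [b = 0], the constant function 1 and the point 0. *)
Lemma integral_decay_kernel_lty (r : R) : 0 < r ->
  (\int[leb]_x (decay_kernel r x)%:E < +oo)%E.
Proof.
move=> r0.
have := @decay_kernel_ball_bound R d d_gt0 0 r 0 1 (cst 1) r0 (lexx _).
rewrite ltr0n => /(_ d_gt0 ler01 (measurable_cst _)) H.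
apply: (@le_lt_trans _ _ (@ball_const R d 0 * 1 * ball_bound r 0 (0 : E))%:E); last exact: ltry.
apply: le_trans (H _).
  rewrite le_eqVlt; apply/orP; left; apply/eqP; apply: eq_integral => y _.
  rewrite normr1 mulr1 sub0r /decay_kernel /norm1.
  by under [in RHS]eq_bigr do rewrite mxE normrN.
by apply: aeW => y; rewrite powRr0 normr1 mulr1.
Qed.

Lemma integrable_oseen_kernel t j k l : 0 < t ->
  leb.-integrable setT (EFin \o oseen_kernel t j k l).
Proof.
move=> t0; have [C C0 HC] := oseen_kernel_le.
have r0 : 0 < Num.sqrt t by rewrite sqrtr_gt0.
apply/integrableP; split.
  apply/measurable_EFinP.
  apply: (measurableT_comp (measurable_oseen_kernel j k l) (g := fun x => (t, x))).
  exact: pair1_measurable.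
apply: (@le_lt_trans _ _ (C%:E * \int[leb]_x (decay_kernel (Num.sqrt t) x)%:E)%E).
  rewrite -ge0_integralZl//; last 2 first.
  - by apply/measurable_EFinP; exact: measurable_decay_kernel.
  - by move=> x _; rewrite lee_fin decay_kernel_ge0.
  apply: ge0_le_integral => //.
  - apply/measurable_EFinP; apply: measurable_norm_fun.
    apply: (measurableT_comp (measurable_oseen_kernel j k l) (g := fun x => (t, x))).
    exact: pair1_measurable.
  - apply: measurable_funeM; apply/measurable_EFinP; exact: measurable_decay_kernel.
  - by move=> x _; rewrite -EFinM lee_fin HC.
by rewrite lte_mul_pinfty ?lee_fin// integral_decay_kernel_lty.
Qed.

Lemma integrable_oseen_tail r j k l : 0 < r ->
  (leb \x mu)%E.-integrable setT
    (EFin \o (fun p : E * measurableTypeR R => oseen_tail r j k l p.1 p.2)).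
Proof.
move=> r0; have [C C0 HC] := integral_oseen_tail_le j k l.
have mt : measurable_fun setT
    (fun p : E * measurableTypeR R => oseen_tail r j k l p.1 p.2).
  exact: measurable_oseen_tail.
have mEt : measurable_fun setT
    (EFin \o (fun p : E * measurableTypeR R => oseen_tail r j k l p.1 p.2)).
  exact/measurable_EFinP.
apply/integrable12ltyP => //.
apply: (@le_lt_trans _ _ (C%:E * \int[leb]_x (decay_kernel r x)%:E)%E).
  rewrite -ge0_integralZl//; last 2 first.
  - by apply/measurable_EFinP; exact: measurable_decay_kernel.
  - by move=> x _; rewrite lee_fin decay_kernel_ge0.
  apply: ge0_le_integral => //.
  - by move=> x _; exact: integral_ge0.
  - apply: (@measurable_fun_fubini_tonelli_F _ _ _ _ R mu
      (abse \o (EFin \o (fun p : E * measurableTypeR R => oseen_tail r j k l p.1 p.2)))) => //.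
      exact: measurableT_comp.
    by move=> p; exact: abse_ge0.
  - apply: measurable_funeM; apply/measurable_EFinP; exact: measurable_decay_kernel.
  - by move=> x _; rewrite -EFinM; exact: HC.
by rewrite lte_mul_pinfty ?lee_fin// integral_decay_kernel_lty.
Qed.

(** Fubini with a bounded factor [h], to be [cos] or [sin]: it reduces the transform of the tail to
    those of the third derivatives of Gaussians. *)
Lemma Rintegral_oseen_tailM r j k l (h : E -> R) : 0 < r -> measurable_fun setT h ->
  (forall x, `|h x| <= 1) ->
  leb.-integrable setT (EFin \o (fun x => (\int[mu]_y oseen_tail r j k l x y) * h x)) /\
  \int[leb]_x ((\int[mu]_y oseen_tail r j k l x y) * h x) =
  \int[mu]_y ((0 <= y)%R%:R * (2 * (r + y) *
    \int[leb]_x (pgauss (ix3 j k l) (r + y) x * h x))).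
Proof.
move=> r0 mh h1; have [C C0 HC] := integral_oseen_tail_le j k l.
have int1 x : mu.-integrable setT (EFin \o (oseen_tail r j k l x)).
  apply/integrableP; split.
    by apply/measurable_EFinP; exact: measurable_oseen_tail.
  exact: le_lt_trans (HC r x r0) (ltry _).
have intg (rho : R) : 0 < rho -> leb.-integrable setT (EFin \o pgauss (ix3 j k l) rho).
  by move=> rho0; have [] := @fourier_pgauss R d (ix3 j k l) rho rho0.
have intgh (rho : R) : 0 < rho ->
    leb.-integrable setT (EFin \o (fun x => pgauss (ix3 j k l) rho x * h x)).
  by move=> rho0; apply: integrableM_le1 => //; exact: intg.
pose f (p : E * measurableTypeR R) := oseen_tail r j k l p.1 p.2 * h p.1.
have intf : (leb \x mu)%E.-integrable setT (EFin \o f).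
  apply: (integrableM_le1 (integrable_oseen_tail j k l r0) (k := h \o fst)).
    exact: measurableT_comp.
  by move=> p; exact: h1.
have fE1 x y : f (x, y) = h x * oseen_tail r j k l x y by rewrite /f/= mulrC.
have fE2 x y : f (x, y) = ((0 <= y)%R%:R * (2 * (r + y))) *
    (pgauss (ix3 j k l) (r + y) x * h x) by rewrite /f/= /oseen_tail; ring.
have LE : (fun x => (\int[mu]_y oseen_tail r j k l x y) * h x) =
    (fun x => \int[mu]_y f (x, y)).
  apply/funext => x; under [RHS]eq_Rintegral do rewrite fE1.
  by rewrite RintegralZl// mulrC.
have pos (y : R) : 0 <= y -> 0 < r + y by move=> y0; rewrite ltr_pwDl.
have int2 (y : R) : leb.-integrable setT (EFin \o (fun x => f (x, y))).
  have [y0|y0] := leP 0 y.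
    have := integrableZl measurableT ((0 <= y)%R%:R * (2 * (r + y))) (intgh _ (pos y y0)).
    by apply: eq_integrable => // x _; rewrite /comp fE2 -EFinM.
  have := integrable0 leb setT; apply: eq_integrable => // x _.
  by rewrite /comp fE2 leNgt y0 mul0r mul0r.
have int1' x : mu.-integrable setT (EFin \o (fun y => f (x, y))).
  have := integrableZl measurableT (h x) (int1 x).
  by apply: eq_integrable => // y _; rewrite /comp fE1 -EFinM.
rewrite LE; split.
  have := integrable_fubini_F intf; apply: eq_integrable => // x _.
  rewrite /fubini_F /comp /Rintegral fineK//.
  exact: (integrable_fin_num measurableT (int1' x)).
rewrite (Rintegral_Fubini intf int1' int2); apply: eq_Rintegral => y _.
have [y0|y0] := leP 0 y; last first.
  rewrite mul0r; under eq_Rintegral do rewrite fE2 leNgt y0 mul0r mul0r.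
  by rewrite Rintegral_cst// mul0r.
under eq_Rintegral do rewrite fE2.
by rewrite RintegralZl ?y0 ?mul1r//; exact: intgh (pos y y0).
Qed.

(** In the variable [s = (r + y) ^+ 2] this is the integral of [expR (- s c)] over [s >= r ^+ 2].
    With [c] equal to [|xi|^2], the quotient by [c] is the one in the Leray projection. *)
Lemma Rintegral_gauss_tail (r c : R) : 0 < r -> 0 < c ->
  \int[mu]_y ((0 <= y)%R%:R * (2 * (r + y) * expR (- ((r + y) ^+ 2 * c)))) =
  expR (- (r ^+ 2 * c)) / c.
Proof.
move=> r0 c0.
pose F (y : R) := - (expR (- ((r + y) ^+ 2 * c)) / c).
pose f (y : R) := 2 * (r + y) * expR (- ((r + y) ^+ 2 * c)).
have dF (y : R) : is_derive y (1 : R) F (f y).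
  have D1 : is_derive y (1 : R) (fun z : R => r + z) 1.
    by have := is_deriveD (is_derive_cst r y (1 : R)) (is_derive_id y (1 : R)); rewrite add0r.
  have D2 : is_derive y (1 : R) (fun z : R => - ((r + z) ^+ 2 * c)) (- (2 * (r + y) * c)).
    have := is_deriveN (is_deriveM (is_deriveM D1 D1) (is_derive_cst c y (1 : R))).
    rewrite (_ : - (_ * _) = fun z : R => - ((r + z) ^+ 2 * c)); last first.
      by apply/funext => z; rewrite expr2.
    by move/is_derive_eq; apply; rewrite /GRing.scale/= ?fctE; ring.
  have H := @is_derive1_comp _ expR _ y _ _ (is_derive_expR _) D2.
  have := is_deriveN (is_deriveM H (is_derive_cst (c^-1 : R) y (1 : R))).
  move/is_derive_eq; apply; rewrite /GRing.scale/= /f.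
  by set e := expR _; field; exact: lt0r_neq0.
have cF y : F z @[z --> y] --> F y.
  by apply/differentiable_continuous/derivable1_diffP; have [] := dF y.
have ca : continuous (fun y : R => r + y).
  by move=> y; apply: cvgD; [exact: cvg_cst|exact: cvg_id].
have cf : continuous f.
  move=> y; apply: cvgM; first by apply: cvgM; [exact: cvg_cst|exact: ca].
  apply: (@continuous_comp _ _ _ (fun y : R => - ((r + y) ^+ 2 * c)) expR).
    apply: cvgN; apply: cvgM; last exact: cvg_cst.
    rewrite /= expr2; under eq_fun do rewrite expr2.
    by apply: cvgM; exact: ca.
  exact: continuous_expR.
transitivity (\int[mu]_(y in `[0, +oo[) f y).
  rewrite [RHS]Rintegral_mkcond; apply: eq_Rintegral => y _.
  rewrite patchE; case: ifPn; rewrite ?inE ?notin_setE/= in_itv/= andbT.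
    by move=> ->; rewrite mul1r.
  by move=> /negP/negbTE ->; rewrite mul0r.
rewrite (@Rintegral_ge0_continuous_FTC2y _ f F 0 0).
- by rewrite /F addr0 sub0r opprK.
- by move=> y y0; rewrite mulr_ge0 ?expR_ge0// mulr_ge0// addr_ge0// ltW.
- exact: continuous_subspaceT.
- rewrite -oppr0 -(mul0r c^-1); apply: cvgN; apply: cvgM; last exact: cvg_cst.
  (* The comparison rests on [(r + y)^2 >= 2 r y]. *)
  apply: (@squeeze_cvgr _ _ _ _ (cst 0) (fun y : R => expR (- (2 * r * c * y)))).
  + near=> y; rewrite expR_ge0/= ler_expR lerN2 mulrAC ler_wpM2r ?(ltW c0)//.
    have : 0 <= y by near: y; apply: nbhs_pinfty_ge; exact: num_real.
    move=> y0; rewrite -subr_ge0 (_ : _ - _ = r ^+ 2 + y ^+ 2); last by ring.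
    by rewrite addr_ge0 ?sqr_ge0.
  + exact: cvg_cst.
  + have cy : 2 * r * c * y @[y --> +oo] --> +oo.
      by apply: gt0_cvgMry; [rewrite !mulr_gt0|exact: cvg_id].
    exact: (cvg_comp _ (fun y : R => expR (- y)) cy (@cvgr_expR R)).
- by move=> y _; have [] := dF y.
- by apply: cvg_at_right_filter; exact: cF.
- by move=> y _; rewrite derive1E; have [_ ->] := dF y.
Unshelve. all: end_near. Qed.

(** Were the extended integral of this nonnegative function infinite, [fine] would make the real one
    0, whereas [Rintegral_gauss_tail] gives a positive value. *)
Lemma integrable_gauss_tail (r c : R) : 0 < r -> 0 < c ->
  mu.-integrable setT (EFin \o (fun y : R =>
    (0 <= y)%R%:R * (2 * (r + y) * expR (- ((r + y) ^+ 2 * c))))).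
Proof.
move=> r0 c0; have := Rintegral_gauss_tail r0 c0.
set f := (fun y : R => _) => fE.
have f0 y : 0 <= f y.
  rewrite /f; have [y0|_] := leP 0 y; last by rewrite mul0r.
  by rewrite !mulr_ge0 ?expR_ge0// addr_ge0// ltW.
have mr : measurable_fun setT (fun y : R => r + y) by exact: measurable_funD.
apply/integrableP; split.
  apply/measurable_EFinP; apply: measurable_funM.
    by apply: measurable_bool_fun; exact: measurable_fun_ler.
  apply: measurable_funM; first exact: measurable_funM.
  apply: (measurableT_comp (f := @expR R)) => //.
  by apply: measurableT_comp => //; apply: measurable_funM => //; exact: measurable_funX.
rewrite ltNge leye_eq; apply/negP => /eqP foo.
have : 0 < \int[mu]_y f y by rewrite fE divr_gt0// expR_gt0.
rewrite /Rintegral; under eq_integral do rewrite -[f _]ger0_norm//.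
by rewrite foo ltxx.
Qed.

Lemma oseen_kernel_fourier t j k l xi : 0 < t ->
  fourier (oseen_kernel t j k l) xi = oseen_symbol t j k l xi.
Proof.
move=> t0; have r0 : 0 < Num.sqrt t by rewrite sqrtr_gt0.
set r := Num.sqrt t in r0; have rt : r ^+ 2 = t by rewrite sqr_sqrtr// ltW.
pose e (rho : R) := expR (- (rho ^+ 2 * enorm xi ^+ 2)).
have KE x : oseen_kernel t j k l x = (j == k)%:R * pgauss (ix1 l) r x +
    \int[mu]_y oseen_tail r j k l x y by rewrite /oseen_kernel t0 mul1r.
have [I1 /(_ xi)] := @fourier_pgauss R d (ix1 l) r r0.
rewrite prod_ix1 [RHS]/GRing.mul/= => -[]; rewrite !mul0r !mulr0 ?subr0 ?add0r => C1 S1.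
(* Three derivatives give the factor [i^3 = - i]: no cosine part, and a sine part of sign opposite
   to that of the first derivative. *)
have F3 (rho : R) : 0 < rho ->
    \int[leb]_x (pgauss (ix3 j k l) rho x * cos (dotp x xi)) = 0 /\
    \int[leb]_x (pgauss (ix3 j k l) rho x * sin (dotp x xi)) =
      xi ord0 j * xi ord0 k * xi ord0 l * e rho.
  move=> rho0; have [_ /(_ xi)] := @fourier_pgauss R d (ix3 j k l) rho rho0.
  rewrite prod_ix3 ![in RHS]/GRing.mul/= => -[] C3 S3; split; first by rewrite C3; ring.
  by apply: oppr_inj; rewrite S3 /e; ring.
have cM := measurable_cos_dotp xi; have sM := measurable_sin_dotp xi.
have [It1 Et1] := Rintegral_oseen_tailM j k l r0 cM (fun x => norm_cos_le1 _).
have [It2 Et2] := Rintegral_oseen_tailM j k l r0 sM (fun x => norm_sin_le1 _).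
have pos (y : R) : 0 <= y -> 0 < r + y by move=> y0; rewrite ltr_pwDl.
have Ec : \int[leb]_x (oseen_kernel t j k l x * cos (dotp x xi)) = 0.
  have Ig := integrableM_le1 I1 cM (fun x => norm_cos_le1 _).
  transitivity (\int[leb]_x ((j == k)%:R * (pgauss (ix1 l) r x * cos (dotp x xi)) +
      (\int[mu]_y oseen_tail r j k l x y) * cos (dotp x xi))).
    by apply: eq_Rintegral => x _; rewrite KE; ring.
  rewrite RintegralD//; last by
    have := integrableZl measurableT (j == k)%:R Ig; apply: eq_integrable.
  rewrite RintegralZl// C1 mulr0 add0r Et1.
  under eq_Rintegral => y _.
    rewrite (_ : _ * _ = 0); last first.
      by case: leP => [/pos/F3[-> _]|_]; rewrite ?mul0r ?mulr0.
    over.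
  by rewrite /= Rintegral_cst// mul0r.
have Es : \int[leb]_x (oseen_kernel t j k l x * sin (dotp x xi)) =
   - ((j == k)%:R * (xi ord0 l * e r)) + \int[mu]_y ((0 <= y)%R%:R * (2 * (r + y) *
    (xi ord0 j * xi ord0 k * xi ord0 l * e (r + y)))).
  have Ig := integrableM_le1 I1 sM (fun x => norm_sin_le1 _).
  transitivity (\int[leb]_x ((j == k)%:R * (pgauss (ix1 l) r x * sin (dotp x xi)) +
      (\int[mu]_y oseen_tail r j k l x y) * sin (dotp x xi))).
    by apply: eq_Rintegral => x _; rewrite KE; ring.
  rewrite RintegralD//; last by
    have := integrableZl measurableT (j == k)%:R Ig; apply: eq_integrable.
  rewrite RintegralZl// -mulrN -S1 opprK Et2; congr (_ + _).
  apply: eq_Rintegral => y _.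
  by case: leP => [/pos/F3[_ ->]|_]; rewrite ?mul0r.
rewrite /fourier /oseen_symbol Ec Es; congr Complex.
rewrite -rt -/(e r).
(* At frequency 0 the quotient in the symbol is a division by 0, but the factor [xi_l] makes both
   sides vanish. *)
have [xi0|xi0] := eqVneq (enorm xi ^+ 2) 0.
  have z i : xi ord0 i = 0.
    move/eqP: xi0; rewrite sqrf_eq0 => /eqP xi0.
    by apply/eqP; rewrite -normr_le0 -xi0 coord_le_enorm.
  rewrite !z xi0; under eq_Rintegral do rewrite !mul0r !mulr0.
  by rewrite Rintegral_cst//; ring.
have c0 : 0 < enorm xi ^+ 2 by rewrite lt0r xi0 sqr_ge0.
transitivity ((j == k)%:R * (xi ord0 l * e r) - xi ord0 j * xi ord0 k * xi ord0 l *
   \int[mu]_y ((0 <= y)%R%:R * (2 * (r + y) * e (r + y)))).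
  rewrite opprD opprK; congr (_ - _).
  rewrite -RintegralZl//; last first.
    exact: integrable_gauss_tail.
  by apply: eq_Rintegral => y _; ring.
rewrite Rintegral_gauss_tail// -/(e r).
by set w := enorm xi ^+ 2 in xi0 *; set ee := e r; field.
Qed.

Lemma is_oseen_kernel_oseen : is_oseen_kernel oseen_kernel.
Proof.
move=> t t0 j k l; split; first exact: integrable_oseen_kernel.
by move=> xi; exact: oseen_kernel_fourier.
Qed.
End oseen_kernel.

(** * Bounds on the Duhamel and heat terms *)

Section duhamel.
Context {R : realType} {d : nat}.
Hypothesis d_gt0 : (0 < d)%N.
Local Notation E := 'rV[R]_d.
Local Notation mu := (@lebesgue_measure R).
Local Notation leb := (@lebesgue_rV R d).
Local Notation K := (@oseen_kernel R d).
Implicit Types (j k l : 'I_d) (x y : E).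

Definition duhamel (F : R -> E -> 'M[R]_d) (t : R) x : E :=
  \row_j \int[mu]_(tau in `]0, t[) oseen K (t - tau) (F tau) x ord0 j.

Definition measurable_tensor (F : R -> E -> 'M[R]_d) :=
  forall k l, measurable_fun setT (fun p : R * E => F p.1 p.2 k l).

Lemma measurable_oseen (F : R -> E -> 'M[R]_d) j : measurable_tensor F ->
  measurable_fun setT
    (fun q : (R * E) * measurableTypeR R =>
       oseen K (q.1.1 - q.2) (F q.2) q.1.2 ord0 j).
Proof.
move=> mF.
apply: (eq_measurable_fun (fun q : (R * E) * measurableTypeR R => \sum_k \sum_l
    \int[leb]_y (K (q.1.1 - q.2) j k l (q.1.2 - y) * F q.2 y k l))).
  by move=> q _; rewrite mxE.
apply: measurable_sum => k; apply: measurable_sum => l.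
apply: (@measurable_Rintegral_param _ _ _ _ R leb
  (fun q : ((R * E) * measurableTypeR R) * E =>
     K (q.1.1.1 - q.1.2) j k l (q.1.1.2 - q.2) * F q.1.2 q.2 k l)).
have m1 : measurable_fun setT (fun q : ((R * E) * measurableTypeR R) * E => q.1.1.1).
  exact: (measurableT_comp measurable_fst (measurableT_comp measurable_fst measurable_fst)).
have m2 : measurable_fun setT (fun q : ((R * E) * measurableTypeR R) * E => q.1.1.2).
  exact: (measurableT_comp measurable_snd (measurableT_comp measurable_fst measurable_fst)).
have m3 : measurable_fun setT (fun q : ((R * E) * measurableTypeR R) * E => (q.1.2 : R)).
  exact: (measurableT_comp measurable_snd measurable_fst).
have m4 : measurable_fun setT (fun q : ((R * E) * measurableTypeR R) * E => q.2).
  exact: measurable_snd.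
apply: measurable_funM.
  apply: (measurableT_comp (measurable_oseen_kernel j k l)
    (g := fun q : ((R * E) * measurableTypeR R) * E => (q.1.1.1 - q.1.2, q.1.1.2 - q.2))).
  apply/measurable_fun_pairP; split; first exact: measurable_funB.
  apply: (measurableT_comp measurable_subrV
    (g := fun q : ((R * E) * measurableTypeR R) * E => (q.1.1.2, q.2))).
  exact/measurable_fun_pairP.
apply: (measurableT_comp (mF k l)
    (g := fun q : ((R * E) * measurableTypeR R) * E => (q.1.2 : R, q.2))).
exact/measurable_fun_pairP.
Qed.

Lemma measurable_oseen_time (F : R -> E -> 'M[R]_d) t x j : measurable_tensor F ->
  measurable_fun setT (fun tau : R => oseen K (t - tau) (F tau) x ord0 j).
Proof.
move=> mF.
apply: (measurableT_comp (measurable_oseen j mF)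
  (g := fun tau : measurableTypeR R => ((t, x), tau))).
exact: pair1_measurable.
Qed.

Lemma measurable_duhamel (F : R -> E -> 'M[R]_d) : measurable_tensor F ->
  measurable_fun setT (fun p : R * E => duhamel F p.1 p.2).
Proof.
move=> mF; apply: measurable_fun_rV => j.
(* The interval []0, t[] depends on the parameter; indicators move this dependence into the
   integrand. *)
apply: (eq_measurable_fun (fun p : R * E => \int[mu]_tau
    ((0 < tau)%R%:R * (tau < p.1)%R%:R * oseen K (p.1 - tau) (F tau) p.2 ord0 j))).
  move=> p _; rewrite mxE [RHS]Rintegral_mkcond; apply: eq_Rintegral => tau _.
  rewrite patchE mem_setE /= in_itv/=.
  by case: (0 < tau); case: (tau < p.1); rewrite ?mul1r ?mul0r.
apply: (@measurable_Rintegral_param _ _ _ _ R mu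
  (fun q : (R * E) * measurableTypeR R => (0 < q.2)%R%:R * (q.2 < q.1.1)%R%:R *
     oseen K (q.1.1 - q.2) (F q.2) q.1.2 ord0 j)).
apply: measurable_funM; last exact: measurable_oseen.
have m1 : measurable_fun setT (fun q : (R * E) * measurableTypeR R => q.1.1).
  exact: (measurableT_comp measurable_fst measurable_fst).
have m2 : measurable_fun setT (fun q : (R * E) * measurableTypeR R => (q.2 : R)).
  exact: measurable_snd.
by apply: measurable_funM; apply: measurable_bool_fun; exact: measurable_fun_ltr.
Qed.

Lemma convol_oseen_le : exists2 C, 0 <= C & forall j k l (s b M : R) (f : E -> R) x,
  0 < s -> 0 <= b -> b < d%:R -> 0 <= M -> measurable_fun setT f ->
  {ae leb, forall y, enorm y `^ b * `|f y| <= M} ->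
  leb.-integrable setT (EFin \o (fun y => K s j k l (x - y) * f y)) /\
  `|convol (K s j k l) f x| <= C * (ball_const (d := d) b * M * ball_bound (Num.sqrt s) b x).
Proof.
have [C C0 HC] := @oseen_kernel_le R d; exists C => // j k l s b M f x s0 b0 bd M0 mf fM.
have r0 : 0 < Num.sqrt s by rewrite sqrtr_gt0.
have msub : measurable_fun setT (fun y => x - y).
  apply: (measurableT_comp measurable_subrV (g := fun y => (x, y))).
  exact: pair1_measurable.
have mk : measurable_fun setT (fun y => decay_kernel (Num.sqrt s) (x - y)).
  exact: (measurableT_comp (measurable_decay_kernel _) msub).
have mg : measurable_fun setT (fun y => decay_kernel (Num.sqrt s) (x - y) * `|f y|).
  by apply: measurable_funM => //; exact: measurable_norm_fun.
have g0 y : 0 <= decay_kernel (Num.sqrt s) (x - y) * `|f y|.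
  by rewrite mulr_ge0// decay_kernel_ge0.
have [] := @Rintegral_dominated R _ E leb setT (fun y => K s j k l (x - y) * f y)
  (fun y => C * (decay_kernel (Num.sqrt s) (x - y) * `|f y|))
  (C * (ball_const (d := d) b * M * ball_bound (Num.sqrt s) b x)) measurableT => //.
- apply: measurable_funM => //.
  apply: (measurableT_comp (measurable_oseen_kernel j k l) (g := fun y => (s, x - y))).
  by apply/measurable_fun_pairP; split; [exact: measurable_cst|exact: msub].
- exact: measurable_funM.
- by move=> y _; rewrite normrM mulrA ler_wpM2r// HC.
- under eq_integral do rewrite EFinM.
  rewrite ge0_integralZl//; last 2 first.
  + exact/measurable_EFinP.
  + by move=> y _; rewrite lee_fin.
  by rewrite EFinM lee_wpmul2l ?lee_fin//; exact: decay_kernel_ball_bound.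
Qed.

(** The exponent [a] stays free between 0 and [b]: each use decides how much spatial decay to keep
    and how much to turn into a power of [s]. *)
Lemma oseen_decay (b : R) : 0 <= b -> b < d%:R ->
  exists2 A, 0 <= A & forall (s M : R) (F : E -> 'M[R]_d), 0 < s -> 0 <= M ->
  (forall k l, measurable_fun setT (fun y => F y k l)) ->
  (forall y k l, enorm y `^ b * `|F y k l| <= M) ->
  forall x j a, 0 <= a -> a <= b ->
  enorm x `^ a * `|oseen K s F x ord0 j| <= A * M * s `^ (- ((1 + b - a) / 2)).
Proof.
move=> b0 bd; have [C C0 HC] := convol_oseen_le.
have B0 : 0 <= ball_const (R := R) (d := d) b.
  rewrite addr_ge0 ?exprn_ge0 ?mulr_ge0 ?powR_ge0 ?divr_ge0 ?exprn_ge0 ?mulr_ge0//.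
  by rewrite invr_ge0 subr_ge0 ler_pdivrMr ?ltr0n// mul1r ltW.
exists ((d * d)%:R * C * ball_const (d := d) b * 2 `^ b) => [|s M F s0 M0 mF FM x j a a0 ab].
  by rewrite !mulr_ge0// powR_ge0.
have r0 : 0 < Num.sqrt s by rewrite sqrtr_gt0.
have V0 : 0 <= ball_bound (Num.sqrt s) b x.
  by rewrite mulr_ge0 ?powR_ge0// invr_ge0 ltW.
have O : `|oseen K s F x ord0 j| <=
    (d * d)%:R * (C * (ball_const (d := d) b * M * ball_bound (Num.sqrt s) b x)).
  rewrite mxE; apply: le_trans (ler_norm_sum _ _ _) _.
  rewrite natrM -mulrA mulr_natl -[X in _ *+ X](card_ord d) -sumr_const; apply: ler_sum => k _.
  apply: le_trans (ler_norm_sum _ _ _) _.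
  rewrite mulr_natl -[X in _ *+ X](card_ord d) -sumr_const; apply: ler_sum => l _.
  have [|_ //] := HC j k l s b M (fun y => F y k l) x s0 b0 bd M0 (mF k l).
  by apply: aeW => y; exact: FM.
apply: le_trans (ler_wpM2l (powR_ge0 _ _) O) _.
have -> : s `^ (- ((1 + b - a) / 2)) = Num.sqrt s `^ (- (1 + b - a)).
  by rewrite -powR12_sqrt ?ltW// -powRrM; congr powR; field.
have := ball_bound_le x r0 a0 ab => H.
set dd := (d * d)%:R; rewrite [leLHS](_ : _ = (dd * C * ball_const (d := d) b * M) *
  (enorm x `^ a * ball_bound (Num.sqrt s) b x)); last by ring.
apply: le_trans (ler_wpM2l _ H) _; first by rewrite !mulr_ge0// ler0n.
by rewrite le_eqVlt; apply/orP; left; apply/eqP; ring.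
Qed.

(** Replacing the smaller of [X] and [Z] by the larger leaves a single power [s]. A zero base is
    treated apart because [0 ^ 0 = 1]. *)
Lemma powR_interpolate (X Z e s : R) : 0 <= X -> 0 <= Z -> 0 <= e -> e <= s ->
  X `^ e * Z `^ (s - e) <= X `^ s + Z `^ s.
Proof.
move=> X0 Z0 e0 es.
have mono (u v w : R) : 0 <= u -> u <= v -> 0 <= w -> u `^ w <= v `^ w.
  by move=> u0 uv w0; apply: ge0_ler_powR; rewrite ?nnegrE// (le_trans u0).
have split_exp (u : R) : u `^ e * u `^ (s - e) <= u `^ s.
  have [->|u0] := eqVneq u 0.
    have [s0|s0] := eqVneq s 0.
      have -> : e = 0 by lra.
      by rewrite s0 subr0 !powRr0 mulr1.
    have [-> |e1] := eqVneq e 0; first by rewrite subr0 powRr0 mul1r.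
    by rewrite (powR0 e1) mul0r powR_ge0.
  by rewrite -powRD ?u0 ?implybT// (_ : e + (s - e) = s)//; ring.
have [XZ|ZX] := leP X Z.
  apply: (@le_trans _ _ (Z `^ e * Z `^ (s - e))); first by rewrite ler_wpM2r ?powR_ge0// mono.
  by apply: le_trans (split_exp Z) _; rewrite lerDr powR_ge0.
apply: (@le_trans _ _ (X `^ e * X `^ (s - e))).
  by rewrite ler_wpM2l ?powR_ge0//; apply: mono => //; [exact: ltW|rewrite subr_ge0].
by apply: le_trans (split_exp X) _; rewrite lerDl powR_ge0.
Qed.

Lemma powRD_gt0 (t p q : R) : 0 < t -> t `^ (p + q) = t `^ p * t `^ q.
Proof. by move=> t0; rewrite powRD// (gt_eqF t0) implybT. Qed.

Lemma ler_powRN_of_mul (t p w M : R) : 0 < t -> t `^ p * w <= M -> w <= M * t `^ (- p).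
Proof.
by move=> t0; rewrite powRN ler_pdivlMr ?powR_gt0// mulrC.
Qed.

Section duhamel_bounds.
Variables (alpha : R).
Hypotheses (alpha_gt0 : 0 < alpha) (alpha_lt1 : alpha < 1).

(** With [c = max(alpha, sigma)], the hypothesis yields two bounds on [F]: spatial weight [c] with
    [tau^-q0], by interpolation since [0 <= c - alpha <= sigma], and spatial weight [alpha] with
    [tau^-q2]. The first is integrable at [tau = 0] and can produce the weight [|x|^sigma], as
    [sigma <= c]; the second has the milder singularity [(t - tau)^-p2] with [p2 < 1]. *)
Lemma duhamel_weighted (sigma : R) : 0 <= sigma -> sigma < d%:R ->
  exists2 C, 0 <= C & forall (F : R -> E -> 'M[R]_d) M, 0 <= M -> measurable_tensor F ->
  (forall tau y k l, 0 < tau -> enorm y `^ alpha * tau `^ ((1 - alpha) / 2) *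
     (enorm y `^ sigma + tau `^ (sigma / 2)) * `|F tau y k l| <= M) ->
  forall t x j, 0 < t ->
  [/\ forall tau k l, 0 < tau < t ->
       leb.-integrable setT (EFin \o (fun y => K (t - tau) j k l (x - y) * F tau y k l)),
     mu.-integrable `]0, t[ (EFin \o (fun tau => oseen K (t - tau) (F tau) x ord0 j)) &
     (enorm x `^ sigma + t `^ (sigma / 2)) * `|duhamel F t x ord0 j| <= C * M].
Proof.
move=> s0 sd; have a0 := alpha_gt0; have a1 := alpha_lt1.
have d1 : 1 <= d%:R :> R by rewrite ler1n.
pose c := Num.max alpha sigma.
have ca : alpha <= c by rewrite le_max lexx.
have cs : sigma <= c by rewrite le_max lexx orbT.
have c0 : 0 <= c by exact: le_trans (ltW alpha_gt0) ca.
have ad : alpha < d%:R by exact: lt_le_trans d1.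
have cd : c < d%:R by rewrite gt_max sd ad.
have cs1 : c - sigma < 1 by rewrite ltrBlDr gt_max; apply/andP; split; lra.
have ca_le : c - alpha <= sigma by rewrite lerBlDr ge_max; apply/andP; split; lra.
have [Ac Ac0 HAc] := oseen_decay c0 cd.
have [Aa Aa0 HAa] := oseen_decay (ltW alpha_gt0) ad.
have [Cv Cv0 HCv] := convol_oseen_le.
pose p0 := (1 + c - sigma) / 2; pose q0 := (1 + sigma - c) / 2.
pose p1 := (1 + c) / 2; pose p2 := (1 + alpha) / 2; pose q2 := (1 - alpha + sigma) / 2.
pose C0 := Ac * (2 `^ p0 / (1 - q0)) + Ac * (2 `^ q0 / (1 - p0)).
pose C1 := Ac * (2 `^ p1 / (1 - q0)) + Aa * (2 `^ q2 / (1 - p2)).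
have q01 : q0 < 1 by rewrite /q0; lra.
have p01 : p0 < 1 by rewrite /p0; lra.
have p21 : p2 < 1 by rewrite /p2; lra.
have q00 : 0 <= q0 by rewrite /q0; lra.
have p00 : 0 <= p0 by rewrite /p0; lra.
have p10 : 0 <= p1 by rewrite /p1; lra.
have q20 : 0 <= q2 by rewrite /q2; lra.
have C00 : 0 <= C0.
  by rewrite addr_ge0// mulr_ge0// divr_ge0 ?powR_ge0// subr_ge0 ltW.
have C10 : 0 <= C1.
  by rewrite addr_ge0// mulr_ge0// divr_ge0 ?powR_ge0// subr_ge0 ltW.
exists (C0 + C1) => [|F M M0 mF FM t x j t0]; first exact: addr_ge0.
have mFt tau k l : measurable_fun setT (fun y => F tau y k l).
  apply: (measurableT_comp (mF k l) (g := fun y => (tau, y))).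
  exact: pair1_measurable.
have wA tau y k l : 0 < tau ->
    enorm y `^ alpha * `|F tau y k l| <= M * tau `^ (- q2).
  move=> tau0; apply: ler_powRN_of_mul => //; apply: le_trans (FM tau y k l tau0).
  rewrite mulrA ler_wpM2r// [leLHS]mulrC -mulrA ler_wpM2l ?powR_ge0//.
  rewrite /q2 (_ : (1 - alpha + sigma) / 2 = (1 - alpha) / 2 + sigma / 2); last by field.
  rewrite powRD_gt0// ler_wpM2l ?powR_ge0//.
  by rewrite lerDr powR_ge0.
have wC tau y k l : 0 < tau ->
    enorm y `^ c * `|F tau y k l| <= M * tau `^ (- q0).
  move=> tau0; apply: ler_powRN_of_mul => //; apply: le_trans (FM tau y k l tau0).
  rewrite mulrA ler_wpM2r//.
  have -> : enorm y `^ c = enorm y `^ alpha * enorm y `^ (c - alpha).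
    rewrite -powRD; first by congr powR; ring.
    by rewrite subrKC (gt_eqF (lt_le_trans a0 ca)).
  have -> : tau `^ q0 = tau `^ ((1 - alpha) / 2) * Num.sqrt tau `^ (sigma - (c - alpha)).
    rewrite -powR12_sqrt ?ltW// -powRrM -powRD_gt0//.
    by congr powR; rewrite /q0; field.
  rewrite (_ : tau `^ (sigma / 2) = Num.sqrt tau `^ sigma); last first.
    by rewrite -powR12_sqrt ?ltW// -powRrM; congr powR; field.
  rewrite mulrACA [X in X * _ <= _]mulrC.
  rewrite ler_wpM2l ?mulr_ge0 ?powR_ge0//.
  rewrite mulrC; apply: powR_interpolate; rewrite ?enorm_ge0 ?sqrtr_ge0 ?subr_ge0//.
have ts tau : 0 < tau < t -> 0 < t - tau by move=> /andP[_]; rewrite subr_gt0.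
have OC tau a : 0 <= a -> a <= c -> 0 < tau < t ->
   enorm x `^ a * `|oseen K (t - tau) (F tau) x ord0 j| <=
   (Ac * M) * ((t - tau) `^ (- ((1 + c - a) / 2)) * tau `^ (- q0)).
  move=> a_ge0 ac /[dup] /ts tt /andP[tau0 _].
  have := HAc (t - tau) _ (F tau) tt (mulr_ge0 M0 (powR_ge0 _ _)) (mFt tau)
    (fun y k l => wC tau y k l tau0) x j a a_ge0 ac.
  by move/le_trans; apply; rewrite le_eqVlt; apply/orP; left; apply/eqP; ring.
have OA tau : 0 < tau < t -> `|oseen K (t - tau) (F tau) x ord0 j| <=
   (Aa * M) * ((t - tau) `^ (- p2) * tau `^ (- q2)).
  move=> /[dup] /ts tt /andP[tau0 _].
  have := HAa (t - tau) _ (F tau) tt (mulr_ge0 M0 (powR_ge0 _ _)) (mFt tau)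
    (fun y k l => wA tau y k l tau0) x j 0 (lexx 0) (ltW alpha_gt0).
  rewrite powRr0 mul1r subr0.
  by move/le_trans; apply; rewrite le_eqVlt; apply/orP; left; apply/eqP; ring.
pose h tau := oseen K (t - tau) (F tau) x ord0 j.
have mh : measurable_fun setT h by exact: measurable_oseen_time.
(* For the weight [t^(sigma / 2)]: weight [c] near [tau = 0], where [p1] may be 1 or more, and
   weight [alpha] near [tau = t], where [q2] may be. *)
have [] := @integral_time_split R h t (Ac * M) (Aa * M) p1 q0 p2 q2 t0
  (mulr_ge0 Ac0 M0) (mulr_ge0 Aa0 M0) p10 q01 p21 q20.
- exact: measurable_funTS.
- move=> tau tt; have := OC tau 0 (lexx 0) c0 tt.
  by rewrite powRr0 mul1r subr0.
- by move=> tau tt; exact: OA.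
move=> inth B0.
(* For the weight [|x|^sigma] the choice [c] works at both ends: [c - sigma] lies in [[0, 1[], so
   [p0] and [q0] are below 1, and [p0 + q0 = 1] leaves no power of [t]. *)
have [] := @integral_time_split R (fun tau => enorm x `^ sigma * h tau) t (Ac * M) (Ac * M)
  p0 q0 p0 q0 t0 (mulr_ge0 Ac0 M0) (mulr_ge0 Ac0 M0) p00 q01 p01 q00.
- by apply: measurable_funTS; exact: measurable_funM.
- move=> tau tt; rewrite normrM ger0_norm ?powR_ge0//; exact: OC.
- move=> tau tt; rewrite normrM ger0_norm ?powR_ge0//; exact: OC.
move=> _; rewrite RintegralZl// normrM ger0_norm ?powR_ge0// => B1.
split => //.
  move=> tau k l tt; have /andP[tau0 _] := tt.
  have [|//] := HCv j k l (t - tau) alpha (M * tau `^ (- q2)) (fun y => F tau y k l) x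
    (ts tau tt) (ltW alpha_gt0) ad (mulr_ge0 M0 (powR_ge0 _ _)) (mFt tau k l).
  by apply: aeW => y; exact: wA.
rewrite mxE mulrDl [leRHS]mulrDl lerD//.
  apply: le_trans B1 _.
  rewrite (_ : 1 - p0 - q0 = 0); last by rewrite /p0 /q0; field.
  by rewrite powRr0 !mulr1 /C0 le_eqVlt; apply/orP; left; apply/eqP; ring.
apply: le_trans (ler_wpM2l (powR_ge0 _ _) B0) _.
rewrite (_ : 1 - p1 - q0 = - (sigma / 2)); last by rewrite /p1 /q0; field.
rewrite (_ : 1 - p2 - q2 = - (sigma / 2)); last by rewrite /p2 /q2; field.
rewrite -mulrDl mulrCA powRN divff ?gt_eqF ?powR_gt0// mulr1.
by rewrite /C1 le_eqVlt; apply/orP; left; apply/eqP; ring.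
Qed.

(** The convolution bound with weight [2 alpha], of which [alpha] is kept, leaves the time exponents
    [(1 + alpha) / 2] and [1 - alpha], both below 1. Integrability is assumed: this estimate says
    nothing of the unweighted integrand at [x = 0], where [|x|^alpha] vanishes. *)
Lemma duhamel_critical : 2 * alpha < d%:R ->
  exists2 C, 0 <= C & forall (F : R -> E -> 'M[R]_d) M, 0 <= M -> measurable_tensor F ->
  (forall tau y k l, 0 < tau ->
     enorm y `^ (2 * alpha) * tau `^ (1 - alpha) * `|F tau y k l| <= M) ->
  forall t x j, 0 < t ->
    mu.-integrable `]0, t[ (EFin \o (fun tau => oseen K (t - tau) (F tau) x ord0 j)) ->
    enorm x `^ alpha * t `^ ((1 - alpha) / 2) * `|duhamel F t x ord0 j| <= C * M.
Proof.
move=> ad; have a0 := alpha_gt0; have a1 := alpha_lt1; have a20 : 0 <= 2 * alpha by rewrite mulr_ge0// ltW.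
have [A A0 HA] := oseen_decay a20 ad.
pose p := (1 + alpha) / 2; pose q := 1 - alpha.
have p0 : 0 <= p by rewrite /p; lra.
have p1 : p < 1 by rewrite /p; lra.
have q0 : 0 <= q by rewrite /q; lra.
have q1 : q < 1 by rewrite /q; lra.
pose C := A * (2 `^ p / (1 - q)) + A * (2 `^ q / (1 - p)).
exists C => [|F M M0 mF FM t x j t0 inth].
  by rewrite addr_ge0// mulr_ge0// divr_ge0 ?powR_ge0// subr_ge0 ltW.
have mFt tau k l : measurable_fun setT (fun y => F tau y k l).
  apply: (measurableT_comp (mF k l) (g := fun y => (tau, y))).
  exact: pair1_measurable.
have w tau y k l : 0 < tau ->
    enorm y `^ (2 * alpha) * `|F tau y k l| <= M * tau `^ (- q).
  move=> tau0; apply: ler_powRN_of_mul => //; apply: le_trans (FM tau y k l tau0).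
  by rewrite mulrA ler_wpM2r// mulrC.
have O tau : 0 < tau < t ->
   `|enorm x `^ alpha * oseen K (t - tau) (F tau) x ord0 j| <=
   (A * M) * ((t - tau) `^ (- p) * tau `^ (- q)).
  move=> /andP[tau0 taut]; rewrite normrM ger0_norm ?powR_ge0//.
  have tt : 0 < t - tau by rewrite subr_gt0.
  have aa : alpha <= 2 * alpha by lra.
  have := HA (t - tau) _ (F tau) tt (mulr_ge0 M0 (powR_ge0 _ _)) (mFt tau)
    (fun y k l => w tau y k l tau0) x j alpha (ltW alpha_gt0) aa.
  rewrite (_ : (1 + 2 * alpha - alpha) / 2 = p); last by rewrite /p; field.
  by move/le_trans; apply; rewrite le_eqVlt; apply/orP; left; apply/eqP; ring.
have [|||_] := @integral_time_split R
  (fun tau => enorm x `^ alpha * oseen K (t - tau) (F tau) x ord0 j) t (A * M) (A * M)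
  p q p q t0 (mulr_ge0 A0 M0) (mulr_ge0 A0 M0) p0 q1 p1 q0.
- by apply: measurable_funTS; apply: measurable_funM => //; exact: measurable_oseen_time.
- exact: O.
- exact: O.
rewrite RintegralZl// normrM ger0_norm ?powR_ge0// => B.
rewrite mxE mulrAC mulrC; apply: le_trans (ler_wpM2l (powR_ge0 _ _) B) _.
rewrite (_ : 1 - p - q = - ((1 - alpha) / 2)); last by rewrite /p /q; field.
rewrite -mulrDl mulrCA powRN divff ?gt_eqF ?powR_gt0// mulr1.
by rewrite /C le_eqVlt; apply/orP; left; apply/eqP; ring.
Unshelve. all: by [].
Qed.
End duhamel_bounds.

(** * The heat flow *)

Lemma heat_kernelE (t : R) x : 0 < t ->
  heat_kernel t x = pgauss (fun=> 0%N) (Num.sqrt t) x.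
Proof.
move=> t0; have r0 : 0 < Num.sqrt t by rewrite sqrtr_gt0.
have rt : Num.sqrt t ^+ 2 = t by rewrite sqr_sqrtr// ltW.
have a0 : 0 <= 4 * pi :> R by rewrite mulr_ge0// pi_ge0.
rewrite /heat_kernel /pgauss /sgauss/=.
under eq_bigr do rewrite expr1 mulrA.
rewrite big_split/= prodr_const card_ord.
rewrite -(big_morph _ (@expRD R) (@expR0 R)); congr (_ * expR _).
  have -> : - (d%:R / 2) = 2^-1 * (- d%:R) :> R by field.
  have at0 : 0 <= 4 * pi * t by rewrite mulr_ge0// ltW.
  rewrite powRrM powR12_sqrt// powR_invn ?sqrtr_ge0//.
  by rewrite sqrtrM// -invfM exprVn mulrC.
rewrite sqr_enorm sumrN /dotp mulr_suml; congr (- _); apply: eq_bigr => i _.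
rewrite -[in LHS]rt; set r := Num.sqrt t in r0 *; field; exact: lt0r_neq0.
Qed.

(** Having one derivative fewer, the heat kernel gains a factor [sqrt t] over the Oseen bound, so
    the same weighted convolution estimate applies to it. *)
Lemma heat_kernel_le : exists2 C, 0 <= C & forall t x, 0 < t ->
  `|heat_kernel t x| <= C * (Num.sqrt t * decay_kernel (Num.sqrt t) x).
Proof.
have [C C0 HC] := @pgauss_decay R d (fun=> 0%N) d.+1; exists C => // t x t0.
have r0 : 0 < Num.sqrt t by rewrite sqrtr_gt0.
rewrite heat_kernelE//; apply: le_trans (HC _ x r0) _.
rewrite big1// addn0 ler_wpM2l// /decay_kernel -(decayE d.+1 (norm1 x) r0) [_^-1 ^+ d.+1]exprS !mulrA.
by rewrite divff ?gt_eqF// mul1r.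
Qed.

Lemma measurable_heat_kernel :
  measurable_fun setT (fun p : R * E => heat_kernel p.1 p.2).
Proof.
apply: measurable_funM.
  by apply: measurable_powR_fun; apply: measurable_funM.
apply: (measurableT_comp (f := @expR R)) => //.
apply: measurableT_comp => //; apply: measurable_funM.
  apply: measurable_funX; apply: (measurableT_comp (@measurable_enorm R d)).
  exact: measurable_snd.
by apply: measurable_inv_fun; exact: measurable_funM.
Qed.

Lemma measurable_heat (u0 : E -> E) : measurable_fun setT u0 ->
  measurable_fun setT (fun p : R * E => heat p.1 u0 p.2).
Proof.
move=> mu0; apply: measurable_fun_rV => j.
apply: (eq_measurable_fun (fun p : R * E =>
    \int[leb]_y (heat_kernel p.1 (p.2 - y) * u0 y ord0 j))).
  by move=> p _; rewrite mxE.
apply: (@measurable_Rintegral_param _ _ _ _ R leb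
  (fun q : (R * E) * E => heat_kernel q.1.1 (q.1.2 - q.2) * u0 q.2 ord0 j)).
have m1 : measurable_fun setT (fun q : (R * E) * E => q.1.1).
  exact: (measurableT_comp measurable_fst measurable_fst).
have m2 : measurable_fun setT (fun q : (R * E) * E => q.1.2).
  exact: (measurableT_comp measurable_snd measurable_fst).
apply: measurable_funM.
  apply: (measurableT_comp measurable_heat_kernel
    (g := fun q : (R * E) * E => (q.1.1, q.1.2 - q.2))).
  apply/measurable_fun_pairP; split=> //.
  apply: (measurableT_comp measurable_subrV (g := fun q : (R * E) * E => (q.1.2, q.2))).
  by apply/measurable_fun_pairP; split=> //; exact: measurable_snd.
apply: (measurableT_comp (measurable_coord j)).
exact: (measurableT_comp mu0 measurable_snd).
Qed.

(** The convolution bound with [b = sigma] is used twice: keeping the whole weight gives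
    [|x|^sigma], keeping none gives [t^(sigma / 2)]. *)
Lemma heat_weighted (sigma : R) (u0 : E -> E) : 0 <= sigma -> sigma < d%:R ->
  weighted_Linfty sigma u0 ->
  exists2 M, 0 <= M & forall t x j, 0 < t ->
    (enorm x `^ sigma + t `^ (sigma / 2)) * `|heat t u0 x ord0 j| <= M.
Proof.
move=> s0 sd [mu0 /ess_supr_bounded [M0 HM0]].
pose M := Num.max M0 0.
have M_ge0 : 0 <= M by rewrite le_max lexx orbT.
have mu0j j : measurable_fun setT (fun y => u0 y ord0 j).
  exact: (measurableT_comp (measurable_coord j) mu0).
have HM j : {ae leb, forall y, enorm y `^ sigma * `|u0 y ord0 j| <= M}.
  apply: filterS HM0 => y Hy; rewrite le_max; apply/orP; left; apply: le_trans Hy.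
  by rewrite ler_wpM2l ?powR_ge0// coord_le_enorm.
have [C C0 HC] := heat_kernel_le.
pose B : R := ball_const (d := d) sigma.
have B0 : 0 <= B.
  rewrite addr_ge0 ?exprn_ge0 ?mulr_ge0 ?powR_ge0 ?divr_ge0 ?exprn_ge0 ?mulr_ge0//.
  by rewrite invr_ge0 subr_ge0 ler_pdivrMr ?ltr0n// mul1r ltW.
pose D := C * B * M * 2 `^ sigma.
have D0 : 0 <= D by rewrite !mulr_ge0 ?powR_ge0.
exists (D + D) => [|t x j t0]; first exact: addr_ge0.
have r0 : 0 < Num.sqrt t by rewrite sqrtr_gt0.
have msub : measurable_fun setT (fun y => x - y).
  apply: (measurableT_comp measurable_subrV (g := fun y => (x, y))).
  exact: pair1_measurable.
have mg : measurable_fun setT (fun y => decay_kernel (Num.sqrt t) (x - y) * `|u0 y ord0 j|).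
  apply: measurable_funM; last exact: measurable_norm_fun.
  exact: (measurableT_comp (measurable_decay_kernel _) msub).
have C10 : 0 <= C * Num.sqrt t by rewrite mulr_ge0// ltW.
have [||||_ H] := @Rintegral_dominated R _ E leb setT
  (fun y => heat_kernel t (x - y) * u0 y ord0 j)
  (fun y => (C * Num.sqrt t) * (decay_kernel (Num.sqrt t) (x - y) * `|u0 y ord0 j|))
  ((C * Num.sqrt t) * (B * M * ball_bound (Num.sqrt t) sigma x)) measurableT.
- apply: measurable_funM => //.
  apply: (measurableT_comp measurable_heat_kernel (g := fun y => (t, x - y))).
  by apply/measurable_fun_pairP; split; [exact: measurable_cst|exact: msub].
- exact: measurable_funM.
- by move=> y _; rewrite normrM mulrA ler_wpM2r// -mulrA HC.
- under eq_integral do rewrite EFinM.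
  rewrite ge0_integralZl//; last 2 first.
  + exact/measurable_EFinP.
  + by move=> y _; rewrite lee_fin mulr_ge0// decay_kernel_ge0.
  by rewrite [leRHS]EFinM lee_wpmul2l ?lee_fin//; exact: decay_kernel_ball_bound.
have {}H : `|heat t u0 x ord0 j| <=
   (C * Num.sqrt t) * (B * M * ball_bound (Num.sqrt t) sigma x) by rewrite mxE.
have bnd a : 0 <= a -> a <= sigma ->
    enorm x `^ a * `|heat t u0 x ord0 j| <= D * Num.sqrt t `^ (a - sigma).
  move=> a_ge0 asig; apply: le_trans (ler_wpM2l (powR_ge0 _ _) H) _.
  have H2 := ball_bound_le x r0 a_ge0 asig.
  rewrite [leLHS](_ : _ = ((C * Num.sqrt t) * B * M) *
    (enorm x `^ a * ball_bound (Num.sqrt t) sigma x)); last by ring.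
  apply: le_trans (ler_wpM2l _ H2) _; first by rewrite !mulr_ge0// ltW.
  have -> : Num.sqrt t `^ (a - sigma) = Num.sqrt t * Num.sqrt t `^ (- (1 + sigma - a)).
    rewrite -[X in _ = X * _](powRr1 (ltW r0)) -powRD_gt0//; congr powR; ring.
  by rewrite /D le_eqVlt; apply/orP; left; apply/eqP; ring.
rewrite mulrDl lerD//.
  by have := bnd sigma s0 (lexx _); rewrite subrr powRr0 mulr1.
have := bnd 0 (lexx _) s0; rewrite powRr0 mul1r sub0r.
have -> : t `^ (sigma / 2) = Num.sqrt t `^ sigma.
  by rewrite -powR12_sqrt ?(ltW t0)// -powRrM; congr powR; field.
by rewrite powRN ler_pdivlMr ?powR_gt0// mulrC.
Qed.
End duhamel.

(** * Sequences with geometrically decreasing increments *)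

Lemma cvg_geometric_half (R : realType) (D : R) : D / 2 ^+ n @[n --> \oo] --> (0 : R).
Proof.
rewrite -(mulr0 D); apply: cvgM; first exact: cvg_cst.
have := @cvg_expr R 2^-1; rewrite ger0_norm ?invr_ge0// invf_lt1// ltr1n.
move=> /(_ erefl); apply: cvg_trans; apply: near_eq_cvg; apply: nearW => n.
by rewrite exprVn.
Qed.

(** The sequences [a n - 2 D / 2^n] and [a n + 2 D / 2^n] are monotone in opposite directions and
    enclose the limit, which gives convergence and its rate together. *)
Lemma geometric_cauchy (R : realType) (a : nat -> R) (D : R) :
  (forall n, `|a n.+1 - a n| <= D / 2 ^+ n) ->
  cvgn a /\ forall n, `|limn a - a n| <= 2 * D / 2 ^+ n.
Proof.
move=> aD.
have E n : 2 * D / 2 ^+ n.+1 = D / 2 ^+ n :> R.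
  by rewrite exprS; field; rewrite expf_neq0.
have S n : D / 2 ^+ n + D / 2 ^+ n = 2 * D / 2 ^+ n :> R by field; rewrite expf_neq0.
have D0 : 0 <= D by have := le_trans (normr_ge0 _) (aD 0%N); rewrite expr0 divr1.
have g0 n : 0 <= 2 * D / 2 ^+ n :> R by rewrite divr_ge0 ?exprn_ge0// mulr_ge0.
pose c n := a n - 2 * D / 2 ^+ n; pose e n := a n + 2 * D / 2 ^+ n.
have ndc : nondecreasing_seq c.
  apply/nondecreasing_seqP => n; rewrite /c E.
  have := aD n; rewrite ler_norml => /andP[+ _]; have := S n; lra.
have nie : nonincreasing_seq e.
  apply/nonincreasing_seqP => n; rewrite /e E.
  have := aD n; rewrite ler_norml => /andP[_]; have := S n; lra.
have geo : 2 * D / 2 ^+ n @[n --> \oo] --> (0 : R).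
  exact: cvg_geometric_half.
have cc : cvgn c.
  apply: nondecreasing_is_cvgn => //; exists (e 0%N) => _ [n _ <-].
  apply: (@le_trans _ _ (e n)); last exact: nie.
  by rewrite /c /e; have := g0 n; lra.
have cl : c n @[n --> \oo] --> limn c by [].
have ca : a n @[n --> \oo] --> limn c.
  have aE n : a n = c n + 2 * D / 2 ^+ n by rewrite /c subrK.
  by rewrite -[limn c]addr0 (eq_cvg _ _ aE); exact: cvgD.
have ce : e n @[n --> \oo] --> limn c.
  by rewrite -[limn c]addr0; exact: cvgD ca geo.
split; first by apply/cvg_ex; eexists; exact: ca.
move=> n; rewrite (cvg_lim _ ca)// ler_norml; apply/andP; split.
  have := nondecreasing_cvgn_le ndc cc n; rewrite /c; lra.
have := nonincreasing_cvgn_ge nie (cvgP _ ce) n; rewrite (cvg_lim _ ce)// /e; lra.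
Qed.

Lemma limn_weight_le (R : realType) (a : nat -> R) (w M : R) : cvgn a ->
  (forall n, w * `|a n| <= M) -> w * `|limn a| <= M.
Proof.
move=> ca aM.
have H : w * `|a n| @[n --> \oo] --> w * `|limn a|.
  by apply: cvgM; [exact: cvg_cst|exact: cvg_norm].
rewrite -(cvg_lim _ H)//; apply: limr_le; first by apply/cvg_ex; eexists; exact: H.
exact: nearW.
Qed.

Lemma sub_mxE (R : realType) m n (A B : 'M[R]_(m, n)) i j :
  (A - B) i j = A i j - B i j.
Proof. by rewrite !mxE. Qed.

(** * Picard iteration *)

Section picard.
Context {R : realType} {d : nat}.
Local Notation E := 'rV[R]_d.
Local Notation mu := (@lebesgue_measure R).
Local Notation leb := (@lebesgue_rV R d).
Local Notation K := (@oseen_kernel R d).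
Implicit Types (x y : E) (u v : R -> E -> E).

Definition nonlinearity u : R -> E -> 'M[R]_d := fun tau => tensor (u tau) (u tau).

Lemma nonlinearityE u tau y k l :
  nonlinearity u tau y k l = u tau y ord0 k * u tau y ord0 l.
Proof. by rewrite !mxE big_ord1 !mxE. Qed.

Definition measurable_flow u := measurable_fun setT (fun p : R * E => u p.1 p.2).

Lemma measurable_nonlinearity u : measurable_flow u -> measurable_tensor (nonlinearity u).
Proof.
move=> mflow k l.
apply: (eq_measurable_fun (fun p : R * E => u p.1 p.2 ord0 k * u p.1 p.2 ord0 l)).
  by move=> p _; rewrite nonlinearityE.
by apply: measurable_funM; exact: (measurableT_comp (measurable_coord _) mflow).
Qed.

(* Integrability of both integrals of [duhamel F t x]. *)
Definition duhamel_integrable (F : R -> E -> 'M[R]_d) t x :=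
  (forall j tau k l, 0 < tau < t ->
     leb.-integrable setT (EFin \o (fun y => K (t - tau) j k l (x - y) * F tau y k l))) /\
  (forall j, mu.-integrable `]0, t[
     (EFin \o (fun tau => oseen K (t - tau) (F tau) x ord0 j))).

Lemma duhamelB (F G : R -> E -> 'M[R]_d) t x j :
  duhamel_integrable F t x -> duhamel_integrable G t x ->
  duhamel (fun tau y => F tau y - G tau y) t x ord0 j =
  duhamel F t x ord0 j - duhamel G t x ord0 j.
Proof.
move=> [F1 F2] [G1 G2]; rewrite [LHS]mxE [X in _ = X - _]mxE [X in _ = _ - X]mxE.
rewrite -RintegralB; [|exact: measurable_itv|exact: F2|exact: G2].
apply: eq_Rintegral => tau; rewrite inE/= in_itv/= => taut.
rewrite !mxE -sumrB; apply: eq_bigr => k _; rewrite -sumrB; apply: eq_bigr => l _.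
rewrite /convol -RintegralB//; last 2 first.
- exact: F1.
- exact: G1.
by apply: eq_Rintegral => y _; rewrite sub_mxE mulrBr.
Qed.

Variable alpha : R.

Definition critical_bound (eps : R) u := forall t x j, 0 < t ->
  enorm x `^ alpha * t `^ ((1 - alpha) / 2) * `|u t x ord0 j| <= eps.

Definition weighted_bound (sigma M : R) u := forall t x j, 0 < t ->
  (enorm x `^ sigma + t `^ (sigma / 2)) * `|u t x ord0 j| <= M.

Lemma critical_weighted_mul sigma eps M u v tau y k l : 0 < tau ->
  critical_bound eps u -> weighted_bound sigma M v ->
  enorm y `^ alpha * tau `^ ((1 - alpha) / 2) * (enorm y `^ sigma + tau `^ (sigma / 2)) *
    `|u tau y ord0 k * v tau y ord0 l| <= eps * M.
Proof.
move=> tau0 Hu Hv; rewrite normrM mulrACA.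
by apply: ler_pM; rewrite ?Hu ?Hv// !mulr_ge0 ?addr_ge0 ?powR_ge0.
Qed.

Lemma critical_mul eps u tau y k l : 0 < alpha -> 0 < tau ->
  critical_bound eps u ->
  enorm y `^ (2 * alpha) * tau `^ (1 - alpha) *
    `|u tau y ord0 k * u tau y ord0 l| <= eps * eps.
Proof.
move=> a0 tau0 Hu; rewrite normrM.
have -> : enorm y `^ (2 * alpha) = enorm y `^ alpha * enorm y `^ alpha.
  rewrite -powRD; first by congr powR; ring.
  by rewrite (gt_eqF (addr_gt0 a0 a0)).
have -> : tau `^ (1 - alpha) = tau `^ ((1 - alpha) / 2) * tau `^ ((1 - alpha) / 2).
  by rewrite -powRD_gt0//; congr powR; field.
rewrite [leLHS](_ : _ =
  (enorm y `^ alpha * tau `^ ((1 - alpha) / 2) * `|u tau y ord0 k|) *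
  (enorm y `^ alpha * tau `^ ((1 - alpha) / 2) * `|u tau y ord0 l|)); last by ring.
by apply: ler_pM; rewrite ?Hu// !mulr_ge0 ?powR_ge0.
Qed.

Hypotheses (d_gt0 : (0 < d)%N) (alpha_gt0 : 0 < alpha) (alpha_lt1 : alpha < 1).

Lemma nonlinearity_weighted sigma : 0 <= sigma -> sigma < d%:R ->
  exists2 C, 0 <= C & forall eps M u, 0 <= eps -> 0 <= M -> measurable_flow u ->
  critical_bound eps u -> weighted_bound sigma M u ->
  (forall t x, 0 < t -> duhamel_integrable (nonlinearity u) t x) /\
  weighted_bound sigma (C * (eps * M)) (duhamel (nonlinearity u)).
Proof.
move=> s0 sd; have [C C0 HC] := duhamel_weighted d_gt0 alpha_gt0 alpha_lt1 s0 sd.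
exists C => // eps M u eps0 M0 mflow Xu Wu.
have P tau y k l : 0 < tau -> enorm y `^ alpha * tau `^ ((1 - alpha) / 2) *
     (enorm y `^ sigma + tau `^ (sigma / 2)) * `|nonlinearity u tau y k l| <= eps * M.
  by move=> tau0; rewrite nonlinearityE; exact: critical_weighted_mul.
have H := HC _ _ (mulr_ge0 eps0 M0) (measurable_nonlinearity mflow) P.
split=> [t x t0|t x j t0]; last by have [] := H t x j t0.
by split=> [j tau k l|j]; have [A B _] := H t x j t0; [exact: A|exact: B].
Qed.

Lemma nonlinearity_lipschitz sigma : 0 <= sigma -> sigma < d%:R ->
  exists2 C, 0 <= C & forall eps M m u v, 0 <= eps -> 0 <= M -> 0 <= m ->
  measurable_flow u -> measurable_flow v ->
  critical_bound eps u -> critical_bound eps v ->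
  weighted_bound sigma M u -> weighted_bound sigma M v ->
  weighted_bound sigma m (fun t x => u t x - v t x) ->
  weighted_bound sigma (C * (2 * eps * m))
    (fun t x => duhamel (nonlinearity u) t x - duhamel (nonlinearity v) t x).
Proof.
move=> s0 sd; have [C1 C10 HC1] := nonlinearity_weighted s0 sd.
have [C C0 HC] := duhamel_weighted d_gt0 alpha_gt0 alpha_lt1 s0 sd.
exists C => // eps M m u v eps0 M0 m0 mflow mv Xu Xv Wu Wv Wuv t x j t0.
have [Iu _] := HC1 _ _ _ eps0 M0 mflow Xu Wu; have [Iv _] := HC1 _ _ _ eps0 M0 mv Xv Wv.
rewrite [X in `|X|](_ : _ = duhamel (fun tau y => nonlinearity u tau y - nonlinearity v tau y)
  t x ord0 j); last by rewrite duhamelB; [rewrite sub_mxE|exact: Iu|exact: Iv].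
have mG : measurable_tensor (fun tau y => nonlinearity u tau y - nonlinearity v tau y).
  move=> k l.
  apply: (eq_measurable_fun (fun p : R * E => nonlinearity u p.1 p.2 k l - nonlinearity v p.1 p.2 k l)).
    by move=> p _; rewrite sub_mxE.
  by apply: measurable_funB; exact: measurable_nonlinearity.
have P tau y k l : 0 < tau -> enorm y `^ alpha * tau `^ ((1 - alpha) / 2) *
     (enorm y `^ sigma + tau `^ (sigma / 2)) *
     `|(nonlinearity u tau y - nonlinearity v tau y) k l| <= 2 * eps * m.
  move=> tau0.
  (* In each term the difference is measured in [W_sigma], and the other factor, [u] or [v], is
     small in [X]: hence [2 * eps * m]. *)
  have -> : (nonlinearity u tau y - nonlinearity v tau y) k l =
      u tau y ord0 l * (u tau y - v tau y) ord0 k + v tau y ord0 k * (u tau y - v tau y) ord0 l.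
    rewrite !sub_mxE !nonlinearityE.
    ring.
  apply: le_trans (ler_wpM2l _ (ler_normD _ _)) _.
    by rewrite !mulr_ge0 ?addr_ge0 ?powR_ge0.
  rewrite mulrDr (_ : 2 * eps * m = eps * m + eps * m); last by ring.
  by apply: lerD; exact: (critical_weighted_mul (v := fun t x => u t x - v t x)).
have [_ _] := HC _ _ (mulr_ge0 (mulr_ge0 (ler0n _ 2) eps0) m0) mG P t x j t0.
by [].
Qed.

(** The indicator makes the iterates vanish for [t <= 0], so that they and their limit are
    measurable on all of [R * E]. *)
Definition picard_step (u0 : E -> E) u : R -> E -> E := fun t x =>
  (0 < t)%R%:R *: (heat t u0 x - duhamel (nonlinearity u) t x).

Fixpoint picard (u0 : E -> E) n : R -> E -> E :=
  if n is n'.+1 then picard_step u0 (picard u0 n') else fun _ _ => 0.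

Lemma picard_stepE (u0 : E -> E) u t x j : 0 < t ->
  picard_step u0 u t x ord0 j = heat t u0 x ord0 j - duhamel (nonlinearity u) t x ord0 j.
Proof. by move=> t0; rewrite /picard_step t0 scale1r sub_mxE. Qed.

Lemma picardSE (u0 : E -> E) n t x j : 0 < t -> picard u0 n.+1 t x ord0 j =
  heat t u0 x ord0 j - duhamel (nonlinearity (picard u0 n)) t x ord0 j.
Proof. exact: picard_stepE. Qed.

Lemma measurable_picard_step (u0 : E -> E) u : measurable_fun setT u0 ->
  measurable_flow u -> measurable_flow (picard_step u0 u).
Proof.
move=> mu0 mflow; apply: measurable_fun_rV => j.
apply: (eq_measurable_fun (fun p : R * E => (0 < p.1)%R%:R *
    (heat p.1 u0 p.2 ord0 j - duhamel (nonlinearity u) p.1 p.2 ord0 j))).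
  by move=> p _; rewrite /picard_step [RHS]mxE sub_mxE.
apply: measurable_funM; first by apply: measurable_bool_fun; exact: measurable_fun_ltr.
apply: measurable_funB.
  exact: (measurableT_comp (measurable_coord j) (measurable_heat mu0)).
apply: (measurableT_comp (measurable_coord j)).
by apply: measurable_duhamel; exact: measurable_nonlinearity.
Qed.

Lemma measurable_picard (u0 : E -> E) n : measurable_fun setT u0 -> measurable_flow (picard u0 n).
Proof.
by move=> mu0; elim: n => [|n IH]; [exact: measurable_cst|exact: measurable_picard_step].
Qed.

Definition picard_lim (u0 : E -> E) : R -> E -> E :=
  fun t x => \row_j limn (fun n => picard u0 n t x ord0 j).

Lemma weighted_bound0 sigma M : 0 <= M -> weighted_bound sigma M (fun _ _ => 0).
Proof. by move=> M0 t x j _; rewrite mxE normr0 mulr0. Qed.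

Lemma weight_gt0 (sigma t : R) x : 0 < t -> 0 < enorm x `^ sigma + t `^ (sigma / 2).
Proof. by move=> t0; rewrite ltr_wpDl ?powR_gt0// powR_ge0. Qed.

Lemma subr_common (a b h p q : R) : a = h - p -> b = h - q -> a - b = q - p.
Proof. by move=> -> ->; ring. Qed.

(** * Bounds on the iterates and passage to the limit *)

Section iteration.
Variables (gamma beta Cc Cg Cb Lb delta Mg Mb : R) (u0 : E -> E).
Hypotheses (Cg_ge0 : 0 <= Cg) (Cb_ge0 : 0 <= Cb) (Lb_ge0 : 0 <= Lb).
Hypotheses (delta_ge0 : 0 <= delta) (Mg_ge0 : 0 <= Mg) (Mb_ge0 : 0 <= Mb).
(** The iterates live in the ball of radius [2 * delta] of [X]. The factor 8 makes the Lipschitz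
    constant [4 * Lb * delta] at most [1 / 2], and bounds each Duhamel term by half of the
    corresponding bound on the heat flow. The sizes [Mg] and [Mb] do not enter. *)
Hypothesis small : forall C, C \in [:: Cc; Cg; Cb; Lb] -> 8 * C * delta <= 1.
Hypothesis mu0 : measurable_fun setT u0.
Hypothesis heat_critical : critical_bound delta (fun t => heat t u0).
Hypothesis heat_gamma : weighted_bound gamma Mg (fun t => heat t u0).
Hypothesis heat_beta : weighted_bound beta Mb (fun t => heat t u0).

Hypothesis critical : forall eps u, 0 <= eps -> measurable_flow u ->
  critical_bound eps u ->
  (forall t x, 0 < t -> duhamel_integrable (nonlinearity u) t x) ->
  critical_bound (Cc * (eps * eps)) (duhamel (nonlinearity u)).

Definition weighted_estimate sigma C := forall eps M u, 0 <= eps -> 0 <= M ->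
  measurable_flow u -> critical_bound eps u -> weighted_bound sigma M u ->
  (forall t x, 0 < t -> duhamel_integrable (nonlinearity u) t x) /\
  weighted_bound sigma (C * (eps * M)) (duhamel (nonlinearity u)).

Hypothesis weighted_gamma : weighted_estimate gamma Cg.
Hypothesis weighted_beta : weighted_estimate beta Cb.

Hypothesis lipschitz_beta : forall eps M m u v, 0 <= eps -> 0 <= M -> 0 <= m ->
  measurable_flow u -> measurable_flow v ->
  critical_bound eps u -> critical_bound eps v ->
  weighted_bound beta M u -> weighted_bound beta M v ->
  weighted_bound beta m (fun t x => u t x - v t x) ->
  weighted_bound beta (Lb * (2 * eps * m))
    (fun t x => duhamel (nonlinearity u) t x - duhamel (nonlinearity v) t x).

Let eps := 2 * delta.
Let eps_ge0 : 0 <= eps. Proof. exact: mulr_ge0. Qed.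
Let Mg2_ge0 : 0 <= 2 * Mg. Proof. exact: mulr_ge0. Qed.
Let Mb2_ge0 : 0 <= 2 * Mb. Proof. exact: mulr_ge0. Qed.

Let weighted_step sigma C M u : 0 <= C -> 0 <= M -> C \in [:: Cc; Cg; Cb; Lb] ->
  weighted_estimate sigma C -> weighted_bound sigma M (fun t => heat t u0) ->
  measurable_flow u -> critical_bound eps u -> weighted_bound sigma (2 * M) u ->
  weighted_bound sigma (2 * M) (picard_step u0 u).
Proof.
move=> C0 M0 Cin HC HM mflow Xu Wu t x j t0; rewrite picard_stepE//.
have [_ D] := HC _ _ _ eps_ge0 (mulr_ge0 (ler0n _ 2) M0) mflow Xu Wu.
apply: le_trans (ler_wpM2l (ltW (weight_gt0 sigma x t0)) (ler_normB _ _)) _.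
rewrite mulrDr; apply: le_trans (lerD (HM t x j t0) (D t x j t0)) _.
have := ler_wpM2r M0 (small Cin); rewrite /eps mul1r => H.
rewrite (_ : C * (2 * delta * (2 * M)) = 8 * C * delta * M / 2); last by field.
lra.
Qed.

Lemma picard_bounds n : [/\ critical_bound eps (picard u0 n),
  weighted_bound gamma (2 * Mg) (picard u0 n) &
  weighted_bound beta (2 * Mb) (picard u0 n)].
Proof.
elim: n => [|n [IHc IHg IHb]].
  split; [|exact: weighted_bound0|exact: weighted_bound0].
  by move=> t x j _; rewrite mxE normr0 mulr0.
have mn := measurable_picard n mu0.
split.
- move=> t x j t0; rewrite (picardSE u0 n x j t0).
  (* The critical estimate takes integrability as an assumption; it is supplied by the bound in
     [W_gamma]. *)
  have [In _] := weighted_gamma eps_ge0 Mg2_ge0 mn IHc IHg.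
  have w0 : 0 <= enorm x `^ alpha * t `^ ((1 - alpha) / 2) by rewrite mulr_ge0 ?powR_ge0.
  apply: le_trans (ler_wpM2l w0 (ler_normB _ _)) _.
  rewrite mulrDr; apply: le_trans (lerD (heat_critical x j t0) (critical eps_ge0 mn IHc In x j t0)) _.
  have Cin : Cc \in [:: Cc; Cg; Cb; Lb] by rewrite inE eqxx.
  have := ler_wpM2r delta_ge0 (small Cin); rewrite mul1r => H.
  rewrite /eps (_ : Cc * (2 * delta * (2 * delta)) = 8 * Cc * delta * delta / 2); last by field.
  have d0 := delta_ge0; lra.
- by apply: (weighted_step Cg_ge0) => //; rewrite !inE eqxx ?orbT.
- by apply: (weighted_step Cb_ge0) => //; rewrite !inE eqxx ?orbT.
Qed.

Lemma picard_diff n : weighted_bound beta (2 * Mb / 2 ^+ n)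
  (fun t x => picard u0 n.+1 t x - picard u0 n t x).
Proof.
elim: n => [|n IH] t x j t0.
  (* The iteration starts from 0, so the first difference is the first iterate. *)
  have [_ _ H] := picard_bounds 1; rewrite subr0 expr0 divr1; exact: H.
rewrite sub_mxE (subr_common (picardSE u0 n.+1 x j t0) (picardSE u0 n x j t0)).
rewrite distrC -sub_mxE.
have [Xn _ Wn] := picard_bounds n; have [Xn1 _ Wn1] := picard_bounds n.+1.
have m0 : 0 <= 2 * Mb / 2 ^+ n by rewrite divr_ge0// exprn_ge0.
apply: le_trans (lipschitz_beta eps_ge0 Mb2_ge0 m0
  (measurable_picard n.+1 mu0) (measurable_picard n mu0) Xn1 Xn Wn1 Wn IH x j t0) _.
have Lin : Lb \in [:: Cc; Cg; Cb; Lb] by rewrite !inE eqxx !orbT.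
have := ler_wpM2r m0 (small Lin); rewrite mul1r => H.
have -> : 2 * Mb / 2 ^+ n.+1 = 2 * Mb / 2 ^+ n / 2 by rewrite exprS; field; rewrite expf_neq0.
set z := 2 * Mb / 2 ^+ n in H *.
rewrite /eps (_ : Lb * (2 * (2 * delta) * z) = 8 * Lb * delta * z / 2); last by field.
lra.
Qed.

(** For [t > 0] the weight of [W_beta] is positive even at [x = 0], so geometric decay in that norm
    gives pointwise convergence. *)
Lemma picard_cvg t x j : 0 < t ->
  cvgn (fun n => picard u0 n t x ord0 j) /\
  forall n, (enorm x `^ beta + t `^ (beta / 2)) *
    `|picard_lim u0 t x ord0 j - picard u0 n t x ord0 j| <= 4 * Mb / 2 ^+ n.
Proof.
move=> t0; have w0 := weight_gt0 beta x t0; set w := _ + _ in w0 *.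
have H n : `|picard u0 n.+1 t x ord0 j - picard u0 n t x ord0 j| <= (2 * Mb / w) / 2 ^+ n.
  have := picard_diff n x j t0; rewrite sub_mxE -/w mulrC -ler_pdivlMr//.
  by move/le_trans; apply; rewrite mulrAC.
have [cn Hn] := geometric_cauchy H; split=> // n.
rewrite mxE; apply: le_trans (ler_wpM2l (ltW w0) (Hn n)) _.
rewrite le_eqVlt; apply/orP; left; apply/eqP; field.
by rewrite expf_neq0//= gt_eqF.
Qed.

Lemma picard_lim_bounds : [/\ critical_bound eps (picard_lim u0),
  weighted_bound gamma (2 * Mg) (picard_lim u0) &
  weighted_bound beta (2 * Mb) (picard_lim u0)].
Proof.
by split=> t x j t0; rewrite mxE; have [cn _] := picard_cvg x j t0;
  apply: limn_weight_le => // n; have [A B C] := picard_bounds n; [exact: A|exact: B|exact: C].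
Qed.

Lemma measurable_picard_lim : measurable_flow (picard_lim u0).
Proof.
apply: measurable_fun_rV => j.
apply: (@measurable_fun_cvg _ _ R setT (fun n (p : R * E) => picard u0 n p.1 p.2 ord0 j)).
  by move=> n; exact: (measurableT_comp (measurable_coord j) (measurable_picard n mu0)).
move=> p _; rewrite mxE.
have [t0|t0] := ltP 0 p.1; first by have [] := picard_cvg p.2 j t0.
have E0 n : picard u0 n p.1 p.2 ord0 j = 0.
  case: n => [|n]; first by rewrite mxE.
  by rewrite /= /picard_step ltNge t0 scale0r mxE.
rewrite (_ : limn _ = 0).
  by apply: cvg_near_cst; apply: nearW => n; exact: E0.
by apply: cvg_lim => //; apply: cvg_near_cst; apply: nearW => n; exact: E0.
Qed.

(** The limit obeys the same bounds as the iterates, so the Lipschitz estimate applies to it and the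
    [n]-th iterate. The Duhamel terms thus converge pointwise, and both sides are limits of the
    iterates. *)
Lemma picard_lim_fixed t x j : 0 < t -> picard_lim u0 t x ord0 j =
  heat t u0 x ord0 j - duhamel (nonlinearity (picard_lim u0)) t x ord0 j.
Proof.
move=> t0; have [cn _] := picard_cvg x j t0.
have [Xl _ Wl] := picard_lim_bounds.
have w0 := weight_gt0 beta x t0; set w := _ + _ in w0.
set L := heat _ _ _ _ _ - _.
pose D := Lb * (2 * eps * (4 * Mb)) / w.
have D0 : 0 <= D by rewrite divr_ge0 ?(ltW w0)// !mulr_ge0.
have H n : `|picard u0 n.+1 t x ord0 j - L| <= D / 2 ^+ n.
  have [Xn _ Wn] := picard_bounds n.
  have m0 : 0 <= 4 * Mb / 2 ^+ n by rewrite divr_ge0 ?exprn_ge0// mulr_ge0.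
  have Wd : weighted_bound beta (4 * Mb / 2 ^+ n)
      (fun t x => picard_lim u0 t x - picard u0 n t x).
    by move=> t' x' j' t'0; rewrite sub_mxE; have [_] := picard_cvg x' j' t'0; exact.
  have := lipschitz_beta eps_ge0 Mb2_ge0 m0 measurable_picard_lim
    (measurable_picard n mu0) Xl Xn Wl Wn Wd x j t0.
  rewrite sub_mxE -/w mulrC -ler_pdivlMr// => B.
  rewrite (subr_common (picardSE u0 n x j t0) (erefl L)).
  apply: le_trans B _; rewrite /D le_eqVlt; apply/orP; left; apply/eqP; field.
  by rewrite expf_neq0//= gt_eqF.
have c1 : picard u0 n.+1 t x ord0 j @[n --> \oo] --> L.
  apply/subr_cvg0; apply: norm_cvg0.
  have geo : D / 2 ^+ n @[n --> \oo] --> (0 : R) by exact: cvg_geometric_half.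
  apply: (squeeze_cvgr _ (cvg_cst 0) geo); apply: nearW => n.
  by rewrite normr_ge0 H.
have c2 : picard u0 n t x ord0 j @[n --> \oo] --> L by rewrite -(cvg_shiftS (fun n => picard u0 n t x ord0 j)).
by rewrite mxE; exact: cvg_lim c2.
Qed.

End iteration.
End picard.

(** * Choice of [delta] and the global solution *)

Lemma enorm_le_sum (R : realType) d (x : 'rV[R]_d) (w M : R) : 0 <= w ->
  (forall j, w * `|x ord0 j| <= M) -> w * enorm x <= d%:R * M.
Proof.
move=> w0 H; apply: le_trans (ler_wpM2l w0 (enorm_le_norm1 x)) _.
rewrite /norm1 mulr_sumr mulr_natl -[X in _ *+ X](card_ord d) -sumr_const.
by apply: ler_sum => j _.
Qed.

Theorem theorem2 (R : realType) (d : nat) (gamma beta : R) :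
  (2 <= d)%N -> 0 <= gamma -> gamma <= 1 -> 1 <= beta -> beta < d%:R ->
  forall gamma' alpha beta' : R,
  0 <= gamma' -> gamma' <= gamma ->
  0 <= beta' -> beta - 2 < beta' -> beta' <= beta ->
  0 < alpha -> alpha < 1 ->
  beta - beta' - 1 < alpha -> alpha < d%:R - beta' ->
  exists2 delta : R, 0 < delta &
  forall u0 : 'rV[R]_d -> 'rV[R]_d,
  weighted_Linfty gamma u0 -> weighted_Linfty beta u0 ->
  divergence_free u0 ->
  (sup_spacetime (fun t x =>
     ((enorm x `^ gamma' * t `^ ((gamma - gamma') / 2)
      + enorm x `^ alpha * t `^ ((1 - alpha) / 2)
      + enorm x `^ beta' * t `^ ((beta - beta') / 2))
     * enorm (heat t u0 x))%R) <= delta%:E)%E ->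
  exists2 u : R -> 'rV[R]_d -> 'rV[R]_d,
    mild_solution +oo%E u0 u &
    (sup_spacetime (fun t x =>
       ((enorm x `^ gamma + t `^ (gamma / 2) + enorm x `^ beta + t `^ (beta / 2))
       * enorm (u t x))%R) < +oo)%E.
Proof.
move=> d2 g0 g1 b1 bd gamma' alpha beta' _ _ _ _ _ a0 a1 _ _.
have d0 : (0 < d)%N by exact: leq_trans d2.
have b0 : 0 <= beta by exact: le_trans b1.
have dR2 : 2 <= d%:R :> R by rewrite ler_nat.
have gd : gamma < d%:R by lra.
have ad : 2 * alpha < d%:R by lra.
have [Cc Cc0 HCc] := duhamel_critical d0 a0 a1 ad.
have [Cg Cg0 HCg] := nonlinearity_weighted d0 a0 a1 g0 gd.
have [Cb Cb0 HCb] := nonlinearity_weighted d0 a0 a1 b0 bd.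
have [Lb Lb0 HLb] := nonlinearity_lipschitz d0 a0 a1 b0 bd.
(* The sum dominates all four constants, and the 1 keeps it positive so that it can be inverted. *)
pose C := 1 + Cc + Cg + Cb + Lb.
have C0 : 0 < C by rewrite /C; lra.
pose delta := (8 * C)^-1.
have delta0 : 0 < delta by rewrite invr_gt0 mulr_gt0.
exists delta => // u0 Wg Wb _ Hsup.
have mu0 : measurable_fun setT u0 by have [] := Wg.
have [Mg Mg0 HMg] := heat_weighted d0 g0 gd Wg.
have [Mb Mb0 HMb] := heat_weighted d0 b0 bd Wb.
have small C' : C' \in [:: Cc; Cg; Cb; Lb] -> 8 * C' * delta <= 1.
  rewrite !inE => H; have C'C : C' <= C.
    by move: H; rewrite /C => /or4P[] /eqP ->; lra.
  rewrite /delta ler_pdivrMr ?mulr_gt0// mul1r; lra.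
(* The middle term of the assumed weight is that of [X]; the other two are nonnegative, so the full
   sum dominates it. *)
have heat_crit : critical_bound alpha delta (fun t => heat t u0).
  move=> t x j t0.
  apply: (@le_trans _ _ ((enorm x `^ gamma' * t `^ ((gamma - gamma') / 2)
      + enorm x `^ alpha * t `^ ((1 - alpha) / 2)
      + enorm x `^ beta' * t `^ ((beta - beta') / 2)) * enorm (heat t u0 x))).
    apply: ler_pM => //; first by rewrite mulr_ge0 ?powR_ge0.
      by rewrite addrAC lerDr addr_ge0// mulr_ge0 ?powR_ge0.
    exact: coord_le_enorm.
  rewrite -lee_fin; apply: le_trans Hsup; apply: ereal_sup_ubound.
  by exists t => //; exists x.
have crit eps (u : R -> 'rV[R]_d -> 'rV[R]_d) : 0 <= eps -> measurable_flow u -> critical_bound alpha eps u ->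
    (forall t x, 0 < t -> duhamel_integrable (nonlinearity u) t x) ->
    critical_bound alpha (Cc * (eps * eps)) (duhamel (nonlinearity u)).
  move=> eps0 mflow Xu Iu t x j t0; have [_ I2] := Iu t x t0.
  have P tau y k l : 0 < tau -> enorm y `^ (2 * alpha) * tau `^ (1 - alpha) *
      `|nonlinearity u tau y k l| <= eps * eps.
    by move=> tau0; rewrite nonlinearityE; exact: critical_mul.
  exact: (HCc (nonlinearity u) (eps * eps) (mulr_ge0 eps0 eps0)
    (measurable_nonlinearity mflow) P t x j t0 (I2 j)).
have delta_ge0 := ltW delta0.
have [Xl Wgl Wbl] := picard_lim_bounds Cg0 Cb0 delta_ge0 Mg0 Mb0 small mu0
  heat_crit HMg HMb crit HCg HCb HLb.
have ml := measurable_picard_lim Cg0 Cb0 delta_ge0 Mg0 Mb0 small mu0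
  heat_crit HMg HMb crit HCg HCb HLb.
have fl := picard_lim_fixed Cg0 Cb0 Lb0 delta_ge0 Mg0 Mb0 small mu0
  heat_crit HMg HMb crit HCg HCb HLb.
(* The limit lies in [X] and [W_beta], which yields the integrability clauses of [mild_solution]. *)
have [Il _] := HCb _ _ _ (mulr_ge0 (ler0n _ 2) delta_ge0) (mulr_ge0 (ler0n _ 2) Mb0)
  ml Xl Wbl.
exists (picard_lim u0).
  split; first exact: measurable_funTS.
  exists (@oseen_kernel R d); first exact: is_oseen_kernel_oseen.
  move=> t t0 _ x; have [I1 I2] := Il t x t0; split.
  - by move=> tau taut j k l; exact: I1.
  - exact: I2.
  - by apply/rowP => j; rewrite fl// sub_mxE.
(* The iteration bounds coordinates; passing to the Euclidean norm costs the factor [d]. *)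
apply: le_lt_trans (ltry (d%:R * (2 * Mg + 2 * Mb))).
apply: ge_ereal_sup => _ [t t0 [x _ <-]]; rewrite lee_fin; apply: enorm_le_sum.
  by rewrite !addr_ge0 ?powR_ge0.
by move=> j; rewrite -addrA mulrDl lerD ?Wgl ?Wbl.
Qed.
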